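(* Let $n\ge 0$ be an integer and let $u_1,\dots,u_n$ be indeterminates; write $\bar u_i=u_i^{-1}$. Then \[ \Bigl(\widetilde{Z}_{2n+1}(u_1,\dots,u_n,\bar u_1,\dots,\bar u_n,1)/s\Bigr)\Big|_{s=0,\;q^2+q^{-2}=1} =3^{-n^2}\prod_{i=1}^n\frac{(u_i+\bar u_i)^2}{u_i^2+\bar u_i^2-1}\; \mathrm{sp}_{(n,n,n-1,n-1,\dots,1,1,0,0)}\bigl(u_1^2,\dots,u_n^2,\bar u_1^2,\dots,\bar u_n^2,1,-1\bigr), \] where the left side means: divide the polynomial-in-$s$ function $\widetilde Z_{2n+1}$ by $s$, set $s=0$, and evaluate at a complex number $q$ with $q^2+q^{-2}=1$.
   Context: Notation: $\bar x=x^{-1}$, $\sigma(x)=x-x^{-1}$, $\widehat\sigma(x)=\sigma(x)/\sigma(q^4)$, where $q$ is a constant. Grid graph $T_m$: vertices are top vertices $(0,j)$ for $1\le j\le m$, left boundary vertices $(i,i)$ for $1\le i\le m$, bulk vertices $(i,j)$ for $1\le i<j\le m$, and right boundary vertices $(i,m+1)$ for $1\le i\le m$. Edges join $(i,j)$ to $(i,j+1)$ whenever both are vertices (horizontal edges, row $i$ running from $(i,i)$ to $(i,m+1)$) and $(i,j)$ to $(i+1,j)$ whenever both are vertices (vertical edges, column $j$ running from $(0,j)$ down to $(j,j)$). Thus each left boundary vertex $(i,i)$ has exactly two edges: one ''upward'' to $(i-1,i)$ and one ''rightward'' to $(i,i+1)$. A six-vertex configuration on $T_m$ is an orientation of all edges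 such that: every bulk vertex has exactly two incoming and two outgoing edges; every edge at a top vertex points toward the top vertex (upward); every edge at a right boundary vertex points away from it (leftward). Weights (specialized, with indeterminates $u_1,\dots,u_m$ and $s$): top and right boundary vertices have weight $1$. A left boundary vertex $(i,i)$ has weight $s$ if exactly one of its two edges points into it, and weight $\sigma(qu_i)/\sigma(q)$ if both point into it or both point out of it. A bulk vertex $(i,j)$ has weight: $1$ if both horizontal edges point toward it and both vertical edges point away from it, or both horizontal edges point away and both vertical point toward it; $\widehat\sigma(q^2\bar u_i\bar u_j)$ if both horizontal edges point left and both vertical edges point up (toward smaller row index), or both horizontal point right and both vertical point down; $\widehat\sigma(q^2u_iu_j)$ if both horizontal edges point left and both vertical point down, or both horizontal point right and both vertical point up. Then $\widetilde Z_m(u_1,\dots,u_m)$ is the sum over all six-vertex configurations on $T_m$ of the product of all vertex weights; it is a polynomial in $s$ with coefficients rational in the $u_i$ and $q$, and it is divisible by $s$ when $m$ is odd. Symplectic character: for a partition $\lambda=(\lambda_1\ge\dots\ge\lambda_N\ge0)$, $\mathrm{sp}_\lambda(x_1,\dots,x_N)=\det_{1\le i,j\le N}\bigl(x_i^{\lambda_j+N+1-j}-x_i^{-(\lambda_j+N+1-j)}\bigr)/\det_{1\le i,j\le N}\bigl(x_i^{N+1-j}-x_i^{-(N+1-j)}\bigr)$, a Laurent polynomial in $x_1,\dots,x_N$, which may be evaluated at any nonzero arguments. Here $N=2n+2$ and $\lambda=(n,n,n-1,n-1,\dots,0,0)$. *)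

(* Defs.v *)
From HB Require Import structures.
From mathcomp Require Import all_boot all_order all_algebra.
From mathcomp Require Import complex reals.
From mathcomp Require Import mpoly.
From Stdlib Require ClassicalEpsilon.

Set Implicit Arguments.
Unset Strict Implicit.
Unset Printing Implicit Defensive.

Import GRing.Theory.
Local Open Scope ring_scope.

Notation "x %:F" := (@FracField.tofrac _ x) : ring_scope.

(** * The grid graph T_m *)

(* A point (i, j) has row i (rows are numbered downwards) and column j. *)
Section Grid.
Local Open Scope nat_scope.
Variable m : nat.

Definition top_vertex (x : nat * nat) : bool := (x.1 == 0) && (1 <= x.2 <= m).
Definition left_vertex (x : nat * nat) : bool := (x.1 == x.2) && (1 <= x.1 <= m).
Definition bulk_vertex (x : nat * nat) : bool := (1 <= x.1) && (x.1 < x.2 <= m).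
Definition right_vertex (x : nat * nat) : bool := (1 <= x.1 <= m) && (x.2 == m.+1).

Definition grid_vertex (x : nat * nat) : bool :=
  [|| top_vertex x, left_vertex x, bulk_vertex x | right_vertex x].

(* Row 0 contains no horizontal edge and column m + 1 no vertical edge. *)
Definition horizontal_edge (x y : nat * nat) : bool :=
  [&& grid_vertex x, grid_vertex y, 1 <= x.1, y.1 == x.1 & y.2 == x.2.+1].
Definition vertical_edge (x y : nat * nat) : bool :=
  [&& grid_vertex x, grid_vertex y, x.2 <= m, y.2 == x.2 & y.1 == x.1.+1].

(* A finite box containing all the vertices of T_m. *)
Definition box : finType := ('I_m.+1 * 'I_m.+2)%type.
Definition coords (p : box) : nat * nat := (nat_of_ord p.1, nat_of_ord p.2).

(* Every edge is listed once, as the pair (left end, right end) or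
   (upper end, lower end). *)
Definition edge : finType :=
  {e : box * box | horizontal_edge (coords e.1) (coords e.2)
                   || vertical_edge (coords e.1) (coords e.2)}.

(* [o e] is true when e points from its first end to its second end, that is,
   rightwards or downwards. *)
Definition orientation : finType := {ffun edge -> bool}.

(* There is an edge between x and y, and it points from x to y. *)
Definition arrow (o : orientation) (x y : nat * nat) : bool :=
  [exists e : edge,
     let a := coords (val e).1 in let b := coords (val e).2 in
     if o e then (a == x) && (b == y) else (a == y) && (b == x)].

Definition indegree (o : orientation) (x : nat * nat) : nat :=
  #|[set p : box | arrow o (coords p) x]|.
Definition outdegree (o : orientation) (x : nat * nat) : nat :=
  #|[set p : box | arrow o x (coords p)]|.

Definition six_vertex (o : orientation) : bool :=
  [forall p : box,
     [&& bulk_vertex (coords p) ==>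
           (indegree o (coords p) == 2) && (outdegree o (coords p) == 2),
         top_vertex (coords p) ==> (outdegree o (coords p) == 0)
       & right_vertex (coords p) ==> (indegree o (coords p) == 0)]].

End Grid.

(** * Weights and partition function *)

Definition sigma (F : fieldType) (x : F) : F := x - x^-1.
Definition sigma_hat (F : fieldType) (q x : F) : F := sigma x / sigma (q ^+ 4).

Section Weights.
Variables (F : fieldType) (m : nat) (q : F).
(* u_i is the entry of index i - 1 of the list u *)
Variable u : seq F.
Variable o : orientation m.

(* The polynomial variable 'X plays the role of s. *)
Definition left_weight (i : nat) : {poly F} :=
  let up_in := arrow o (i.-1, i) (i, i) in
  let right_in := arrow o (i, i.+1) (i, i) in
  if up_in (+) right_in then 'X
  else (sigma (q * u`_i.-1) / sigma q)%:P.

Definition bulk_weight (i j : nat) : F :=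
  let left_in := arrow o (i, j.-1) (i, j) in
  let right_in := arrow o (i, j.+1) (i, j) in
  let up_in := arrow o (i.-1, j) (i, j) in
  let down_in := arrow o (i.+1, j) (i, j) in
  match left_in, right_in, up_in, down_in with
  | true, true, false, false | false, false, true, true => 1
  | false, true, false, true | true, false, true, false =>
      sigma_hat q (q ^+ 2 * (u`_i.-1)^-1 * (u`_j.-1)^-1)
  | false, true, true, false | true, false, false, true =>
      sigma_hat q (q ^+ 2 * u`_i.-1 * u`_j.-1)
  | _, _, _, _ => 0 (* excluded by [six_vertex] *)
  end.

Definition vertex_weight (x : nat * nat) : {poly F} :=
  if left_vertex m x then left_weight x.1
  else if bulk_vertex m x then (bulk_weight x.1 x.2)%:P
  else 1.

End Weights.

(* The partition function, as a polynomial in s = 'X; u = [:: u_1; ...; u_m]. *)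
Definition Ztilde (F : fieldType) (m : nat) (q : F) (u : seq F) : {poly F} :=
  \sum_(o : orientation m | six_vertex o)
    \prod_(p : box m | grid_vertex m (coords p)) vertex_weight q u o (coords p).

(** * Symplectic characters *)

(* sp_lambda(x_1, ..., x_N) as an element of F(x_1, ..., x_N).  Indices start
   at 0, so that N + 1 - j of the usual formula is N - j here. *)
Section Symplectic.
Variables (F : fieldType) (N : nat) (lambda : 'I_N -> nat).

Let x (i : 'I_N) : {fraction {mpoly F[N]}} := ('X_i : {mpoly F[N]})%:F.

Definition symplectic_character : {fraction {mpoly F[N]}} :=
  \det (\matrix_(i < N, j < N)
          (x i ^+ (lambda j + (N - j)) - x i ^- (lambda j + (N - j))))
  / \det (\matrix_(i < N, j < N) (x i ^+ (N - j) - x i ^- (N - j))).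

End Symplectic.

(* v is the value at a of the rational function f, which is regular at a.
   Writing f = g / h with h(a) <> 0 is necessary: at the points of interest the
   two determinants defining the symplectic character both vanish.  For a
   Laurent polynomial and nonzero arguments, h can be taken to be a monomial. *)
Definition is_value_at (F : fieldType) (N : nat) (f : {fraction {mpoly F[N]}})
    (a : 'I_N -> F) (v : F) : Prop :=
  exists g h : {mpoly F[N]},
    [/\ f = g%:F / h%:F, h.@[a] != 0 & v = g.@[a] / h.@[a]].

Lemma is_value_at_unique (F : fieldType) (N : nat)
    (f : {fraction {mpoly F[N]}}) (a : 'I_N -> F) (v w : F) :
  is_value_at f a v -> is_value_at f a w -> v = w.
Proof.
move=> [g [h [-> ha ->]]] [g' [h' [E ha' ->]]].
have nz (k : {mpoly F[N]}) : k.@[a] != 0 -> k%:F != 0.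
  by move=> ka; rewrite tofrac_eq0; apply: contraNneq ka => ->; rewrite meval0.
move/eqP: E; rewrite eqr_div ?nz // -!tofracM tofrac_eq => /eqP E.
by apply/eqP; rewrite eqr_div // -!mevalM E.
Qed.

Definition value_at (F : fieldType) (N : nat) (f : {fraction {mpoly F[N]}})
    (a : 'I_N -> F) : F :=
  ClassicalEpsilon.epsilon (inhabits 0) (is_value_at f a).

Definition sp (F : fieldType) (N : nat) (lambda : 'I_N -> nat) (a : 'I_N -> F) :
    F := value_at (symplectic_character F lambda) a.

(* The partition (n, n, n-1, n-1, ..., 1, 1, 0, 0) with 2n + 2 parts. *)
Definition double_staircase (n : nat) (j : 'I_(2 * n + 2)) : nat := (n - j./2)%N.

(* Main.v *)
(* Fix q with q^2 + q^-2 = 1, so that w = q^4 is a primitive cube root of unity,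
   and put x = u^2. After a diagonal gauge the grid sum becomes a state sum in
   the variables x whose weights are polynomial and satisfy the Yang-Baxter and
   reflection equations; hence it is symmetric in the x's. At s = 0 it is, up to
   a product, the "even" partition function E, and its coefficient of s is the
   "odd" one, O. When x_i x_j = w, the first row and the last column freeze, which
   gives a recursion. Interpolation in one variable from these recursions
   expresses both O(xs) and E(y, xs) as sums over a selected x in xs of the same
   quantities A_x, the product over z != x of pairw z x / (z - x) times E(xs \ x).
   If xs is closed under inversion, then A_{1/x} = x A_x, and averaging each sum
   over x <-> 1/x shows that O(xs) is proportional to E(-1, xs). Finally E with an
   even number of variables satisfies the recursion of a ratio of two symplectic
   alternants with exponents 1, 2, 4, 5, 7, 8, ... and 1, 2, 3, 4, ..., hence
   equals it up to a monomial; this is the double staircase character. *)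

Require Import Defs.
From HB Require Import structures.
From mathcomp Require Import all_boot all_order all_algebra.
From mathcomp Require Import complex reals.
From mathcomp Require Import mpoly.
From mathcomp Require Import perm ring zify.
Import GRing.Theory.
Local Open Scope ring_scope.

Set Implicit Arguments.
Unset Strict Implicit.
Unset Printing Implicit Defensive.

(** * State sums and exchange of lines *)

(** Two obstacles shape the proof. The determinants defining the symplectic character both vanish at
    the arguments u_i^2, u_i^-2, 1, -1; their ratio is therefore computed over independent
    indeterminates, where the denominator is non-zero, and comes out as a polynomial over a
    monomial, which can be evaluated at any non-zero arguments. And the odd function comes only as a
    sum over a selected variable, not as a determinant; the even function has the same kind of sum,
    with one extra argument y free to choose. Put d(x) = 1 + w - w x. Averaging the odd sum over x
    and 1/x produces the denominator d(x) x d(1/x) = x^2 - x + 1, and the value y = -1 is suggested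
    by [pairw x (-1)] = - w^2 (x^2 - x + 1). This is the origin of the argument -1 of the character
    and of the factors u^2 + u^-2 - 1 and (u + 1/u)^2. The power of 3 comes from (1 - w)^2 = - 3
    w. *)

Section StateSum.
Variables (R : comNzRingType) (T : Type).
Implicit Types (W : T -> T -> bool -> bool -> bool -> bool -> R)
  (K : T -> bool -> bool -> R) (f : seq bool -> R).

(* Line [x] enters at the top of the triangle as a column, turns at the left
   boundary with weight [K] and leaves to the right as a row, crossing each later
   line [v] with weight [W x v left top right bottom]. The states [ts] are those
   of the vertical edges above a row; the last horizontal edge carries [false].
   In terms of arrows, [true] means right or down. *)
Fixpoint row_sum W (x : T) (vs : seq T) (h : bool) f (ts : seq bool) : R :=
  match vs, ts with
  | v :: vs', t :: ts' =>
      \sum_r \sum_b W x v h t r b * row_sum W x vs' r (fun bs => f (b :: bs)) ts'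
  | _, _ => if h then 0 else f [::]
  end.

Fixpoint state_sum W K (xs : seq T) (ts : seq bool) : R :=
  match xs, ts with
  | x :: xs', t :: ts' => \sum_h K x t h * row_sum W x xs' h (state_sum W K xs') ts'
  | _, _ => 1
  end.

Lemma eq_row_sum W x vs h f g ts :
  f =1 g -> row_sum W x vs h f ts = row_sum W x vs h g ts.
Proof.
elim: vs h f g ts => [|v vs IH] h f g [|t ts] fg //=; rewrite ?fg //.
by apply: eq_bigr => r _; apply: eq_bigr => b _; rewrite (IH _ _ (fun bs => g (b :: bs))).
Qed.

Lemma row_sum0 W x vs h ts : row_sum W x vs h (fun _ => 0) ts = 0.
Proof.
elim: vs h ts => [|v vs IH] h [|t ts] //=; rewrite ?if_same //.
by rewrite big1 // => r _; rewrite big1 // => b _; rewrite IH mulr0.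
Qed.

Lemma row_sumD W x vs h f g ts :
  row_sum W x vs h (fun bs => f bs + g bs) ts
  = row_sum W x vs h f ts + row_sum W x vs h g ts.
Proof.
elim: vs h f g ts => [|v vs IH] h f g [|t ts] //=; try by case: h; rewrite ?addr0.
rewrite -big_split; apply: eq_bigr => r _; rewrite -big_split; apply: eq_bigr => b _.
by rewrite (IH _ (fun bs => f (b :: bs))) mulrDr.
Qed.

Lemma row_sumZ W x vs h c f ts :
  row_sum W x vs h (fun bs => c * f bs) ts = c * row_sum W x vs h f ts.
Proof.
elim: vs h f ts => [|v vs IH] h f [|t ts] //=; try by case: h; rewrite ?mulr0.
rewrite mulr_sumr; apply: eq_bigr => r _; rewrite mulr_sumr; apply: eq_bigr => b _.
by rewrite (IH _ (fun bs => f (b :: bs))) mulrCA.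
Qed.

Lemma row_sum_sum W x vs h (I : finType) (f : I -> seq bool -> R) ts :
  row_sum W x vs h (fun bs => \sum_i f i bs) ts = \sum_i row_sum W x vs h (f i) ts.
Proof.
rewrite unlock; elim: (index_enum I) => [|i s IH] /=; first exact: row_sum0.
by rewrite row_sumD IH.
Qed.

End StateSum.

Section Intertwine.
Variables (R : comNzRingType) (T : Type).
Variable W : T -> T -> bool -> bool -> bool -> bool -> R.
Variable K : T -> bool -> bool -> R.
Variables v1 v2 : T.
(* [X t1 t2 s1 s2] is the weight of the auxiliary vertex exchanging the lines
   of parameters [v1] and [v2]. *)
Variables (X : bool -> bool -> bool -> bool -> R) (a : R).

Hypothesis yang_baxter_columns : forall x h t1 t2 r b1 b2,
  \sum_s1 \sum_s2 X t1 t2 s1 s2 * (\sum_m W x v1 h s1 m b1 * W x v2 m s2 r b2)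
  = \sum_s1 \sum_s2 (\sum_m W x v2 h t1 m s1 * W x v1 m t2 r s2) * X s1 s2 b1 b2.

Hypothesis yang_baxter_rows : forall y r h t r' h' b,
  \sum_s1 \sum_s2 X r h s1 s2 * (\sum_m W v1 y s1 t r' m * W v2 y s2 m h' b)
  = \sum_s1 \sum_s2 (\sum_m W v2 y r t s1 m * W v1 y h m s2 b) * X s1 s2 r' h'.

Hypothesis reflection : forall t1 t2 r h,
  \sum_s1 \sum_s2 X t1 t2 s1 s2 *
     (\sum_m \sum_b K v1 s1 m * W v1 v2 m s2 r b * K v2 b h)
  = \sum_s1 \sum_s2
     (\sum_m \sum_b K v2 t1 m * W v2 v1 m t2 s1 b * K v1 b s2) * X s1 s2 r h.

Hypothesis X_false : forall r h,
  X r h false false = if r || h then 0 else a.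

(** [X] sits above two adjacent columns; the Yang-Baxter equation moves it below the row, where the
    hypothesis on [f] and [g] absorbs it. That hypothesis allows any prefix of the right length, so
    that the induction can put the states of crossed columns in front. *)
Lemma row_sum_exchange pre post x h f g :
  (forall tpre t1 t2 tpost, size tpre = size pre ->
     \sum_s1 \sum_s2 X t1 t2 s1 s2 * f (tpre ++ s1 :: s2 :: tpost)
     = a * g (tpre ++ t1 :: t2 :: tpost)) ->
  forall tpre t1 t2 tpost, size tpre = size pre ->
   \sum_s1 \sum_s2 X t1 t2 s1 s2 *
      row_sum W x (pre ++ v1 :: v2 :: post) h f (tpre ++ s1 :: s2 :: tpost)
   = a * row_sum W x (pre ++ v2 :: v1 :: post) h g (tpre ++ t1 :: t2 :: tpost).
Proof.
elim: pre h f g => [|v pre IH] h f g fg [|t tpre] // t1 t2 tpost; last first.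
  move=> [sz] /=; rewrite mulr_sumr.
  transitivity (\sum_r \sum_b \sum_s1 \sum_s2 W x v h t r b * (X t1 t2 s1 s2 *
     row_sum W x (pre ++ v1 :: v2 :: post) r (fun bs => f (b :: bs))
        (tpre ++ s1 :: s2 :: tpost))).
    by rewrite !big_bool /=; ring.
  apply: eq_bigr => r _; rewrite mulr_sumr; apply: eq_bigr => b _.
  rewrite [RHS]mulrCA -(IH _ (fun bs => f (b :: bs))) //.
    by rewrite mulr_sumr; apply: eq_bigr => s1 _; rewrite mulr_sumr.
  by move=> tpre' t1' t2' tpost' sz'; rewrite -(fg (b :: tpre')) //= sz'.
move=> _; rewrite /=.
pose F r b1 b2 := row_sum W x post r (fun bs => f (b1 :: b2 :: bs)) tpost.
pose G r b1 b2 := row_sum W x post r (fun bs => g (b1 :: b2 :: bs)) tpost.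
have FG r b1 b2 : \sum_s1 \sum_s2 X b1 b2 s1 s2 * F r s1 s2 = a * G r b1 b2.
  rewrite -row_sumZ.
  under [in RHS]eq_row_sum => bs do rewrite -(fg [::] b1 b2 bs erefl).
  rewrite row_sum_sum; apply: eq_bigr => s1 _; rewrite row_sum_sum.
  by apply: eq_bigr => s2 _; rewrite row_sumZ.
transitivity (\sum_r \sum_b1 \sum_b2 (\sum_s1 \sum_s2 X t1 t2 s1 s2 *
   (\sum_m W x v1 h s1 m b1 * W x v2 m s2 r b2)) * F r b1 b2).
  by rewrite !big_bool /F /=; ring.
transitivity (\sum_r \sum_s1 \sum_s2 (\sum_m W x v2 h t1 m s1 * W x v1 m t2 r s2)
   * (\sum_b1 \sum_b2 X s1 s2 b1 b2 * F r b1 b2)).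
  apply: eq_bigr => r _.
  under eq_bigr => b1 _ do under eq_bigr => b2 _ do rewrite yang_baxter_columns.
  by rewrite !big_bool /=; ring.
transitivity (\sum_r \sum_s1 \sum_s2 (\sum_m W x v2 h t1 m s1 * W x v1 m t2 r s2)
   * (a * G r s1 s2)).
  by do 3 (apply: eq_bigr => ? _); rewrite -FG.
by rewrite !big_bool /G /=; ring.
Qed.

(** Here [X] enters at the left of two stacked rows and travels right past one column at a time; at
    the right boundary both states are [false], and [X_false] turns it into the scalar [a]. *)
Lemma row_sum2_exchange post f r h ts :
  \sum_s1 \sum_s2 X r h s1 s2 * row_sum W v1 post s1 (row_sum W v2 post s2 f) ts
  = a * row_sum W v2 post r (row_sum W v1 post h f) ts.
Proof.
elim: post f r h ts => [|y post IH] f r h ts.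
  by rewrite /= !big_bool !X_false; case: r; case: h; rewrite /=; ring.
case: ts => [|t ts].
  by rewrite /= !big_bool !X_false; case: r; case: h; rewrite /=; ring.
rewrite /=.
pose F (z1 z2 : T) r2 h2 b :=
  row_sum W z1 post r2 (row_sum W z2 post h2 (fun bs => f (b :: bs))) ts.
have E z1 z2 s2 r2 m : row_sum W z1 post r2 (fun bs =>
    \sum_h2 \sum_b W z2 y s2 m h2 b * row_sum W z2 post h2 (fun bs' => f (b :: bs')) bs) ts
    = \sum_h2 \sum_b W z2 y s2 m h2 b * F z1 z2 r2 h2 b.
  rewrite row_sum_sum; apply: eq_bigr => h2 _; rewrite row_sum_sum.
  by apply: eq_bigr => b _; rewrite row_sumZ.
under eq_bigr => s1 _ do under eq_bigr => s2 _ do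
  under eq_bigr => r2 _ do under eq_bigr => m _ do rewrite E.
under [in RHS]eq_bigr => r2 _ do under eq_bigr => m _ do rewrite E.
transitivity (\sum_r' \sum_h' \sum_b (\sum_s1 \sum_s2 X r h s1 s2 *
   (\sum_m W v1 y s1 t r' m * W v2 y s2 m h' b)) * F v1 v2 r' h' b).
  by rewrite !big_bool /=; ring.
transitivity (\sum_b \sum_s1 \sum_s2 (\sum_m W v2 y r t s1 m * W v1 y h m s2 b)
   * (\sum_r' \sum_h' X s1 s2 r' h' * F v1 v2 r' h' b)).
  under eq_bigr => r' _ do under eq_bigr => h' _ do
    under eq_bigr => b _ do rewrite yang_baxter_rows.
  by rewrite !big_bool /=; ring.
transitivity (\sum_b \sum_s1 \sum_s2
   (\sum_m W v2 y r t s1 m * W v1 y h m s2 b) * (a * F v2 v1 s1 s2 b)).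
  by do 3 (apply: eq_bigr => ? _); rewrite -IH.
by rewrite /F !big_bool /=; ring.
Qed.

(** [X] enters above the columns of [v1] and [v2], descends through the rows of [pre], passes the
    two turns and the crossing between them by reflection, and leaves along the two rows. *)
Lemma state_sum_exchange pre post tpre t1 t2 tpost : size tpre = size pre ->
  \sum_s1 \sum_s2 X t1 t2 s1 s2 *
     state_sum W K (pre ++ v1 :: v2 :: post) (tpre ++ s1 :: s2 :: tpost)
  = a * state_sum W K (pre ++ v2 :: v1 :: post) (tpre ++ t1 :: t2 :: tpost).
Proof.
elim: pre tpre t1 t2 tpost => [|x pre IH] [|t tpre] // t1 t2 tpost.
  move=> _ /=.
  pose F (z1 z2 : T) r h :=
    row_sum W z1 post r (row_sum W z2 post h (state_sum W K post)) tpost.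
  have E z1 z2 r b : row_sum W z1 post r (fun bs => \sum_h K z2 b h *
      row_sum W z2 post h (state_sum W K post) bs) tpost = \sum_h K z2 b h * F z1 z2 r h.
    by rewrite row_sum_sum; apply: eq_bigr => h _; rewrite row_sumZ.
  under eq_bigr => s1 _ do under eq_bigr => s2 _ do under eq_bigr => h _ do
    under eq_bigr => r _ do under eq_bigr => b _ do rewrite E.
  under [in RHS]eq_bigr => s1 _ do under eq_bigr => s2 _ do
     under eq_bigr => h _ do rewrite E.
  transitivity (\sum_r \sum_h (\sum_s1 \sum_s2 X t1 t2 s1 s2 *
     (\sum_m \sum_b K v1 s1 m * W v1 v2 m s2 r b * K v2 b h)) * F v1 v2 r h).
    by rewrite !big_bool /=; ring.
  transitivity (\sum_s1 \sum_s2
     (\sum_m \sum_b K v2 t1 m * W v2 v1 m t2 s1 b * K v1 b s2)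
     * (\sum_r \sum_h X s1 s2 r h * F v1 v2 r h)).
    under eq_bigr => r _ do under eq_bigr => h _ do rewrite reflection.
    by rewrite !big_bool /=; ring.
  transitivity (\sum_s1 \sum_s2
     (\sum_m \sum_b K v2 t1 m * W v2 v1 m t2 s1 b * K v1 b s2) * (a * F v2 v1 s1 s2)).
    by do 2 (apply: eq_bigr => ? _); rewrite -row_sum2_exchange.
  by rewrite /F !big_bool /=; ring.
move=> [sz] /=; rewrite mulr_sumr.
transitivity (\sum_h K x t h * (\sum_s1 \sum_s2 X t1 t2 s1 s2 *
  row_sum W x (pre ++ v1 :: v2 :: post) h (state_sum W K (pre ++ v1 :: v2 :: post))
    (tpre ++ s1 :: s2 :: tpost))).
  by rewrite !big_bool /=; ring.
apply: eq_bigr => h _; rewrite [RHS]mulrCA; congr (_ * _).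
by apply: row_sum_exchange => // *; exact: IH.
Qed.

End Intertwine.

(** * Ice weights at a cube root of unity: Yang-Baxter and reflection equations *)

Section IceWeights.
Variables (R : comNzRingType) (w : R).

(** The two turning cases differ because of the gauge: with [x = u ^+ 2] and [y = v ^+ 2], it trades
    equal weights proportional to [u * v] for [y] and [x], which avoids square roots. *)
Definition ice_weight (x y : R) (l t r b : bool) : R :=
  if (l == r) && (t == b) then if l == t then x * y - w else 1 - w * x * y
  else if [&& l, ~~ t, ~~ r & b] then (1 - w) * y
  else if [&& ~~ l, t, r & ~~ b] then (1 - w) * x
  else 0.

(* With [e = false] and [s = 0] the common factor [1 + w - w * x] is dropped. *)
Definition rho (e : bool) (x : R) : R := if e then 1 + w - w * x else 1.

Definition turn_weight (s : R) (e : bool) (x : R) (t h : bool) : R :=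
  if t == h then s * x else if t then rho e x else x * rho e x.

(** The R-matrix of the six-vertex model up to a scalar; under [hw] below, [- (1 + w)] is [w * w].
    The entry [v2 - w * v1] on equal states is the scalar that survives at the boundary. *)
Definition exchange_weight (v1 v2 : R) (t1 t2 s1 s2 : bool) : R :=
  if t1 == t2 then if (s1 == t1) && (s2 == t1) then v2 - w * v1 else 0
  else if s1 == s2 then 0
  else if s1 == t1 then (1 - w) * (if t1 then v1 else v2)
  else - (1 + w) * (v1 - v2).

Hypothesis hw : w * w = - 1 - w.

Lemma ice_yang_baxter_columns v1 v2 x h t1 t2 r b1 b2 :
  \sum_s1 \sum_s2 exchange_weight v1 v2 t1 t2 s1 s2 *
     (\sum_m ice_weight x v1 h s1 m b1 * ice_weight x v2 m s2 r b2)
  = \sum_s1 \sum_s2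
      (\sum_m ice_weight x v2 h t1 m s1 * ice_weight x v1 m t2 r s2)
        * exchange_weight v1 v2 s1 s2 b1 b2.
Proof.
rewrite !big_bool /ice_weight /exchange_weight.
by case: h; case: t1; case: t2; case: r; case: b1; case: b2; rewrite /=; ring: hw.
Qed.

Lemma ice_yang_baxter_rows v1 v2 y r h t r' h' b :
  \sum_s1 \sum_s2 exchange_weight v1 v2 r h s1 s2 *
     (\sum_m ice_weight v1 y s1 t r' m * ice_weight v2 y s2 m h' b)
  = \sum_s1 \sum_s2
      (\sum_m ice_weight v2 y r t s1 m * ice_weight v1 y h m s2 b)
        * exchange_weight v1 v2 s1 s2 r' h'.
Proof.
rewrite !big_bool /ice_weight /exchange_weight.
by case: h; case: t; case: r; case: b; case: r'; case: h'; rewrite /=; ring: hw.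
Qed.

(** When [s = 0], every product of two turns carries the common factor [rho e v1 * rho e v2] on both
    sides, so the relation persists with [rho] dropped. *)
Lemma ice_reflection s e v1 v2 t1 t2 r h : e || (s == 0) ->
  \sum_s1 \sum_s2 exchange_weight v1 v2 t1 t2 s1 s2 *
     (\sum_m \sum_b turn_weight s e v1 s1 m * ice_weight v1 v2 m s2 r b
        * turn_weight s e v2 b h)
  = \sum_s1 \sum_s2
     (\sum_m \sum_b turn_weight s e v2 t1 m * ice_weight v2 v1 m t2 s1 b
        * turn_weight s e v1 b s2) * exchange_weight v1 v2 s1 s2 r h.
Proof.
rewrite !big_bool /ice_weight /exchange_weight /turn_weight /rho.
case: e => [_|/eqP ->];
  by case: t1; case: t2; case: r; case: h; rewrite /=; ring: hw.
Qed.

Definition ice_sum s e := state_sum ice_weight (turn_weight s e).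
Definition ice_pf s e xs := ice_sum s e xs (nseq (size xs) false).

(** With all top states [false], the auxiliary vertex is a scalar at its entrance as well as at its
    exit, and it is the same scalar. *)
Lemma ice_pf_exchange s e pre post v1 v2 : e || (s == 0) ->
  (v2 - w * v1) * ice_pf s e (pre ++ v1 :: v2 :: post)
  = (v2 - w * v1) * ice_pf s e (pre ++ v2 :: v1 :: post).
Proof.
move=> es; have X00 r h : exchange_weight v1 v2 r h false false =
    if r || h then 0 else v2 - w * v1 by case: r; case: h.
have /= := state_sum_exchange (@ice_yang_baxter_columns v1 v2)
  (@ice_yang_baxter_rows v1 v2) (fun t1 t2 r h => @ice_reflection s e v1 v2 t1 t2 r h es)
  X00 post false false (nseq (size post) false) (size_nseq (size pre) false).
by rewrite !big_bool /= /exchange_weight /= !(mul0r, add0r)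
  /ice_pf /ice_sum !size_cat /= !nseqD /=.
Qed.

End IceWeights.

(** * Compatibility of the sums with ring morphisms *)

Section Morphism.
Variables (R S : comNzRingType) (phi : {rmorphism R -> S}).

Lemma rmorph_row_sum w x vs h f g ts : (forall bs, phi (f bs) = g bs) ->
  phi (row_sum (ice_weight w) x vs h f ts)
  = row_sum (ice_weight (phi w)) (phi x) (map phi vs) h g ts.
Proof.
elim: vs h f g ts => [|v vs IH] h f g [|t ts] fg /=;
  rewrite ?[phi (if _ then _ else _)]fun_if ?rmorph0 ?fg //.
rewrite rmorph_sum; apply: eq_bigr => r _; rewrite rmorph_sum; apply: eq_bigr => b _.
rewrite rmorphM (IH _ _ (fun bs => g (b :: bs))) //; congr (_ * _).
by rewrite /ice_weight; do !case: ifP => _; rewrite ?(rmorphM, rmorphB, rmorph1, rmorph0).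
Qed.

Lemma rmorph_ice_sum w s e xs ts :
  phi (ice_sum w s e xs ts) = ice_sum (phi w) (phi s) e (map phi xs) ts.
Proof.
elim: xs ts => [|x xs IH] [|t ts] /=; rewrite ?rmorph1 //.
rewrite rmorph_sum; apply: eq_bigr => h _; rewrite rmorphM (rmorph_row_sum _ _ _ _ _ IH).
congr (_ * _); rewrite /turn_weight /rho.
by do !case: ifP => _; rewrite ?(rmorphM, rmorphB, rmorphD, rmorph1, rmorph0).
Qed.

Lemma rmorph_ice_pf w s e xs :
  phi (ice_pf w s e xs) = ice_pf (phi w) (phi s) e (map phi xs).
Proof. by rewrite /ice_pf rmorph_ice_sum size_map. Qed.

End Morphism.

Lemma perm_adjacent_inv (T : eqType) (S : Type) (g : seq T -> S) :
  (forall pre post x y, g (pre ++ x :: y :: post) = g (pre ++ y :: x :: post)) ->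
  forall xs ys, perm_eq xs ys -> g xs = g ys.
Proof.
move=> gX.
have mv pre mid x post : g (pre ++ x :: mid ++ post) = g (pre ++ mid ++ x :: post).
  elim: mid pre => [|y mid IH] pre //=.
  by rewrite gX -cat_rcons IH cat_rcons.
suff H xs ys pre : perm_eq xs ys -> g (pre ++ xs) = g (pre ++ ys) by move=> *; exact: (H _ _ [::]).
elim: xs ys pre => [|x xs IH] ys pre; first by rewrite perm_sym => /perm_nilP ->.
move=> pxy; have xy: x \in ys by rewrite -(perm_mem pxy) mem_head.
case/splitPr: xy pxy => [y1 y2] pxy.
rewrite -mv -!(cat_rcons x); apply: IH.
by rewrite -(perm_cons x) (permPl pxy) perm_sym -cat1s perm_catCA.
Qed.

(** The exchange factor may vanish at the given arguments. One of them is therefore replaced by the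
    indeterminate ['X], which makes the factor a non-zero polynomial; it is cancelled, and
    evaluation at [x] gives the claim. *)
Lemma ice_pf_perm (R : idomainType) (w s : R) e xs ys :
  w * w = - 1 - w -> w != 0 -> e || (s == 0) -> perm_eq xs ys ->
  ice_pf w s e xs = ice_pf w s e ys.
Proof.
move=> hw w0 es; apply: perm_adjacent_inv => {xs ys} pre post x y.
pose ev : {rmorphism {poly R} -> R} := horner_eval x.
have evC c : ev c%:P = c by rewrite /= /horner_eval hornerC.
have evX : ev 'X = x by rewrite /= /horner_eval hornerX.
have mC l : map ev (map polyC l) = l by rewrite -map_comp map_id_in // => z _; exact: evC.
have hwP : w%:P * w%:P = - 1 - w%:P by rewrite -polyCM hw polyCB polyCN.
have esP : e || (s%:P == 0) by rewrite polyC_eq0.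
have /mulfI E := ice_pf_exchange hwP (map polyC pre) (map polyC post) 'X y%:P esP.
have /E/(congr1 ev) : y%:P - w%:P * 'X != 0.
  apply: contraNneq w0 => /(congr1 (coefp 1)) /eqP.
  by rewrite /= coefB coefC coefCM coefX mulr1 coef0 sub0r oppr_eq0.
by rewrite !rmorph_ice_pf !map_cat /= !mC !evC evX.
Qed.

(** * Degree bounds and interpolation *)

Section PolySize.
Variable R : nzRingType.
Implicit Types p q : {poly R}.

Lemma size_mul_leq_add p q k l :
  (size p <= k.+1 -> size q <= l -> size (p * q)%R <= k + l)%N.
Proof.
move=> sp sq; rewrite (leq_trans (size_polyMleq _ _)) //.
by rewrite -[(k + l)%N]/((k.+1 + l).-1) -!subn1 leq_sub2r // leq_add.
Qed.

Lemma size_prod_leq_mul (T : Type) (s : seq T) (f : T -> {poly R}) k :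
  (forall z, size (f z) <= k.+1)%N -> (size (\prod_(z <- s) f z)%R <= (size s * k).+1)%N.
Proof.
move=> fk; elim: s => [|z s IH]; first by rewrite big_nil size_poly1.
by rewrite big_cons /= mulSn -addnS size_mul_leq_add.
Qed.

Lemma size_lin_leq (a b : R) : (size (a%:P * 'X + b%:P)%R <= 2)%N.
Proof.
rewrite (leq_trans (size_polyD _ _)) // geq_max (leq_trans (size_polyC_leq1 _)) // andbT.
by rewrite (@size_mul_leq_add _ _ 0 2) ?size_polyC_leq1 ?size_polyX.
Qed.

End PolySize.

Lemma poly_eq_on (R : idomainType) (p q : {poly R}) (rs : seq R) : uniq rs -> (size p <= size rs)%N ->
  (size q <= size rs)%N -> {in rs, forall r, p.[r] = q.[r]} -> p = q.
Proof.
move=> urs sp sq pq; apply/eqP; rewrite -subr_eq0; apply/eqP.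
apply: (roots_geq_poly_eq0 (rs := rs)) => //.
  by apply/allP => r /pq pqr; rewrite rootE hornerD hornerN pqr subrr.
by rewrite (leq_trans (size_polyD _ _)) // size_polyN geq_max sp.
Qed.

(** * Corner recursion *)

Section Recursion.
Variables (R : comNzRingType) (w : R).
Local Notation W := (ice_weight w).
Local Notation row := (row_sum W).

Lemma eq_row_sum_size (f g : seq bool -> R) x vs h ts : size ts = size vs ->
  (forall bs, size bs = size vs -> f bs = g bs) -> row x vs h f ts = row x vs h g ts.
Proof.
elim: vs h f g ts => [|v vs IH] h f g [|t ts] //= => [_|[sz]] fg; rewrite ?fg //.
apply: eq_bigr => r _; apply: eq_bigr => b _; congr (_ * _).
by apply: IH => // bs sb; rewrite fg //= sb.
Qed.

(** At the last crossing the top state is [true] and the right one [false]; the ice rule leaves only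
    left [false] and bottom [true], so the downward arrow passes straight through. *)
Lemma row_sum_rcons_true x vs z h f ts : size ts = size vs ->
  row x (rcons vs z) h f (rcons ts true)
  = (1 - w * x * z) * row x vs h (fun bs => f (rcons bs true)) ts.
Proof.
elim: vs h f ts => [|v vs IH] h f [|t ts] //= => [_|[sz]].
  by rewrite !big_bool /= /ice_weight; case: h => /=; ring.
rewrite mulr_sumr; apply: eq_bigr => r _; rewrite mulr_sumr; apply: eq_bigr => b _.
by rewrite (IH _ (fun bs => f (b :: bs))) // mulrCA.
Qed.

(** The straight weight [x * z - w] vanishes at the last crossing, so the row must turn down there.
    Under [false] top states, this forces [true] on all its earlier edges. *)
Lemma row_sum_rcons_corner x vs z h f : x * z = w ->
  row x (rcons vs z) h f (nseq (size vs).+1 false)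
  = if h then \prod_(v <- vs) (1 - w * x * v) * ((1 - w) * z)
              * f (rcons (nseq (size vs) false) true) else 0.
Proof.
move=> xz; elim: vs h f => [|v vs IH] h f.
  by rewrite /= !big_bool /= /ice_weight big_nil; case: h; rewrite /= ?xz; ring.
rewrite [LHS]/= !big_bool !IH /= /ice_weight big_cons; case: h => /=; ring.
Qed.

Lemma row_sum_false x vs f :
  row x vs false f (nseq (size vs) false)
  = \prod_(v <- vs) (x * v - w) * f (nseq (size vs) false).
Proof.
elim: vs f => [|v vs IH] f; first by rewrite /= big_nil mul1r.
by rewrite /= !big_bool /= /ice_weight /= !mul0r !add0r IH big_cons; ring.
Qed.

(** The arrow frozen in the last column runs down to its own turn; no line remains to the right, so
    the horizontal state is [false] and the turn has weight [rho w e z]. *)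
Lemma ice_sum_rcons_true s e xs z ts : size ts = size xs ->
  ice_sum w s e (rcons xs z) (rcons ts true)
  = \prod_(x <- xs) (1 - w * x * z) * rho w e z * ice_sum w s e xs ts.
Proof.
rewrite /ice_sum; elim: xs ts => [|x xs IH] [|t ts] //= => [_|[sz]].
  by rewrite big_bool /= /turn_weight big_nil /=; ring.
rewrite mulr_sumr; apply: eq_bigr => h _; rewrite row_sum_rcons_true //.
rewrite (eq_row_sum_size _ _ _ (fun bs sb => IH bs sb)) // row_sumZ big_cons.
by ring.
Qed.

Lemma ice_pf_corner s e x xs z : x * z = w ->
  ice_pf w s e (x :: rcons xs z)
  = (1 - w) * w * rho w e x * rho w e z
    * \prod_(v <- xs) ((1 - w * x * v) * (1 - w * z * v)) * ice_pf w s e xs.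
Proof.
move=> xz; rewrite /ice_pf /ice_sum /= size_rcons big_bool !(row_sum_rcons_corner _ _ _ xz).
rewrite /= mulr0 addr0 [state_sum _ _ _ _]ice_sum_rcons_true ?size_nseq //.
have -> : turn_weight w s e x false true = x * rho w e x by [].
have -> : (1 - w) * w = (1 - w) * (x * z) by rewrite xz.
rewrite big_split /= /ice_sum.
under [X in _ = _ * (_ * X) * _]eq_bigr => v _ do rewrite -mulrA (mulrC z) mulrA.
by ring.
Qed.

Lemma ice_pf_cons s e x xs :
  ice_pf w s e (x :: xs)
  = s * x * \prod_(v <- xs) (x * v - w) * ice_pf w s e xs
    + x * rho w e x * row x xs true (ice_sum w s e xs) (nseq (size xs) false).
Proof.
by rewrite /ice_pf /ice_sum /= big_bool row_sum_false /turn_weight /=; ring.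
Qed.

(** Each crossing is at most linear in [y]. A row that starts with [true] must drop to [false]
    before its right end, and the crossing where it drops has the weight [(1 - w) * v], constant in
    [y]; hence one degree less when [h] holds. *)
Lemma row_sum_poly xs h f ts : exists2 p : {poly R}, (size p <= size xs + ~~ h)%N
  & forall y, row y xs h f ts = p.[y].
Proof.
elim: xs h f ts => [|v xs IH] h f ts.
  exists (if h then 0 else (f [::])%:P) => [|y]; last by case: h; rewrite ?horner0 ?hornerC.
  by case: h; rewrite ?size_poly0 //= size_polyC_leq1.
case: ts => [|t ts].
  exists (if h then 0 else (f [::])%:P) => [|y]; last by case: h; rewrite ?horner0 ?hornerC.
  by case: h; rewrite ?size_poly0 //= (leq_trans (size_polyC_leq1 _)) // addn1.
have Wp r b : exists2 q : {poly R},
    forall p : {poly R}, (size p <= size xs + ~~ r)%N ->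
       (size (q * p)%R <= size (v :: xs) + ~~ h)%N
    & forall y, W y v h t r b = q.[y].
  pose c1 := if (h == r) && (t == b) then if h == t then v else - w * v
             else if [&& ~~ h, t, r & ~~ b] then 1 - w else 0.
  pose c0 := if (h == r) && (t == b) then if h == t then - w else 1
             else if [&& h, ~~ t, ~~ r & b] then (1 - w) * v else 0.
  exists (c1%:P * 'X + c0%:P) => [p sp|y]; last first.
    by rewrite !hornerE /ice_weight /c1 /c0; case: (h) (t) (r) (b) => [] [] [] [] /=; ring.
  case hE: h; case rE: r sp => /= sp; rewrite ?addn0 ?addn1 in sp *.
  - by rewrite -add1n (@size_mul_leq_add _ _ _ 1) ?size_lin_leq // -[size xs]addn0.
  - apply: (@size_mul_leq_add _ _ _ 0) => //.
    by rewrite /c1 hE rE /= mul0r add0r size_polyC_leq1.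
  - by rewrite -add2n (@size_mul_leq_add _ _ _ 1) ?size_lin_leq // ltnW.
  - by rewrite -add1n (@size_mul_leq_add _ _ _ 1) ?size_lin_leq.
have sumP (F : bool -> R -> R) k :
    (forall i, exists2 p : {poly R}, (size p <= k)%N & forall y, F i y = p.[y]) ->
    exists2 p : {poly R}, (size p <= k)%N & forall y, \sum_i F i y = p.[y].
  move=> FP; have [p ps pE] := FP true; have [q qs qE] := FP false.
  exists (p + q) => [|y]; last by rewrite big_bool hornerD -pE -qE.
  by rewrite (leq_trans (size_polyD _ _)) // geq_max ps.
apply: (sumP) => r; apply: (sumP) => b.
have [q qs qE] := Wp r b; have [p ps pE] := IH r (fun bs => f (b :: bs)) ts.
by exists (q * p) => [|y]; [exact: qs | rewrite hornerM -qE -pE].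
Qed.

End Recursion.

(** * Sums over a selected element of a list *)

Section SelectionSum.
Variables (T : eqType) (R : zmodType).
Implicit Types (G : T -> seq T -> R).

Definition sel_sum G xs := \sum_(x <- xs) G x (rem x xs).

Lemma eq_sel_sum G H xs : {in xs, forall x, G x (rem x xs) = H x (rem x xs)} ->
  sel_sum G xs = sel_sum H xs.
Proof. by move=> GH; apply: eq_big_seq. Qed.

Lemma sel_sum_cons G x xs : x \notin xs ->
  sel_sum G (x :: xs) = G x xs + sel_sum (fun y zs => G y (x :: zs)) xs.
Proof.
move=> nx; rewrite /sel_sum big_cons /= eqxx; congr (_ + _).
apply: eq_big_seq => y yxs; case: eqP => // xy.
by rewrite xy yxs in nx.
Qed.

Lemma perm_rem (x : T) xs ys : perm_eq xs ys -> perm_eq (rem x xs) (rem x ys).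
Proof.
move=> pxy; have [xxs|nx] := boolP (x \in xs); last first.
  by rewrite !rem_id // -(perm_mem pxy).
rewrite -(perm_cons x) -(permPl (perm_to_rem xxs)) (permPl pxy) perm_to_rem //.
by rewrite -(perm_mem pxy).
Qed.

Lemma remC (x y : T) s : uniq s -> rem x (rem y s) = rem y (rem x s).
Proof.
move=> us; rewrite !rem_filter ?filter_uniq //.
by rewrite -!filter_predI; apply: eq_filter => z /=; rewrite andbC.
Qed.

Lemma map_rem (f : T -> T) x s : injective f ->
  rem (f x) (map f s) = map f (rem x s).
Proof.
move=> fI; elim: s => [|y s IH] //=; rewrite (inj_eq fI).
by case: ifP => //= _; rewrite IH.
Qed.

Lemma sel_sum_perm G xs ys : (forall x zs zs', perm_eq zs zs' -> G x zs = G x zs') ->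
  perm_eq xs ys -> sel_sum G xs = sel_sum G ys.
Proof.
move=> Gp pxy; rewrite /sel_sum (perm_big _ pxy) /=.
by apply: eq_bigr => x _; apply/Gp/perm_rem.
Qed.

Lemma sel_sumD G H xs :
  sel_sum (fun x zs => G x zs + H x zs) xs = sel_sum G xs + sel_sum H xs.
Proof. exact: big_split. Qed.

(** Each ordered pair cancels against its transpose; removing one element at a time pairs them
    without a division by 2. *)
Lemma sel_sum_antisym (G : T -> T -> seq T -> R) xs : uniq xs ->
  (forall x y zs, G x y zs = - G y x zs) ->
  sel_sum (fun x zs => sel_sum (G x) zs) xs = 0.
Proof.
elim: xs G => [|x xs IH] G /=; first by rewrite /sel_sum big_nil.
move=> /andP[nx uxs] GN; rewrite sel_sum_cons //.
rewrite [X in _ + X](@eq_sel_sum _ (fun y zs => G y x zs + sel_sum (fun z zs' => G y z (x :: zs')) zs)).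
  rewrite sel_sumD IH // addr0 -sel_sumD /sel_sum big1 // => y _.
  by rewrite /= GN addNr.
move=> y yxs; rewrite sel_sum_cons //; apply: contra nx; exact: mem_rem.
Qed.

End SelectionSum.

(** * Even and odd partition functions *)

Section CubeRoot.
Variables (F : fieldType) (w : F).
Hypothesis hw : w * w = - 1 - w.

Lemma cube_root_neq0 : w != 0.
Proof.
apply: contra_eq_neq hw => ->; rewrite mulr0 subr0 eq_sym oppr_eq0; exact: oner_neq0.
Qed.
Let w0 := cube_root_neq0.

Definition even_pf xs := ice_pf w 0 false xs.
Definition odd_pf xs := (ice_pf w%:P 'X true (map polyC xs))`_1.
Local Notation E := even_pf.
Local Notation O := odd_pf.
Local Notation d := (rho w true).

(** Up to the factor [w], the product of the two straight weights of the crossing of [z] and [x].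
    The factor [w] makes [pairw_corner] hold without a constant, since the powers of [w] there
    collect to [w ^+ 3 = 1]. *)
Definition pairw (z x : F) := w * (z * x - w) * (1 - w * z * x).
Local Notation b := pairw.
Definition selw (x : F) zs := \prod_(z <- zs) (b z x / (z - x)) * E zs.

Let hwP : w%:P * w%:P = - 1 - w%:P :> {poly F}.
Proof. by rewrite -polyCM hw polyCB polyCN. Qed.

Lemma even_pf_perm xs ys : perm_eq xs ys -> E xs = E ys.
Proof. by apply: ice_pf_perm => //=; rewrite eqxx. Qed.

Lemma odd_pf_perm xs ys : perm_eq xs ys -> O xs = O ys.
Proof.
move=> pxy; rewrite /O (@ice_pf_perm _ _ _ _ _ (map polyC ys)) ?polyC_eq0 //.
exact: perm_map.
Qed.

Lemma selw_perm x zs zs' : perm_eq zs zs' -> selw x zs = selw x zs'.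
Proof. by move=> pz; rewrite /selw (perm_big _ pz) (even_pf_perm pz). Qed.

Lemma even_pf_corner x xs z : x * z = w -> z \in xs ->
  E (x :: xs) = (1 - w) * w * \prod_(v <- rem z xs) ((1 - w * x * v) * (1 - w * z * v))
                * E (rem z xs).
Proof.
move=> xz zxs; rewrite (@even_pf_perm _ (x :: rcons (rem z xs) z)).
  by rewrite /E ice_pf_corner // /rho !mulr1.
by rewrite perm_cons perm_sym perm_rcons perm_sym perm_to_rem.
Qed.

Lemma odd_pf_corner x xs z : x * z = w -> z \in xs ->
  O (x :: xs) = (1 - w) * w * d x * d z
     * \prod_(v <- rem z xs) ((1 - w * x * v) * (1 - w * z * v)) * O (rem z xs).
Proof.
move=> xz zxs; rewrite (@odd_pf_perm _ (x :: rcons (rem z xs) z)); last first.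
  by rewrite perm_cons perm_sym perm_rcons perm_sym perm_to_rem.
rewrite /O /= map_rcons ice_pf_corner; last by rewrite -polyCM xz.
have -> : (1 - w%:P) * w%:P * rho w%:P true x%:P * rho w%:P true z%:P *
    \prod_(v <- map polyC (rem z xs)) ((1 - w%:P * x%:P * v) * (1 - w%:P * z%:P * v))
  = ((1 - w) * w * d x * d z *
     \prod_(v <- rem z xs) ((1 - w * x * v) * (1 - w * z * v)))%:P :> {poly F}.
  rewrite big_map rmorphM rmorph_prod /rho !(rmorphM, rmorphB, rmorphD, rmorph1) /=.
  congr (_ * _); apply: eq_bigr => v _.
  by rewrite !(polyCM, polyCB, polyC1).
by rewrite coefCM.
Qed.

Lemma row_sum_coef x xs h (f : seq bool -> {poly F}) ts k :
  (row_sum (ice_weight w%:P) x%:P (map polyC xs) h f ts)`_k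
  = row_sum (ice_weight w) x xs h (fun bs => (f bs)`_k) ts.
Proof.
elim: xs h f ts => [|v xs IH] h f [|t ts] /=; try by case: h; rewrite ?coef0.
rewrite coef_sum; apply: eq_bigr => r _; rewrite coef_sum; apply: eq_bigr => b _.
have -> : ice_weight w%:P x%:P v%:P h t r b = (ice_weight w x v h t r b)%:P.
  by rewrite /ice_weight; do !case: ifP => _; rewrite ?(polyCM, polyCB, polyC1).
by rewrite coefCM (IH _ (fun bs => f (b :: bs))).
Qed.

Lemma ice_sum_rho xs ts : size ts = size xs ->
  ice_sum w 0 true xs ts = \prod_(x <- xs) d x * ice_sum w 0 false xs ts.
Proof.
rewrite /ice_sum; elim: xs ts => [|x xs IH] [|t ts] //= => [_|[sz]].
  by rewrite big_nil mul1r.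
rewrite big_cons mulr_sumr; apply: eq_bigr => h _.
rewrite (eq_row_sum_size _ _ _ _ (fun bs => IH bs)) // row_sumZ /turn_weight /=.
by case: ifP => _; [|case: ifP => _]; ring.
Qed.

Lemma ice_pf_coef0 xs :
  (ice_pf w%:P 'X true (map polyC xs))`_0 = \prod_(x <- xs) d x * E xs.
Proof.
rewrite -horner_coef0 -/(horner_eval 0 _) rmorph_ice_pf /= /horner_eval hornerC hornerX.
rewrite -map_comp map_id_in => [|z _]; last by rewrite /= hornerC.
by rewrite /E /ice_pf ice_sum_rho // size_nseq.
Qed.

(** At the zero of [d] the first line can only take the turn of weight [s * x]. This uses up the
    power of [s], so the other lines contribute their value at [s = 0]: the link from the odd
    function to the even one. *)
Lemma odd_pf_cons_root x xs : d x = 0 ->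
  O (x :: xs) = x * \prod_(v <- xs) (x * v - w) * \prod_(v <- xs) d v * E xs.
Proof.
move=> dx; rewrite /O /= ice_pf_cons.
have -> : rho w%:P true x%:P = 0 :> {poly F}.
  by rewrite /rho -[1]/(1%:P) -!polyCM -polyCD -polyCB -[1 + w - _]/(d x) dx polyC0.
rewrite mulr0 mul0r addr0 big_map.
have -> : \prod_(v <- xs) (x%:P * v%:P - w%:P)
     = (\prod_(v <- xs) (x * v - w))%:P :> {poly F}.
  by rewrite rmorph_prod; apply: eq_bigr => v _; rewrite /= polyCB polyCM.
by rewrite -!mulrA coefXM /= coefCM coefCM ice_pf_coef0; ring.
Qed.

Lemma even_pf_poly xs : exists2 p : {poly F}, (size p <= size xs)%N
  & forall y, E (y :: xs) = y * p.[y].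
Proof.
have [p sp pE] := row_sum_poly w xs true (ice_sum w 0 false xs) (nseq (size xs) false).
exists p => [|y]; first by rewrite addn0 in sp.
by rewrite /E ice_pf_cons /rho mul0r !mul0r add0r mulr1 pE.
Qed.

Lemma odd_pf_poly xs : exists2 p : {poly F}, (size p <= (size xs).+1)%N
  & forall y, O (y :: xs) = y * p.[y].
Proof.
pose Z := ice_sum w%:P 'X true (map polyC xs).
have [p sp pE] := row_sum_poly w xs false (fun bs => (Z bs)`_0) (nseq (size xs) false).
have [q sq qE] := row_sum_poly w xs true (fun bs => (Z bs)`_1) (nseq (size xs) false).
exists (p + ((- w)%:P * 'X + (1 + w)%:P) * q) => [|y].
  rewrite addn0 addn1 in sp sq; rewrite (leq_trans (size_polyD _ _)) // geq_max sp.
  by rewrite -add1n size_mul_leq_add ?size_lin_leq.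
rewrite hornerD hornerM -pE -qE !hornerE row_sum_false /O /= ice_pf_cons coefD [RHS]mulrDr.
have dP : y%:P * rho w%:P true y%:P = (y * d y)%:P :> {poly F}.
  by rewrite /rho polyCM polyCB polyCD polyC1 polyCM.
rewrite dP coefCM size_map row_sum_coef big_map; congr (_ + _); last first.
  by rewrite /rho; ring.
have -> : \prod_(v <- xs) (y%:P * v%:P - w%:P)
     = (\prod_(v <- xs) (y * v - w))%:P :> {poly F}.
  by rewrite rmorph_prod; apply: eq_bigr => v _; rewrite /= polyCB polyCM.
by rewrite -!mulrA coefXM /= !coefCM /ice_pf size_map.
Qed.

End CubeRoot.

(** * Expansion over a selected variable *)

Section Expansion.
Variables (F : fieldType) (w : F).
Hypothesis hw : w * w = - 1 - w.
Local Notation E := (even_pf w).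
Local Notation O := (odd_pf w).
Local Notation d := (rho w true).
Local Notation b := (pairw w).
Local Notation sel := (selw w).
Let w0 : w != 0 := cube_root_neq0 hw.

(** The conditions under which [xs] and the values [w / x] are pairwise distinct interpolation
    nodes; the case [y = x] excludes [x * x = w]. *)
Definition generic (xs : seq F) :=
  [&& uniq xs, 0 \notin xs & all (fun x => all (fun y => x * y != w) xs) xs].

Lemma genericP xs : generic xs ->
  [/\ uniq xs, {in xs, forall x, x != 0} & {in xs &, forall x y, x * y != w}].
Proof.
move=> /and3P[uxs x0 xy]; split=> // [x xxs|x y xxs yxs].
  by apply: contraNneq x0 => <-.
exact: (allP (allP xy x xxs) y yxs).
Qed.

Lemma generic_rem x xs : generic xs -> generic (rem x xs).
Proof.
move=> /and3P[uxs x0 /allP xy]; apply/and3P; split; first exact: rem_uniq.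
  by apply: contra x0; exact: mem_rem.
by apply/allP => y /mem_rem yxs; apply/allP => z /mem_rem zxs; exact: (allP (xy y yxs)).
Qed.

Lemma pairwC x y : b x y = b y x.
Proof. by rewrite /pairw; ring. Qed.

Lemma pairw_corner0 y u : y * u = w -> b u y = 0.
Proof. by move=> yu; rewrite /pairw (mulrC u) yu subrr mulr0 mul0r. Qed.

(** Since [v * y - w = w * (v - u) / u] and [v * u - w = u * (v - y)], the denominators cancel. This
    converts the factors of the corner recursion into those of the expansions. *)
Lemma pairw_corner y u v : y * u = w -> v != u ->
  (1 - w * y * v) * (1 - w * u * v) * (v - y) = b v y * (b v u / (v - u)).
Proof.
move=> yu vu; have vu0 : v - u != 0 by rewrite subr_eq0.
have u0 : u != 0 by apply: contraNneq w0 => u0; rewrite -yu u0 mulr0.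
have -> : y = w / u by rewrite -yu mulfK.
by rewrite /pairw; field: hw; rewrite vu0 u0.
Qed.

Definition pairw_poly z : {poly F} :=
  ((w * z)%:P * 'X + (- (w * w))%:P) * ((- (w * z))%:P * 'X + 1%:P).

Lemma horner_pairw_poly z y : (pairw_poly z).[y] = b z y.
Proof. by rewrite /pairw_poly !hornerE /pairw; ring. Qed.

Lemma size_pairw_poly z : (size (pairw_poly z) <= 3)%N.
Proof. by rewrite (@size_mul_leq_add _ _ _ 1 2) ?size_lin_leq. Qed.

Lemma interpolation_points xs : generic xs ->
  uniq (xs ++ [seq w / x | x <- xs]) /\ {in xs, forall u, w / u != 0 /\ w / u * u = w}.
Proof.
move=> /genericP[uxs x0 xy]; split; last first.
  by move=> u /x0 u0; rewrite mulfVK ?mulf_neq0 ?invr_eq0.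
rewrite cat_uniq uxs map_inj_in_uniq ?uxs ?andbT /=.
  apply/hasPn => _ /mapP[x xxs ->] /=; apply: contraTN isT => wx.
  by have := xy _ _ wx xxs; rewrite mulfVK ?eqxx ?x0.
by move=> x y _ _ /(mulfI w0)/invr_inj.
Qed.

Lemma horner_prod_pairw_poly zs y :
  (\prod_(z <- zs) pairw_poly z).[y] = \prod_(z <- zs) b z y.
Proof. by rewrite horner_prod; apply: eq_bigr => z _; exact: horner_pairw_poly. Qed.

Lemma horner_prod_lin (zs : seq F) y :
  (\prod_(z <- zs) ((-1)%:P * 'X + z%:P)).[y] = \prod_(z <- zs) (z - y).
Proof. by rewrite horner_prod; apply: eq_bigr => z _; rewrite !hornerE; ring. Qed.

Lemma size_prod_lin (zs : seq F) :
  (size (\prod_(z <- zs) ((-1)%:P * 'X + z%:P))%R <= (size zs).+1)%N.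
Proof.
rewrite (leq_trans (size_prod_leq_mul (k := 1) _ _)) ?muln1 // => z.
exact: size_lin_leq.
Qed.

Lemma size_sum_leq (s : seq F) (f : F -> {poly F}) n :
  {in s, forall x, (size (f x) <= n)%N} -> (size (\sum_(x <- s) f x)%R <= n)%N.
Proof.
move=> fn; rewrite big_seq; elim/big_ind: _ => [|p q sp sq|x /fn //].
  by rewrite size_poly0.
by rewrite (leq_trans (size_polyD _ _)) // geq_max sp.
Qed.

Lemma sum_mulX_poly (s : seq F) (f : F -> F -> F) n :
  {in s, forall x, exists2 p : {poly F}, (size p <= n)%N & forall v, f x v = v * p.[v]} ->
  exists2 p : {poly F}, (size p <= n)%N & forall v, \sum_(x <- s) f x v = v * p.[v].
Proof.
elim: s => [|x s IH] fP.
  by exists 0 => [|v]; rewrite ?size_poly0 // big_nil horner0 mulr0.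
have [p sp pE] := fP x (mem_head _ _).
have [y ys|q sq qE] := IH; first by apply: fP; rewrite inE ys orbT.
exists (p + q) => [|v]; last by rewrite big_cons hornerD pE qE mulrDr.
by rewrite (leq_trans (size_polyD _ _)) // geq_max sp.
Qed.

(** Divided by [y], both sides are polynomials of size at most [2 * size xs], the number of nodes
    [x] and [w / x]. At [w / u] the corner recursion matches the one surviving term; at a node of
    [xs] the left side vanishes, and the induction serves to show that the right side does too. *)
Lemma even_pf_expand k xs : size xs = (2 * k).+1 -> generic xs -> forall y,
  E (y :: xs) * \prod_(z <- xs) (z - y)
  = (1 - w) * y * sel_sum (fun x zs => x * (x - y) * \prod_(z <- zs) b z y * sel x zs) xs.
Proof.
elim/ltn_ind: k xs => k IH xs sz gxs y; have [uxs x0 xy] := genericP gxs.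
have [urs ru] := interpolation_points gxs; have [p sp pE] := even_pf_poly w xs.
pose S y := sel_sum (fun x zs => x * (x - y) * \prod_(z <- zs) b z y * sel x zs) xs.
pose P : {poly F} := p * \prod_(z <- xs) ((-1)%:P * 'X + z%:P).
pose Q : {poly F} := \sum_(x <- xs) ((1 - w) * x * sel x (rem x xs))%:P *
   (((-1)%:P * 'X + x%:P) * \prod_(z <- rem x xs) pairw_poly z).
have PE v : E (v :: xs) * \prod_(z <- xs) (z - v) = v * P.[v].
  by rewrite pE /P hornerM horner_prod_lin mulrA.
have QE v : (1 - w) * S v = Q.[v].
  rewrite /Q /S /sel_sum horner_sum !mulr_sumr; apply: eq_bigr => x _.
  by rewrite !hornerM horner_prod_pairw_poly !hornerE /=; ring.
rewrite PE -/(S y) (mulrC (1 - w)) -mulrA QE; congr (_ * _.[_]).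
apply: (poly_eq_on urs).
- rewrite /P mulrC size_cat size_map; apply: size_mul_leq_add sp; exact: size_prod_lin.
- rewrite /Q size_cat size_map; apply: size_sum_leq => x xxs.
  rewrite (@leq_trans (0 + (1 + (size (rem x xs) * 2).+1))) //.
    rewrite size_mul_leq_add ?size_polyC_leq1 // size_mul_leq_add ?size_lin_leq //.
    by apply: size_prod_leq_mul => z; exact: size_pairw_poly.
  by rewrite size_rem // sz; lia.
move=> v; rewrite mem_cat => /orP[uxs'|/mapP[u uxs' ->]] {y}.
  have -> : P.[v] = 0.
    by rewrite /P hornerM horner_prod_lin (big_rem _ uxs') /= subrr mul0r mulr0.
  rewrite -QE /S (sel_sum_perm _ (perm_to_rem uxs')) => [|x zs zs' pz]; last first.
    by rewrite (perm_big _ pz) (selw_perm hw _ pz).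
  have nv : v \notin rem v xs by rewrite mem_rem_uniqF.
  rewrite sel_sum_cons // subrr mulr0 !mul0r add0r.
  set ys := rem v xs in nv *.
  have sys : size ys = (2 * k)%N by rewrite /ys size_rem // sz.
  (* Expanding [E (v :: zs)] by induction turns the sum at the node [v] into a double sum over [x]
     and [t]. [H] is symmetric in them, and the only antisymmetric factor of [G] is
     [b t x / (t - x)]. *)
  pose H x t ts := (\prod_(z <- ts) b z v) * (\prod_(z <- ts) (b z x / (z - x)))
    * (\prod_(z <- ts) b z v) * (\prod_(z <- ts) (b z t / (z - t)))
    / (\prod_(z <- ts) (z - v)) * E ts.
  pose G x t ts := - b v v * (1 - w) * v * x * t * b v x * b v t
    * (b t x / (t - x)) * H x t ts.
  rewrite (@eq_sel_sum _ _ _ (fun x zs => sel_sum (G x) zs)).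
    rewrite sel_sum_antisym ?mulr0 // ?rem_uniq // => x t ts.
    have HC : H x t ts = H t x ts by rewrite /H; ring.
    by rewrite /G HC (pairwC t x) -(opprB t x) invrN; ring.
  move=> x xys; have xxs := mem_rem xys.
  have vx : v - x != 0 by rewrite subr_eq0; apply: contraNneq nv => ->.
  set zs := rem x ys; have zsP z : z \in zs -> z \in ys /\ z != x.
    by rewrite mem_rem_uniq ?rem_uniq // => /andP[].
  have szs : size zs = (2 * k.-1).+1 /\ (0 < k)%N.
    have := size_rem xys; rewrite -/zs sys.
    by case: (k) sys => [/size0nil ys0|k' _ /=]; [rewrite ys0 in xys | lia].
  have Pv : \prod_(z <- zs) (z - v) != 0.
    rewrite prodf_seq_neq0; apply/allP => z /zsP[zys _] /=.
    by rewrite subr_eq0; apply: contraNneq nv => <-.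
  have Ev : E (v :: zs) = (1 - w) * v
      * sel_sum (fun x zs => x * (x - v) * \prod_(z <- zs) b z v * sel x zs) zs
      / \prod_(z <- zs) (z - v).
    apply: (canRL (mulfK Pv)); apply: (IH k.-1); rewrite ?szs.1 ?prednK ?szs.2 //.
    exact/generic_rem/generic_rem.
  rewrite /selw !big_cons Ev /sel_sum !(mulr_suml, mulr_sumr).
  apply: eq_big_seq => t tzs; have [tys tx] := zsP t tzs.
  have tv : t - v != 0 by rewrite subr_eq0; apply: contraNneq nv => <-.
  move: Pv; rewrite /G /H /selw (pairwC v t) !(big_rem _ tzs) /=.
  rewrite mulf_eq0 negb_or tv /= => Pv.
  have {}tx : t - x != 0 by rewrite subr_eq0.
  by field; rewrite vx tv tx Pv.
have [y0 yu] := ru u uxs'; set y := w / u in y0 yu *.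
apply: (mulfI y0); rewrite -PE -QE /S /sel_sum.
(* Every term with [x != u] contains [b u y], which is zero because [y * u = w]. *)
rewrite [in RHS](big_rem _ uxs') [X in _ = _ * (_ * (_ + X))]big1_seq => [|x /= xxs]; last first.
  have urx : u \in rem x xs.
    by move: xxs; rewrite !mem_rem_uniq // !inE uxs' andbT => /andP[]; rewrite eq_sym.
  by rewrite (big_rem _ urx) /= pairw_corner0 // !(mul0r, mulr0).
rewrite addr0 (even_pf_corner hw yu uxs') (big_rem _ uxs') /= /selw.
have -> : \prod_(v <- rem u xs) ((1 - w * y * v) * (1 - w * u * v)) =
   \prod_(v <- rem u xs) b v y * \prod_(v <- rem u xs) (b v u / (v - u))
   / \prod_(v <- rem u xs) (v - y).
  rewrite -big_split -prodf_div; apply: eq_big_seq => z.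
  rewrite mem_rem_uniq // !inE => /andP[zu zxs].
  rewrite /= -pairw_corner // mulfK // subr_eq0.
  by apply: contraNneq (xy _ _ zxs uxs') => ->; rewrite yu.
have Py : \prod_(v <- rem u xs) (v - y) != 0.
  rewrite prodf_seq_neq0; apply/allP => z /mem_rem zxs /=; rewrite subr_eq0.
  by apply: contraNneq (xy _ _ zxs uxs') => ->; rewrite yu.
by move: (y) yu Py => y' yu' Py; field: yu'.
Qed.

(** One argument serves as variable, so the [2 * k] others give [4 * k] nodes, one too few for the
    degree. The missing node is [- w], the zero of [d]; it differs from the others because [- w] is
    not in the list and [- w = w / x] would mean [x = -1]. *)
Lemma odd_pf_expand k xs : size xs = (2 * k).+1 -> generic xs ->
  - w \notin xs -> -1 \notin xs ->
  O xs = sel_sum (fun x zs => x * \prod_(z <- zs) d z * sel x zs) xs.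
Proof.
elim/ltn_ind: k xs => k IH [//|t xs] [sz] gtxs wtxs ntxs.
have /andP[tnxs _] : (t \notin xs) && uniq xs by case/and3P: gtxs.
have gxs : generic xs by move: (generic_rem t gtxs); rewrite /= eqxx.
have wxs : - w \notin xs by apply: contra wtxs; rewrite inE orbC => ->.
have nxs : -1 \notin xs by apply: contra ntxs; rewrite inE orbC => ->.
have {gtxs wtxs ntxs} [uxs x0 xy] := genericP gxs.
have [urs ru] := interpolation_points gxs; have [p sp pE] := odd_pf_poly w xs.
have dw : d (- w) = 0 by rewrite /rho; ring: hw.
have {}urs : uniq (- w :: xs ++ [seq w / x | x <- xs]).
  rewrite /= urs andbT mem_cat negb_or wxs; apply/mapP => -[x xxs wx].
  have xN1 : x = -1.
    by apply: (mulfI w0); rewrite mulrN1 -[w * x]opprK -mulNr wx mulfVK // x0.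
  by rewrite -xN1 xxs in nxs.
(* The claim multiplied by [\prod_(z <- xs) (z - t)]: the term selecting [t], then those selecting
   [x] in [xs], where [x - t] against the denominator [t - x] leaves the minus sign. *)
pose rhs t := t * \prod_(z <- xs) d z * \prod_(z <- xs) b z t * E xs
  - \sum_(x <- xs) x * d t * \prod_(z <- rem x xs) d z * b t x
     * \prod_(z <- rem x xs) (z - t) * \prod_(z <- rem x xs) (b z x / (z - x))
     * E (t :: rem x xs).
suff main v : O (v :: xs) * \prod_(z <- xs) (z - v) = rhs v.
  have Pt : \prod_(z <- xs) (z - t) != 0.
    rewrite prodf_seq_neq0; apply/allP => z zxs /=.
    by rewrite subr_eq0; apply: contraNneq tnxs => <-.
  rewrite sel_sum_cons // -[O _](mulfK Pt) main /rhs mulrBl; congr (_ + _).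
    rewrite /selw prodf_div; field; exact: Pt.
  rewrite /sel_sum -mulNr -sumrN mulr_suml; apply: eq_big_seq => x xxs.
  rewrite /selw !big_cons; move: Pt; rewrite (big_rem _ xxs) /= mulf_eq0 negb_or.
  move=> /andP[xt Pt]; have tx : t - x != 0 by rewrite -opprB oppr_eq0.
  by field; rewrite xt tx Pt.
pose P : {poly F} := p * \prod_(z <- xs) ((-1)%:P * 'X + z%:P).
have PE v' : O (v' :: xs) * \prod_(z <- xs) (z - v') = v' * P.[v'].
  by rewrite pE /P hornerM horner_prod_lin mulrA.
pose D : {poly F} := (- w)%:P * 'X + (1 + w)%:P.
have DE v' : D.[v'] = d v' by rewrite !hornerE /rho /=; ring.
have [Q sQ QE] : exists2 Q : {poly F}, (size Q <= (4 * k).+1)%N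
    & forall v', rhs v' = v' * Q.[v'].
  have [x xxs|q sq qE] := @sum_mulX_poly xs (fun x v' => - (x * d v'
      * \prod_(z <- rem x xs) d z * b v' x * \prod_(z <- rem x xs) (z - v')
      * \prod_(z <- rem x xs) (b z x / (z - x)) * E (v' :: rem x xs))) (4 * k).+1.
    have [px spx pxE] := even_pf_poly w (rem x xs).
    exists ((- (x * \prod_(z <- rem x xs) d z * \prod_(z <- rem x xs) (b z x / (z - x))))%:P
      * (D * (pairw_poly x * (\prod_(z <- rem x xs) ((-1)%:P * 'X + z%:P) * px)))) => [|v'].
      rewrite (@leq_trans (0 + (1 + (2 + (size (rem x xs) + size (rem x xs)))))) //.
        rewrite !size_mul_leq_add ?size_polyC_leq1 ?size_lin_leq ?size_pairw_poly //.
        exact: size_prod_lin.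
      by rewrite size_rem // sz; case: (k) sz => [/size0nil xs0|k' _]; [rewrite xs0 in xxs|lia].
    rewrite pxE hornerM hornerC hornerM DE hornerM horner_pairw_poly hornerM.
    by rewrite horner_prod_lin (pairwC v'); ring.
  exists ((\prod_(z <- xs) d z * E xs)%:P * \prod_(z <- xs) pairw_poly z + q) => [|v'].
    rewrite (leq_trans (size_polyD _ _)) // geq_max sq andbT.
    rewrite (@leq_trans (0 + (size xs * 2).+1)) //; last by rewrite sz; lia.
    rewrite size_mul_leq_add ?size_polyC_leq1 //.
    by apply: size_prod_leq_mul => z; exact: size_pairw_poly.
  rewrite /rhs -sumrN qE hornerD hornerM hornerC horner_prod_pairw_poly; ring.
rewrite PE QE; congr (_ * _.[_]); apply: (poly_eq_on urs).
- rewrite /P mulrC; apply: leq_trans (size_mul_leq_add (size_prod_lin _) sp) _.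
  by rewrite /= size_cat size_map addnS.
- by rewrite (leq_trans sQ) //= size_cat size_map; lia.
move=> u; rewrite inE mem_cat => /or3P[/eqP ->|uxs'|/mapP[u' uxs' ->]] {v}.
- apply: (mulfI (x := - w)); first by rewrite oppr_eq0.
  rewrite -PE -QE odd_pf_cons_root // /rhs [\sum_(x <- xs) _]big1 ?subr0 => [|x _]; last first.
    by rewrite dw mulr0 !mul0r.
  have -> : \prod_(z <- xs) b z (- w)
      = \prod_(z <- xs) (- w * z - w) * \prod_(z <- xs) (z - - w).
    by rewrite -big_split; apply: eq_bigr => z _; rewrite /pairw /=; ring: hw.
  by ring.
(* At a node [u] of [xs] only the terms selecting the variable and [u] survive, and they cancel. *)
- apply: (mulfI (x0 _ uxs')); rewrite -PE -QE [in LHS](big_rem _ uxs') /= subrr mul0r mulr0.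
  have pu := perm_to_rem uxs'; rewrite /rhs [\sum_(x <- xs) _](big_rem _ uxs') /=.
  rewrite [\sum_(x <- rem u xs) _]big1_seq => [|x /= xxs].
    rewrite addr0 !(perm_big _ pu) /= !big_cons (even_pf_perm hw pu) prodf_div.
    have Pu : \prod_(z <- rem u xs) (z - u) != 0.
      rewrite prodf_seq_neq0; apply/allP => z; rewrite mem_rem_uniq // !inE.
      by move=> /andP[zu _]; rewrite /= subr_eq0.
    by field.
  have urx : u \in rem x xs.
    by move: xxs; rewrite !mem_rem_uniq // !inE uxs' andbT => /andP[]; rewrite eq_sym.
  by rewrite [\prod_(z <- _) (z - u)](big_rem _ urx) /= subrr !(mul0r, mulr0).
(* At [w / u] the two sides agree term by term: odd corner recursion and induction on the left, even
   corner recursion on the right. *)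
move: u' uxs' => {}u uxs'; have [y0 yu] := ru u uxs'; set y := w / u in y0 yu *.
apply: (mulfI y0); rewrite -PE -QE (odd_pf_corner hw yu uxs').
have k0 : (0 < k)%N by case: (k) sz => // /size0nil xs0; rewrite xs0 in uxs'.
rewrite (IH k.-1) ?prednK ?generic_rem //; first last.
- by apply: contra nxs; exact: mem_rem.
- by apply: contra wxs; exact: mem_rem.
- by rewrite size_rem // sz; lia.
rewrite /rhs [\prod_(z <- xs) b z y](big_rem _ uxs') /= (pairw_corner0 yu) mul0r mulr0 mul0r add0r.
rewrite [\sum_(x <- xs) _](big_rem _ uxs') [\prod_(z <- xs) (z - y)](big_rem _ uxs') /= (pairwC y u) (pairw_corner0 yu).
rewrite mulr0 !mul0r add0r -sumrN /sel_sum mulr_sumr mulr_suml.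
apply: eq_big_seq => x xys.
have [xu xxs] : x != u /\ x \in xs by move: xys; rewrite mem_rem_uniq // => /andP[].
have urx : u \in rem x xs by rewrite mem_rem_uniq // !inE eq_sym xu.
rewrite (even_pf_corner hw yu urx) !(big_rem _ urx) /= (remC u x) //.
rewrite !(big_rem _ xys) /=.
set zs := rem x (rem u xs).
have := pairw_corner yu xu; rewrite (pairwC y x) (pairwC u x) /selw.
have xu0 : x - u != 0 by rewrite subr_eq0.
have ux0 : u - x != 0 by rewrite -opprB oppr_eq0.
have -> : b x u / (x - u) = - (b x u / (u - x)) by rewrite -(opprB u x) invrN mulrN.
move=> corner.
transitivity (- ((1 - w * y * x) * (1 - w * u * x) * (x - y)) * -1 * ((1 - w) * w * d y * d u * x * (u - y)
  * \prod_(v <- zs) ((1 - w * y * v) * (1 - w * u * v)) * \prod_(z <- zs) d z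
  * \prod_(z <- zs) (z - y) * \prod_(z <- zs) (b z x / (z - x)) * E zs)).
  by rewrite /rho; ring.
by rewrite corner /rho; field.
Qed.

End Expansion.

(** * Inversion-closed arguments *)

Section Inversion.
Variables (F : fieldType) (w : F).
Hypothesis hw : w * w = - 1 - w.
Local Notation E := (even_pf w).
Local Notation O := (odd_pf w).
Local Notation d := (rho w true).
Local Notation b := (pairw w).
Local Notation sel := (selw w).
Let w0 : w != 0 := cube_root_neq0 hw.

Lemma even_pf_expand_div k xs y : size xs = (2 * k).+1 -> generic w xs -> y \notin xs ->
  E (y :: xs) = (1 - w) * y *
    sel_sum (fun x zs => x * \prod_(z <- zs) (b z y / (z - y)) * sel x zs) xs.
Proof.
move=> sz gxs yxs; have Py : \prod_(z <- xs) (z - y) != 0.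
  rewrite prodf_seq_neq0; apply/allP => z zxs /=.
  by rewrite subr_eq0; apply: contraNneq yxs => <-.
rewrite -[LHS](mulfK Py) (even_pf_expand hw sz gxs).
rewrite /sel_sum !mulr_sumr mulr_suml; apply: eq_big_seq => x xxs.
move: Py; rewrite (big_rem _ xxs) /= mulf_eq0 negb_or => /andP[xy Py].
by rewrite prodf_div; field; rewrite xy Py.
Qed.

Lemma pairw_inv z x : z != 0 -> x != 0 ->
  b z^-1 x^-1 / (z^-1 - x^-1) = - (z * x)^-1 * (b z x / (z - x)).
Proof.
move=> z0 x0; have [->|zx] := eqVneq z x; first by rewrite !subrr invr0 !mulr0.
have zx0 : z - x != 0 by rewrite subr_eq0.
have xz0 : x - z != 0 by rewrite -opprB oppr_eq0.
by rewrite /pairw; field; rewrite mulN1r zx0 xz0 z0 x0.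
Qed.

Lemma prod_pairw_inv x zs : x != 0 -> {in zs, forall z, z != 0} ->
  \prod_(z <- map GRing.inv zs) (b z x^-1 / (z - x^-1))
  = (- x^-1) ^+ size zs * \prod_(z <- zs) z^-1 * \prod_(z <- zs) (b z x / (z - x)).
Proof.
move=> x0; elim: zs => [|z zs IH] zs0; first by rewrite !big_nil !mulr1.
have z0 : z != 0 by apply: zs0; rewrite mem_head.
rewrite /= !big_cons IH => [|y ys]; last by apply: zs0; rewrite inE ys orbT.
by rewrite pairw_inv // exprS invfM; ring.
Qed.

(** The expansions of both sides match term by term, [x] against [x^-1]. Each product in a term has
    an even number [2 * k] of factors, so the signs of [pairw_inv] disappear. *)
Lemma even_pf_inv k xs : size xs = (2 * k)%N -> generic w xs ->
  generic w (map GRing.inv xs) ->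
  E (map GRing.inv xs) = (\prod_(x <- xs) x^-1) ^+ (2 * k) * E xs.
Proof.
elim: k xs => [|k IH] [|y xs] //; first by rewrite mul1r.
move=> /= /eqP; rewrite mulnS eqSS => /eqP sz gyxs giyxs.
have [/andP[yxs uxs] x0 xy] := genericP gyxs.
have gxs : generic w xs by have := generic_rem y gyxs; rewrite /= eqxx.
have gixs : generic w (map GRing.inv xs).
  by have := generic_rem y^-1 giyxs; rewrite /= eqxx.
have y0 : y != 0 by apply: x0; rewrite mem_head.
have x0' : {in xs, forall x, x != 0} by move=> x xs'; apply: x0; rewrite inE xs' orbT.
rewrite !(@even_pf_expand_div k) ?size_map // ?mem_map //; try exact: invr_inj.
rewrite /sel_sum !mulr_sumr big_map; apply: eq_big_seq => x xxs.
have zs0 : {in rem x xs, forall z, z != 0} by move=> z /mem_rem /x0'.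
have szs : size (rem x xs) = (2 * k)%N by rewrite size_rem // sz.
rewrite map_rem; last exact: invr_inj.
have xx0 := x0' x xxs.
rewrite /selw !prod_pairw_inv // szs IH ?generic_rem //; last first.
  by rewrite -map_rem ?generic_rem //; exact: invr_inj.
have sgn : (-1) ^+ (2 * k) = 1 :> F by rewrite exprM sqrrN expr1n expr1n.
move: (2 * k)%N sgn => m sgn.
rewrite !(big_cons, big_rem _ xxs) /= !(exprMn, exprD) expr2 (exprNn y^-1) (exprNn x^-1).
rewrite sgn !mul1r; move: (y^-1 ^+ m) (x^-1 ^+ m) (_ ^+ m) => Y X Z.
by field; rewrite y0 xx0.
Qed.

Lemma generic_perm xs ys : perm_eq xs ys -> generic w xs = generic w ys.
Proof.
move=> pxy; rewrite /generic (perm_uniq pxy) (perm_mem pxy) (perm_all _ pxy).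
by congr [&& _, _ & _]; apply: eq_all => x; exact: perm_all.
Qed.

(** Only the odd sum has to be averaged: the coefficients of the even sum at [-1] are already
    proportional to [x * (x + 1) / (x ^+ 2 - x + 1)], the form that the odd ones take after
    averaging. *)
Lemma even_odd_pf_closed k xs : size xs = (2 * k).+1 -> generic w xs ->
  perm_eq (map GRing.inv xs) xs -> \prod_(x <- xs) x = 1 ->
  -1 \notin xs -> - w \notin xs ->
  \prod_(x <- xs) d x * E (-1 :: xs)
  = 2 * w * (1 - w) * \prod_(x <- xs) (b x (-1) / (x + 1)) * O xs.
Proof.
move=> sz gxs pinv prod1 nxs wxs; have [uxs x0 xy] := genericP gxs.
have memV x : (x^-1 \in xs) = (x \in xs).
  by rewrite -{1}(perm_mem pinv) mem_map //; exact: invr_inj.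
have dx x : x \in xs -> d x != 0.
  move=> xxs; apply: contraNneq wxs; rewrite /rho => dx0.
  suff -> : - w = x by [].
  apply: (mulfI w0); have -> : w * x = 1 + w by apply/esym/eqP; rewrite -subr_eq0 dx0.
  by ring: hw.
have x1 x : x \in xs -> x + 1 != 0.
  by move=> xxs; rewrite addr_eq0; apply: contraNneq nxs => <-.
pose A x := sel x (rem x xs).
(* The powers [x ^- (2 * k)] and [x ^+ (2 * k)] from the two inversion lemmas cancel; what remains
   is the product of the inverses of the other arguments, which is [x] because [xs] has product
   1. *)
have AV x : x \in xs -> A x^-1 = x * A x.
  move=> xxs; have zs0 : {in rem x xs, forall z, z != 0} by move=> z /mem_rem /x0.
  have szs : size (rem x xs) = (2 * k)%N by rewrite size_rem // sz.
  have pr : perm_eq (rem x^-1 xs) (map GRing.inv (rem x xs)).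
    by rewrite -map_rem; [apply: perm_rem; rewrite perm_sym | exact: invr_inj].
  have gr := generic_rem x gxs; have xx0 := x0 x xxs.
  have gi : generic w (map GRing.inv (rem x xs)).
    rewrite -map_rem; last exact: invr_inj.
    by rewrite generic_rem // (generic_perm pinv).
  rewrite /A (selw_perm hw _ pr) /selw prod_pairw_inv // szs (even_pf_inv szs) //.
  have -> : \prod_(z <- rem x xs) z^-1 = x.
    move: prod1; rewrite (big_rem _ xxs) /= prodfV => prod1.
    by apply: invr_inj; rewrite invrK; apply: (mulfI xx0); rewrite prod1 mulfV.
  have sgn : (-1) ^+ (2 * k) = 1 :> F by rewrite exprM sqrrN expr1n expr1n.
  rewrite exprNn sgn mul1r exprVn; have := expf_neq0 (2 * k) xx0.
  by move: (x ^+ _) => X X0; field.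
have dV x : x \in xs -> d x * (x * d x^-1) = x ^+ 2 - x + 1.
  by move=> /x0 xx0; rewrite /rho; field: hw.
have qx x : x \in xs -> x ^+ 2 - x + 1 != 0.
  by move=> xxs; rewrite -dV // !mulf_neq0 ?dx ?memV ?x0.
pose S := \sum_(x <- xs) x / d x * A x.
have OS : O xs = \prod_(x <- xs) d x * S.
  rewrite (odd_pf_expand hw sz) // /sel_sum mulr_sumr; apply: eq_big_seq => x xxs.
  by rewrite [\prod_(z <- xs) _](big_rem _ xxs) /= -/(A x); field; rewrite dx.
have S2 : 2 * S = \sum_(x <- xs) x * (x + 1) / (x ^+ 2 - x + 1) * A x.
  have -> : 2 * S = S + S by ring.
  have {2}-> : S = \sum_(x <- xs) x^-1 / d x^-1 * (x * A x).
    rewrite /S -(perm_big _ pinv) /= big_map; apply: eq_big_seq => x xxs.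
    by rewrite AV.
  rewrite -big_split /=; apply: eq_big_seq => x xxs; rewrite -dV //.
  have := dx x xxs; have := dx x^-1; rewrite memV => /(_ xxs); have := x0 x xxs.
  rewrite /rho => xx0 d1 d2.
  have d1' : (1 + w) * x - w != 0.
    by rewrite (_ : _ - w = (1 + w - w / x) * x) ?mulf_neq0 //; field.
  by field: hw; rewrite xx0 d1' d2.
rewrite OS (even_pf_expand_div sz) // /sel_sum.
transitivity (w * (1 - w) * \prod_(x <- xs) (b x (-1) / (x + 1)) * \prod_(x <- xs) d x * (2 * S)).
  rewrite S2 !mulr_sumr; apply: eq_big_seq => x xxs.
  have bx : b x (-1) = - (w * w) * (x ^+ 2 - x + 1) by rewrite /pairw; ring: hw.
  have -> : \prod_(z <- rem x xs) (b z (-1) / (z - -1))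
      = \prod_(z <- rem x xs) (b z (-1) / (z + 1)).
    by apply: eq_bigr => z _; rewrite opprK.
  rewrite [\prod_(x <- xs) (_ / _)](big_rem _ xxs) /= bx -/(A x).
  by field: hw; rewrite qx // x1.
by ring.
Qed.

End Inversion.

(** * Symplectic determinants *)

Section AlternantDet.
Variable F : fieldType.
Implicit Types (g : nat -> F -> F) (xs : seq F).

(* The first condition is a linear recurrence: adding multiples of earlier
   columns to column [k + j] turns it into [c] times column [j], and [c] vanishes
   on the first [k] nodes. *)
Lemma det_block_reduce g (c : F -> F) k m (x : 'I_(k + m) -> F) (t : nat -> nat -> F) :
  (forall j (l : 'I_(k + m)),
     \sum_(i < k + j) t i j * g i (x l) + g (k + j)%N (x l) = c (x l) * g j (x l)) ->
  (forall i, c (x (lshift m i)) = 0) ->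
  \det (\matrix_(i < k + m, j < k + m) g j (x i))
  = \det (\matrix_(i < k, j < k) g j (x (lshift m i)))
    * \prod_(i < m) c (x (rshift k i))
    * \det (\matrix_(i < m, j < m) g j (x (rshift k i))).
Proof.
move=> gc c0; set M := (X in \det X = _).
pose T : 'M[F]_(k + m) := \matrix_(i, j)
  (if i == j then 1 else if (i < j)%N && (k <= j)%N then t i (j - k)%N else 0).
have dT : \det T = 1.
  rewrite -det_tr det_trig; first by rewrite big1 // => i _; rewrite !mxE eqxx.
  apply/is_trig_mxP => i j ij; rewrite !mxE -val_eqE /= gtn_eqF //.
  by rewrite ltnNge ltnW.
have -> : \det M = \det (M *m T) by rewrite det_mulmx dT mulr1.
have -> : M *m T = block_mx (\matrix_(i < k, j < k) g j (x (lshift m i))) 0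
   (\matrix_(i < m, j < k) g j (x (rshift k i)))
   (diag_mx (\row_i c (x (rshift k i))) *m \matrix_(i < m, j < m) g j (x (rshift k i))).
  have MTl i (j : 'I_k) : (M *m T) i (lshift m j) = g j (x i).
    rewrite mxE (bigD1 (lshift m j)) //= !mxE eqxx mulr1 big1 ?addr0 // => l lj.
    by rewrite !mxE (negPf lj) [(k <= _)%N]leqNgt /= ltn_ord andbF mulr0.
  have MTr i (j : 'I_m) : (M *m T) i (rshift k j) = c (x i) * g j (x i).
    rewrite mxE -gc (bigD1 (rshift k j)) //= !mxE eqxx mulr1 addrC; congr (_ + _).
    rewrite (@big_ord_widen_cond _ _ _ _ (k + m) xpredT (fun l => t l j * g l (x i))) /=; last first.
      by rewrite leq_add2l ltnW.
    rewrite (bigID (fun l : 'I_(k + m) => (l < k + j)%N)) /= [X in _ + X]big1 ?addr0.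
      rewrite [RHS](eq_bigl (fun l => (l != rshift k j) && (l < k + j)%N)) => [|l].
        apply: eq_bigr => l /andP[/negPf lj ljk]; rewrite !mxE lj ljk leq_addr /= mulrC.
        by rewrite addKn.
      by rewrite -val_eqE /=; case: ltngtP.
    by move=> l /andP[/negPf lj /negPf ljk]; rewrite !mxE lj ljk mulr0.
  apply/matrixP => i j; rewrite -(splitK i) -(splitK j).
  case: (split i) => i'; case: (split j) => j' /=;
    rewrite ?block_mxEul ?block_mxEur ?block_mxEdl ?block_mxEdr ?MTl ?MTr.
  - by rewrite !mxE.
  - by rewrite c0 mul0r mxE.
  - by rewrite mxE.
  - by rewrite mul_diag_mx !mxE.
rewrite det_lblock det_mulmx det_diag mulrA; congr (_ * _ * _).
by apply: eq_bigr => i _; rewrite mxE.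
Qed.

Definition alt_det g xs := \det (\matrix_(i < size xs, j < size xs) g j xs`_i).

(** The sign [e] is chosen before [g], so that it is the same for the numerator and the denominator
    alternants. *)
Lemma alt_det_perm xs ys : perm_eq xs ys ->
  exists2 e : F, e != 0 & forall g, alt_det g xs = e * alt_det g ys.
Proof.
move=> pxy; have sz := perm_size pxy; rewrite /alt_det.
have /tuple_permP[s sE] : perm_eq (in_tuple xs) (tcast (esym sz) (in_tuple ys)).
  by rewrite val_tcast.
exists ((-1) ^+ s) => [|g]; first by rewrite signr_eq0.
transitivity (\det (row_perm s (\matrix_(i < size xs, j < size xs) g j ys`_i))).
  congr (\det _); apply/matrixP => i j; rewrite !mxE; congr g.
  have -> : xs`_i = nth 0 (val (in_tuple xs)) i by [].
  rewrite [val _]sE (nth_map i) ?size_enum_ord // nth_ord_enum.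
  by rewrite (tnth_nth 0) val_tcast.
rewrite row_permE det_mulmx det_perm; congr (_ * _).
by move: (size xs) sz s {sE} => N -> _.
Qed.

(** The cofactors of the first row do not involve [y], so the alternant is an explicit function of
    this one variable. The node [0] in [M] is a placeholder for [y]. *)
Lemma alt_det_cons g xs : exists cof : nat -> F, forall y,
  alt_det g (y :: xs) = \sum_(j < (size xs).+1) g j y * cof j.
Proof.
pose M : 'M[F]_((size xs).+1) := \matrix_(i, j) g j (0 :: xs)`_i.
exists (fun j => cofactor M 0 (inord j)) => z.
rewrite /alt_det (expand_det_row _ 0); apply: eq_bigr => j _.
rewrite mxE /= inord_val; congr (_ * _); congr (_ * \det _).
by apply/matrixP => i l; rewrite !mxE.
Qed.

Lemma alt_det_mem g y xs : y \in xs -> alt_det g (y :: xs) = 0.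
Proof.
move=> yxs; have iy : ((index y xs).+1 < (size xs).+1)%N by rewrite ltnS index_mem.
apply: (@determinant_alternate _ _ _ ord0 (Ordinal iy)) => // j.
by rewrite !mxE /= nth_index.
Qed.

Definition sym_pow (e : nat) (x : F) := x ^+ e - x ^- e.
Definition den_fun j := sym_pow j.+1.
(* The exponents are 1, 2, 4, 5, 7, 8, ... *)
Definition num_fun j := sym_pow (3 * j + 2)./2.

(** Multiplication by [x + x^-1] shifts the exponent by one in both directions, so modulo earlier
    columns, column [j + 1] becomes [c] times column [j], with [c] zero at [y]. *)
Lemma alt_det_den_cons y xs : y != 0 -> {in xs, forall x, x != 0} ->
  alt_det den_fun (y :: xs) = den_fun 0 y
    * \prod_(x <- xs) (x + x^-1 - y - y^-1) * alt_det den_fun xs.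
Proof.
move=> y0 x0.
pose c x := x + x^-1 - y - y^-1.
pose t i j : F := if i == j then - (y + y^-1) else if i.+1 == j then 1 else 0.
have nth0 (l : 'I_(size xs).+1) : (y :: xs)`_l != 0.
  by case: l => -[|l] //= ls; apply/x0/mem_nth.
rewrite /alt_det (@det_block_reduce den_fun c 1 (size xs) (fun i => (y :: xs)`_i) t).
- rewrite det_mx11 mxE (big_nth 0) big_mkord.
  by congr (_ * _ * \det _); apply/matrixP => i j; rewrite !mxE.
- move=> j l; have := nth0 l; move: (_`_l) => v v0; rewrite /den_fun /sym_pow /c.
  rewrite add1n big_ord_recr /= {2}/t eqxx.
  case: j => [|j]; first by rewrite big_ord0; field; rewrite v0 y0.
  rewrite big_ord_recr /= big1 => [|i _]; last first.
    have ij := ltn_ord i; rewrite /t /=; case: eqP => [|_]; first lia.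
    by case: eqP => [|_]; [lia | rewrite mul0r].
  rewrite /t ltn_eqF // eqxx add0r !exprS; have := expf_neq0 j v0.
  by move: (v ^+ j) => V V0; field; rewrite v0 V0 y0.
- by move=> i; rewrite ord1 /= /c addrAC addrK subrr.
Qed.

(** Multiplication by [x ^+ 3 + x ^- 3] shifts exponents by three, and 1, 2, 4, 5, ... are stable
    under this because -2 and -1 count as 2 and 1 up to sign. As [(y * z) ^+ 3 = 1], the same [c]
    vanishes at [y] and at [z], so two nodes come off together. *)
Lemma alt_det_num_cons2 y z xs : y != 0 -> z != 0 -> {in xs, forall x, x != 0} ->
  (y * z) ^+ 3 = 1 ->
  alt_det num_fun (y :: z :: xs) =
    (den_fun 0 y * den_fun 0 z * (z + z^-1 - y - y^-1))
    * \prod_(x <- xs) (x ^+ 3 + x ^- 3 - z ^+ 3 - z ^- 3) * alt_det num_fun xs.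
Proof.
move=> y0 z0 x0 yz.
pose c x := x ^+ 3 + x ^- 3 - z ^+ 3 - z ^- 3.
(* The entries [-1] come from the exponents 1 - 3 = -2 and 2 - 3 = -1, where the symmetric
   difference of powers changes sign. *)
pose t i j : F := if i == j then - (z ^+ 3 + z ^- 3) else if i.+2 == j then 1
  else if (i + j)%N == 1 then -1 else 0.
have nth0 (l : 'I_(size xs).+2) : (y :: z :: xs)`_l != 0.
  by case: l => -[|[|l]] //= ls; apply/x0/mem_nth.
rewrite /alt_det (@det_block_reduce num_fun c 2 (size xs) (fun i => (y :: z :: xs)`_i) t).
- rewrite [\prod_(x <- xs) _](big_nth 0) big_mkord.
  congr (_ * _ * _).
  rewrite (expand_det_row _ ord0) !big_ord_recl big_ord0 /cofactor !det_mx11 !mxE.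
  rewrite /num_fun /den_fun /sym_pow /=.
  by field; rewrite y0 z0.
- move=> j l; have := nth0 l; move: (_`_l) => v v0; rewrite /c.
  rewrite add2n; case: j => [|[|j]].
  + by rewrite !big_ord_recr big_ord0 /t /num_fun /sym_pow /=; field; rewrite v0 z0.
  + by rewrite !big_ord_recr big_ord0 /t /num_fun /sym_pow /=; field; rewrite v0 z0.
  have E (i : nat) : (3 * i.+2 + 2)./2 = ((3 * i + 2)./2 + 3)%N by lia.
  rewrite 4!big_ord_recr /= big1 => [|i _]; last first.
    have ij := ltn_ord i; rewrite /t /=; case: eqP => [|_]; first lia.
    case: eqP => [|_]; first lia.
    by case: eqP => [|_]; [lia | rewrite mul0r].
  have -> : t j j.+2 = 1 by rewrite /t eqxx ltn_eqF.
  have -> : t j.+1 j.+2 = 0.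
    by rewrite /t; case: eqP => [|_]; [lia|case: eqP => [|_]; [lia|case: eqP => [|_]; [lia|]]].
  have -> : t j.+3 j.+2 = 0.
    by rewrite /t; case: eqP => [|_]; [lia|case: eqP => [|_]; [lia|case: eqP => [|_]; [lia|]]].
  have -> : t j.+2 j.+2 = - (z ^+ 3 + z ^- 3) by rewrite /t eqxx.
  rewrite /num_fun /sym_pow !E !exprD; have := expf_neq0 (3 * j + 2)./2 v0.
  move: (v ^+ (3 * j + 2)./2) => V V0; field.
  by rewrite v0 V0 z0 expf_neq0.
- move=> i; have y3 : y ^+ 3 = z ^- 3.
    by apply: (mulIf (expf_neq0 3 z0)); rewrite -exprMn yz mulVf // expf_neq0.
  case: i => -[|[|i]] //= _; rewrite /c ?y3 ?invrK; ring.
Qed.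

End AlternantDet.

(** * The even partition function as a ratio of alternants *)

Section EvenDet.
Variables (F : fieldType) (w : F).
Hypothesis hw : w * w = - 1 - w.
Local Notation E := (even_pf w).
Let w0 : w != 0 := cube_root_neq0 hw.

Lemma sym_powV e (x : F) : sym_pow e x^-1 = - sym_pow e x.
Proof. by rewrite /sym_pow exprVn invrK opprB. Qed.

Lemma alt_det_numV y (xs : seq F) :
  alt_det (@num_fun F) (y^-1 :: xs) = - alt_det (@num_fun F) (y :: xs).
Proof.
have [cof numE] := alt_det_cons (@num_fun F) xs.
rewrite !numE -sumrN; apply: eq_bigr => j _.
by rewrite /num_fun sym_powV mulNr.
Qed.

Lemma alt_det_num_sqr1 y (xs : seq F) : y ^+ 2 = 1 ->
  alt_det (@num_fun F) (y :: xs) = 0.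
Proof.
move=> y2; have y0 : y != 0.
  by apply: contra_eq_neq y2 => ->; rewrite expr0n eq_sym oner_neq0.
have [cof numE] := alt_det_cons (@num_fun F) xs.
rewrite numE big1 // => j _; rewrite /num_fun /sym_pow -exprVn.
have -> : y^-1 = y by apply: (mulfI y0); rewrite mulfV // -expr2 y2.
by rewrite subrr mul0r.
Qed.

(** For [2 * n + 1] arguments these are [6 * n + 5] distinct values, the number of nodes that the
    interpolation in [even_pf_det] consumes. *)
Definition separated (xs : seq F) :=
  (0 \notin xs) && uniq ([:: 1; -1] ++ xs ++ map GRing.inv xs ++ [seq w / x | x <- xs]).

Lemma separated_subseq xs ys : subseq xs ys -> separated ys -> separated xs.
Proof.
move=> sxy /andP[y0 uy]; apply/andP; split.
  by apply: contra y0; exact: (mem_subseq sxy).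
by apply: subseq_uniq uy; rewrite !cat_subseq // map_subseq.
Qed.

Definition det_const n := (1 - w) ^+ n * w ^+ (n * n.-1).

(** Adding a pair with product [w] multiplies [E] by a constant [(1 - w) * w] and the power of the
    product of arguments by [w ^+ n.+1]; the exponents of [w] are compared modulo 3. *)
Lemma det_const_rec n : det_const n.+1 * w ^+ n.+1 = (1 - w) * w * det_const n.
Proof.
have w3 : w ^+ 3 = 1 by rewrite !exprS expr0; ring: hw.
rewrite /det_const /= -mulrA -exprD.
have -> : (n.+1 * n + n.+1 = 3 * n + (n * n.-1).+1)%N by case: n => //= n; lia.
by rewrite exprD exprM w3 expr1n mul1r !exprS; ring.
Qed.

(** Over the cube roots of unity c, the product of [v + v^-1 - c * z - (c * z)^-1] is
    [v ^+ 3 + v ^- 3 - z ^+ 3 - z ^- 3]. The roots 1 and [w^-1] give the factors of [z] and [y], and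
    [(1 - w * y * v) * (1 - w * z * v)] is [v] times the third. *)
Lemma corner_product y z v : y * z = w -> z != 0 -> v != 0 ->
  (1 - w * y * v) * (1 - w * z * v) * (v + v^-1 - y - y^-1) * (v + v^-1 - z - z^-1)
  = v * (v ^+ 3 + v ^- 3 - z ^+ 3 - z ^- 3).
Proof.
move=> yz z0 v0; have -> : y = w / z by rewrite -yz mulfK.
by field: hw; rewrite w0 z0 v0.
Qed.

Lemma even_pf_det_step n z xs : z != 0 -> {in xs, forall x, x != 0} ->
  E xs * alt_det (@den_fun F) xs
    = det_const n * (\prod_(x <- xs) x) ^+ n * alt_det (@num_fun F) xs ->
  E (w / z :: z :: xs) * alt_det (@den_fun F) (w / z :: z :: xs)
  = det_const n.+1 * (\prod_(x <- (w / z :: z :: xs)) x) ^+ n.+1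
     * alt_det (@num_fun F) (w / z :: z :: xs).
Proof.
move=> z0 x0 IH; have yz : w / z * z = w by rewrite mulfVK.
have y0 : w / z != 0 by rewrite mulf_neq0 ?invr_eq0.
set y := w / z in yz y0 *.
rewrite (even_pf_corner hw yz) ?mem_head //= eqxx !alt_det_den_cons //; last first.
  by move=> x; rewrite inE => /predU1P[->|/x0].
rewrite alt_det_num_cons2 //; last by rewrite yz !exprS expr0; ring: hw.
have -> : \prod_(x <- [:: y, z & xs]) x = w * \prod_(x <- xs) x.
  by rewrite !big_cons mulrA yz.
rewrite !big_cons exprMn [det_const n.+1 * _]mulrA det_const_rec.
set P1 := \prod_(v <- xs) ((1 - w * y * v) * _); set P2 := \prod_(x <- xs) (_ - y^-1).
set P3 := \prod_(x <- xs) (_ - z^-1); set P4 := \prod_(x <- xs) (_ - z ^- 3).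
have PE : P1 * P2 * P3 = \prod_(x <- xs) x * P4.
  rewrite -!big_split; apply: eq_big_seq => v /x0 v0; exact: corner_product.
rewrite [_ ^+ n.+1]exprS.
transitivity ((1 - w) * w * (den_fun 0 y * den_fun 0 z * (z + z^-1 - y - y^-1)) *
  (P1 * P2 * P3) * (E xs * alt_det (@den_fun F) xs)); first by ring.
by rewrite PE IH; ring.
Qed.

(** Multiplication by [y ^+ (2 * n.+1)] clears the poles. Both sides vanish at 1 and -1 and at [x]
    and [x^-1] for [x] in [xs], the numerator alternant being odd under inversion of [y]; the nodes
    [w / z] are left to the corner recursion. *)
Lemma even_pf_det n y xs : size xs = (2 * n).+1 -> y != 0 -> separated xs ->
  E (y :: xs) * alt_det (@den_fun F) (y :: xs)
  = det_const n.+1 * (\prod_(x <- (y :: xs)) x) ^+ n.+1 * alt_det (@num_fun F) (y :: xs).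
Proof.
elim/ltn_ind: n y xs => n IH y xs sz y0 sxs.
have /andP[xs0 uxs] := sxs.
have x0 : {in xs, forall x, x != 0} by move=> x xxs; apply: contraNneq xs0 => <-.
have [p sp pE] := even_pf_poly w xs.
have [cof numE] := alt_det_cons (@num_fun F) xs.
pose D := alt_det (@den_fun F) xs.
pose PL : {poly F} := (1%:P * 'X + (-1)%:P) * ((1%:P * 'X + 1%:P)
  * (\prod_(x <- xs) (((-1)%:P * 'X + x%:P) * (1%:P * 'X + (- x^-1)%:P)) * (D%:P * p))).
pose PR : {poly F} := (det_const n.+1 * (\prod_(x <- xs) x) ^+ n.+1)%:P
  * \sum_(j < (size xs).+1) (cof j)%:P
       * ('X^(3 * n + 2 + (3 * j + 2)./2) - 'X^(3 * n + 2 - (3 * j + 2)./2)).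
(* The largest exponent, at [j = 2 * n + 1], is [3 * n + 2], so the truncated subtraction in [PR] is
   exact. *)
have ej (j : 'I_(size xs).+1) : ((3 * j + 2)./2 <= 3 * n + 2)%N.
  by case: j => j /=; rewrite sz; lia.
have PLh v : PL.[v] = (v - 1) * ((v + 1)
     * (\prod_(x <- xs) ((x - v) * (v - x^-1)) * (D * p.[v]))).
  have PP : (\prod_(x <- xs) (((-1)%:P * 'X + x%:P) * (1%:P * 'X + (- x^-1)%:P))).[v]
      = \prod_(x <- xs) ((x - v) * (v - x^-1)).
    by rewrite horner_prod; apply: eq_bigr => x _; rewrite !hornerE; ring.
  by rewrite /PL 4!hornerM PP hornerC !hornerE.
have PLE v : v != 0 ->
    v ^+ (2 * n.+1) * (E (v :: xs) * alt_det (@den_fun F) (v :: xs)) = v * PL.[v].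
  move=> v0; rewrite alt_det_den_cons // PLh pE -/D.
  have -> : \prod_(x <- xs) ((x - v) * (v - x^-1))
      = v ^+ size xs * \prod_(x <- xs) (x + x^-1 - v - v^-1).
    elim: (xs) x0 => [|x s IHs] s0; first by rewrite !big_nil mulr1.
    rewrite !big_cons IHs => [|z zs]; last by apply: s0; rewrite inE zs orbT.
    have {}s0 := s0 _ (mem_head _ _).
    by rewrite /= exprS; field; rewrite s0 v0.
  by rewrite mulnS sz addSn exprS /den_fun /sym_pow; field.
have PRE v : v != 0 ->
    v ^+ (2 * n.+1) * (det_const n.+1 * (\prod_(x <- (v :: xs)) x) ^+ n.+1
      * alt_det (@num_fun F) (v :: xs)) = v * PR.[v].
  move=> v0; rewrite numE big_cons exprMn /PR hornerM hornerC horner_sum.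
  rewrite !mulr_sumr; apply: eq_bigr => j _.
  rewrite hornerM hornerC hornerD hornerN !hornerXn /num_fun /sym_pow exprB ?unitfE // exprD.
  have -> : v ^+ (3 * n + 2) = v ^+ (2 * n.+1) * v ^+ n.+1 / v.
    by rewrite -exprD (_ : 2 * n.+1 + n.+1 = (3 * n + 2).+1)%N ?exprS; [field | lia].
  have := expf_neq0 (3 * j + 2)./2 v0; move: (v ^+ (3 * j + 2)./2) => V V0.
  by field; rewrite v0 V0.
have vI := mulfI (expf_neq0 (2 * n.+1) y0).
apply: vI; rewrite PLE // PRE //; congr (_ * _.[_]); apply: (poly_eq_on uxs).
- rewrite /= !size_cat !size_map.
  apply: (@leq_trans (1 + (1 + (size xs * 2 + (0 + size xs))))); last by rewrite sz; lia.
  rewrite /PL !size_mul_leq_add ?size_lin_leq ?size_polyC_leq1 //.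
  apply: size_prod_leq_mul => x.
  by rewrite (@size_mul_leq_add _ _ _ 1 2) ?size_lin_leq.
- rewrite /= !size_cat !size_map.
  apply: (@leq_trans (0 + (6 * n + 5))); last by rewrite sz; lia.
  rewrite size_mul_leq_add ?size_polyC_leq1 //.
  apply: (big_ind (fun p : {poly F} => (size p <= 6 * n + 5)%N)) => [|p1 p2 s1 s2|j _].
  + by rewrite size_poly0.
  + by rewrite (leq_trans (size_polyD _ _)) // geq_max s1.
  rewrite (@size_mul_leq_add _ _ _ 0) ?size_polyC_leq1 //.
  rewrite (leq_trans (size_polyD _ _)) // size_polyN !size_polyXn geq_max.
  by have := ej j; lia.
move=> r; rewrite !mem_cat => /or4P[r1|rxs|/mapP[x xxs ->]|/mapP[z zxs ->]].
- have r2 : r ^+ 2 = 1 by move: r1; rewrite !inE => /orP[]/eqP ->; rewrite ?sqrrN expr1n.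
  have r0 : r != 0.
    by apply: contra_eq_neq r2 => ->; rewrite expr0n eq_sym oner_neq0.
  apply: (mulfI r0); rewrite -PRE // alt_det_num_sqr1 // !mulr0 PLh.
  have -> : (r - 1) * ((r + 1) * (\prod_(x <- xs) ((x - r) * (r - x^-1)) * (D * p.[r])))
      = (r ^+ 2 - 1) * (\prod_(x <- xs) ((x - r) * (r - x^-1)) * (D * p.[r])) by ring.
  by rewrite r2 subrr mul0r mulr0.
- apply: (mulfI (x0 _ rxs)); rewrite -PRE ?x0 // alt_det_mem // !mulr0 PLh.
  by rewrite (big_rem _ rxs) /= subrr !(mul0r, mulr0).
- have rx0 : x^-1 != 0 by rewrite invr_eq0 x0.
  apply: (mulfI rx0); rewrite -PRE // alt_det_numV alt_det_mem // oppr0 !mulr0 PLh.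
  by rewrite (big_rem _ xxs) /= subrr !(mul0r, mulr0).
have yz0 : w / z != 0 by rewrite mulf_neq0 // invr_eq0 x0.
apply: (mulfI yz0); rewrite -PRE // -PLE //; congr (_ * _).
have pz : perm_eq (w / z :: xs) (w / z :: z :: rem z xs) by rewrite perm_cons perm_to_rem.
have [e e0 detE] := alt_det_perm pz.
rewrite (even_pf_perm hw pz) (perm_big _ pz) /= !detE.
rewrite mulrCA [RHS]mulrCA; congr (_ * _).
apply: even_pf_det_step => //; first exact: x0.
  by move=> x /mem_rem /x0.
have: subseq (rem z xs) xs := rem_subseq _ _.
have: size (rem z xs) = (2 * n)%N by rewrite size_rem // sz; lia.
have: {in rem z xs, forall x, x != 0} by move=> x /mem_rem /x0.
(* Removing [z] may empty the list; this is the case [n = 0], where both determinants are empty and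
   the induction hypothesis has no first argument to act on. *)
case: (rem z xs) => [|x xs'] s0 sz' sub.
  have -> : n = 0%N by move: sz' => /=; lia.
  by rewrite big_nil /alt_det !det_mx00 expr1n /det_const !expr0 !mulr1.
case: n IH {sz PR PRE ej PLE} sz' => // n IH sz'.
apply: IH => //; first by move: sz' => /=; lia.
  by apply: s0; rewrite mem_head.
apply: separated_subseq sxs; apply: subseq_trans sub; exact: subseq_cons.
Qed.

Corollary even_pf_det_list n zs : size zs = (2 * n).+2 -> separated zs ->
  E zs * alt_det (@den_fun F) zs
  = det_const n.+1 * (\prod_(x <- zs) x) ^+ n.+1 * alt_det (@num_fun F) zs.
Proof.
case: zs => // y ys [sz] sep; apply: even_pf_det => //.
  by case/andP: sep; rewrite inE negb_or eq_sym => /andP[].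
exact: separated_subseq (subseq_cons ys y) sep.
Qed.

End EvenDet.

(** * From orientations of the grid to state sums *)

Section IteratedSum.
Variables (T : eqType) (R : comNzRingType).
Implicit Types (ks : seq T) (G A B : (T -> bool) -> R) (kappa : T -> bool).

Definition upd kappa k b : T -> bool := fun k' => if k' == k then b else kappa k'.

(** Summing edge by edge in a chosen order allows the weight of a vertex to be pulled out as soon as
    its edges are fixed. *)
Fixpoint iter_sum ks G kappa : R :=
  if ks is k :: ks' then \sum_b iter_sum ks' G (upd kappa k b) else G kappa.

Lemma iter_sum_cons k ks G kappa :
  iter_sum (k :: ks) G kappa = \sum_b iter_sum ks G (upd kappa k b).
Proof. by []. Qed.

Lemma iter_sum_pull ks A B kappa :
  (forall k1 k2, (forall k, k \notin ks -> k1 k = k2 k) -> A k1 = A k2) ->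
  iter_sum ks (fun k => A k * B k) kappa = A kappa * iter_sum ks B kappa.
Proof.
elim: ks kappa => [|k ks IH] kappa //= Ak; rewrite mulr_sumr.
apply: eq_bigr => b _; rewrite IH; last first.
  by move=> k1 k2 k12; apply: Ak => k'; rewrite inE negb_or => /andP[_ /k12].
by congr (_ * _); apply: Ak => k'; rewrite inE negb_or /upd => /andP[/negPf ->].
Qed.

Lemma eq_iter_sum ks G H kappa : G =1 H -> iter_sum ks G kappa = iter_sum ks H kappa.
Proof. by move=> GH; elim: ks kappa => //= k ks IH kappa; apply: eq_bigr => b _. Qed.

Variables (I : finType) (key : I -> T).
Hypothesis key_inj : injective key.

Definition read (o : {ffun I -> bool}) k := [exists e, (key e == k) && o e].

Lemma readE o e : read o (key e) = o e.
Proof.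
apply/existsP/idP => [[e' /andP[/eqP/key_inj -> //]]|oe].
by exists e; rewrite eqxx.
Qed.

Lemma sum_ffun_iter_sum ks G :
  (forall k1 k2, k1 =1 k2 -> G k1 = G k2) -> uniq ks -> ks =i codom key ->
  \sum_(o : {ffun I -> bool}) G (read o) = iter_sum ks G (fun _ => false).
Proof.
move=> Gext uks ksI.
pose base0 : T -> bool := fun _ => false; rewrite -/base0.
have b0 : forall k, k \notin codom key -> base0 k = false by [].
(* Generalised to orientations that are free on [ks] and agree with [base] elsewhere, so that each
   summed edge moves from [ks] into [base]. *)
suff H : forall base, (forall k, k \notin codom key -> base k = false) ->
    {subset ks <= codom key} ->
  \sum_(o : {ffun I -> bool} | [forall e, (key e \in ks) || (o e == base (key e))]) G (read o)
    = iter_sum ks G base.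
  rewrite -H => [|//|k]; last by rewrite ksI.
  apply: eq_bigl => o; apply/esym/forallP => e.
  by rewrite ksI codom_f.
elim: ks uks {ksI b0} => [|k ks IH] /=.
  move=> _ base b0 _; rewrite (big_pred1 [ffun e => base (key e)]).
    apply: Gext => k; case: (boolP (k \in codom key)) => [/codomP[e ->]|nk].
      by rewrite readE ffunE.
    rewrite b0 //; apply/existsP => -[e /andP[/eqP ke _]].
    by rewrite -ke codom_f in nk.
  move=> o; apply/forallP/eqP => [oe|-> e]; last by rewrite ffunE.
  by apply/ffunP => e; rewrite ffunE (eqP (oe e)).
move=> /andP[nk uks] base b0 sub.
have /codomP[e0 ke0] : k \in codom key by apply: sub; rewrite mem_head.
rewrite (partition_big (fun o : {ffun I -> bool} => o e0) xpredT) //=.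
apply: eq_bigr => b _; rewrite -IH //; last first.
- by move=> k' kks; apply: sub; rewrite inE kks orbT.
- move=> k' nk'; rewrite /upd; case: eqP => [k'k|_]; last exact: b0.
  by rewrite k'k ke0 codom_f in nk'.
apply: eq_bigl => o; apply/andP/forallP => [[/forallP oe /eqP ob] e|oe].
  rewrite /upd; case: (eqVneq (key e) k) => [kek|nek].
    by move: kek; rewrite ke0 => /key_inj ->; rewrite ob eqxx orbT.
  by have := oe e; rewrite inE (negPf nek).
split; last by have := oe e0; rewrite -ke0 (negPf nk) /upd eqxx.
apply/forallP => e; rewrite inE; case: (eqVneq (key e) k) => //= nek.
by have := oe e; rewrite /upd (negPf nek).
Qed.

End IteratedSum.

(** * Summation over the edges of the grid, row by row *)

Section GridSum.
Variables (R : comNzRingType) (U : Type) (m : nat).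
Variables (W : U -> U -> bool -> bool -> bool -> bool -> R) (K : U -> bool -> bool -> R).
Variable u : nat -> U.

(* [(true, (i, j))] is the edge from (i, j) to (i, j + 1), and [(false, (i, j))]
   the edge from (i, j) to (i + 1, j). *)
Definition edge_key : eqType := (bool * (nat * nat))%type.
Implicit Types (kappa : edge_key -> bool).

(** The right edge precedes the lower one, and cells run from left to right, to match the order of
    summation in [row_sum]. *)
Definition cell_keys i j : seq edge_key := [:: (true, (i, j)); (false, (i, j))].
Definition row_keys i : seq edge_key :=
  (true, (i, i)) :: flatten [seq cell_keys i j | j <- iota i.+1 (m - i)].
Definition top_keys : seq edge_key := [seq (false, (0%N, j)) | j <- iota 1 m].
Definition grid_keys : seq edge_key :=
  top_keys ++ flatten [seq row_keys i | i <- iota 1 m].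

Definition bulk_val i j kappa : R :=
  W (u i) (u j) (kappa (true, (i, j.-1))) (kappa (false, (i.-1, j)))
    (kappa (true, (i, j))) (kappa (false, (i, j))).
Definition left_val i kappa : R :=
  K (u i) (kappa (false, (i.-1, i))) (kappa (true, (i, i))).
(** The boundary conditions, here and in [top_val], are encoded as zero weights, so that the sum can
    run over all orientations. *)
Definition right_val i kappa : R := if kappa (true, (i, m)) then 0 else 1.
Definition top_val j kappa : R := if kappa (false, (0%N, j)) then 0 else 1.

Definition rows_val (rs : seq nat) kappa : R :=
  \prod_(i <- rs) (left_val i kappa *
     ((\prod_(j <- iota i.+1 (m - i)) bulk_val i j kappa) * right_val i kappa)).
Definition grid_val kappa : R :=
  (\prod_(j <- iota 1 m) top_val j kappa) * rows_val (iota 1 m) kappa.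

Definition after i j (k : edge_key) : bool := (i < k.2.1)%N || (k.2.1 == i) && (j < k.2.2)%N.

Lemma iter_sum_row i j l rk Rest f kappa : (0 < i)%N -> (i < j)%N -> (j + l = m.+1)%N ->
  all (fun k => i < k.2.1)%N rk ->
  (forall kappa', (forall j', (j' < j)%N -> kappa' (false, (i, j')) = kappa (false, (i, j'))) ->
     iter_sum rk Rest kappa' = f [seq kappa' (false, (i, j')) | j' <- iota j l]) ->
  iter_sum (flatten [seq cell_keys i j' | j' <- iota j l] ++ rk)
    (fun k => ((\prod_(j' <- iota j l) bulk_val i j' k) * right_val i k) * Rest k) kappa
  = row_sum W (u i) [seq u j' | j' <- iota j l] (kappa (true, (i, j.-1))) f
      [seq kappa (false, (i.-1, j')) | j' <- iota j l].
Proof.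
move=> i0; elim: l j f kappa => [|l IH] j f kappa ij jl rkP Rf.
  rewrite /= iter_sum_pull; last first.
    move=> k1 k2 k12; rewrite !big_nil !mul1r /right_val k12 //.
    by apply: contraTN isT => /(allP rkP) /=; rewrite ltnn.
  have <- : m = j.-1 by lia.
  by rewrite big_nil mul1r /right_val Rf //; case: ifP; rewrite ?mul0r ?mul1r.
have -> : flatten [seq cell_keys i j' | j' <- iota j l.+1] ++ rk =
  (true, (i, j)) :: (false, (i, j)) :: flatten [seq cell_keys i j' | j' <- iota j.+1 l] ++ rk.
  by [].
rewrite iter_sum_cons [RHS]/=; apply: eq_bigr => r _.
rewrite iter_sum_cons; apply: eq_bigr => b _.
set kappa1 := upd _ _ b.
rewrite (@eq_iter_sum _ _ _ _ (fun k => bulk_val i j k *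
  (((\prod_(j' <- iota j.+1 l) bulk_val i j' k) * right_val i k) * Rest k))); last first.
  by move=> k; rewrite big_cons !mulrA.
have ksP : all (after i j) (flatten [seq cell_keys i j' | j' <- iota j.+1 l] ++ rk).
  rewrite all_cat; apply/andP; split; last first.
    by apply: sub_all rkP => k ik; rewrite /after ik.
  apply/allP => k /flatten_mapP[j' ]; rewrite mem_iota => /andP[jj' _].
  by rewrite !inE => /orP[]/eqP ->; rewrite /after /= eqxx jj' orbT.
have notin k : ~~ after i j k -> k \notin flatten [seq cell_keys i j' | j' <- iota j.+1 l] ++ rk.
  by apply: contra => /(allP ksP).
rewrite iter_sum_pull; last first.
  move=> k1 k2 k12; rewrite /bulk_val !k12 // notin // /after /=; apply/negP; lia.
have ji : (i.-1 == i) = false by lia.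
rewrite (IH _ (fun bs => f (b :: bs))) //; last 3 first.
- lia.
- lia.
- move=> kappa' kE; rewrite Rf => [|j' j'j]; last first.
    by rewrite kE ?ltnS 1?ltnW // /kappa1 /upd !xpair_eqE /= eqxx ltn_eqF.
  by rewrite /= kE // /kappa1 /upd eqxx.
have k1h j' : (j' < j)%N -> kappa1 (true, (i, j')) = kappa (true, (i, j')).
  by move=> j'j; rewrite /kappa1 /upd !xpair_eqE /= eqxx ltn_eqF.
have k1v j' : kappa1 (false, (i.-1, j')) = kappa (false, (i.-1, j')).
  by rewrite /kappa1 /upd !xpair_eqE /= ji.
congr (_ * _).
  rewrite /bulk_val k1h ?k1v; last lia.
  by rewrite /kappa1 /upd !xpair_eqE /= !eqxx.
have -> : kappa1 (true, (i, j.+1.-1)) = r by rewrite /kappa1 /upd !xpair_eqE /= !eqxx.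
by congr row_sum; apply: eq_map.
Qed.

Lemma iter_sum_rows l i kappa : (0 < i)%N -> (i + l = m.+1)%N ->
  iter_sum (flatten [seq row_keys i' | i' <- iota i l]) (rows_val (iota i l)) kappa
  = state_sum W K [seq u i' | i' <- iota i l]
      [seq kappa (false, (i.-1, j)) | j <- iota i l].
Proof.
elim: l i kappa => [|l IH] i kappa i0 il.
  by rewrite /= /rows_val big_nil.
have -> : flatten [seq row_keys i' | i' <- iota i l.+1] = (true, (i, i)) ::
  flatten [seq cell_keys i j | j <- iota i.+1 (m - i)]
     ++ flatten [seq row_keys i' | i' <- iota i.+1 l] by [].
rewrite iter_sum_cons [RHS]/=; apply: eq_bigr => h _.
have -> : (m - i)%N = l by lia.
set rk := flatten [seq row_keys i' | i' <- iota i.+1 l].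
rewrite (@eq_iter_sum _ _ _ _ (fun k => left_val i k *
  (((\prod_(j' <- iota i.+1 l) bulk_val i j' k) * right_val i k) * rows_val (iota i.+1 l) k))); last first.
  by move=> k; rewrite /rows_val big_cons !mulrA (_ : m - i = l)%N //; lia.
have rkP : all (fun k : edge_key => i < k.2.1)%N rk.
  apply/allP => k /flatten_mapP[i' ]; rewrite mem_iota => /andP[ii' _].
  rewrite inE => /predU1P[-> //|/flatten_mapP[j' _]].
  by rewrite !inE => /orP[]/eqP ->.
have ksP : all (after i i) (flatten [seq cell_keys i j' | j' <- iota i.+1 l] ++ rk).
  rewrite all_cat; apply/andP; split; last first.
    by apply: sub_all rkP => k ik; rewrite /after ik.
  apply/allP => k /flatten_mapP[j' ]; rewrite mem_iota => /andP[jj' _].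
  by rewrite !inE => /orP[]/eqP ->; rewrite /after /= eqxx jj' orbT.
rewrite iter_sum_pull; last first.
  move=> k1 k2 k12; rewrite /left_val !k12 //.
    by apply: contraTN isT => /(allP ksP); rewrite /after /=; lia.
  by apply: contraTN isT => /(allP ksP); rewrite /after /=; lia.
rewrite (@iter_sum_row i i.+1 l rk _ (state_sum W K [seq u i' | i' <- iota i.+1 l])) //; last 2 first.
- lia.
- by move=> kappa' _; rewrite IH // addSnnS.
have ii : (i.-1 == i) = false by lia.
congr (_ * _).
  by rewrite /left_val /upd !xpair_eqE /= !eqxx.
by congr row_sum; rewrite /upd !xpair_eqE /= !eqxx.
Qed.

Lemma iter_sum_top js rk Rest kappa : uniq js ->
  all (fun k : edge_key => 0 < k.2.1)%N rk ->
  exists2 kappa', {in js, forall j, kappa' (false, (0%N, j)) = false}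
   & iter_sum ([seq (false, (0%N, j)) | j <- js] ++ rk)
       (fun k => (\prod_(j <- js) top_val j k) * Rest k) kappa
     = iter_sum rk Rest kappa'.
Proof.
suff H : uniq js -> all (fun k : edge_key => 0 < k.2.1)%N rk ->
   exists kappa', [/\ {in js, forall j, kappa' (false, (0%N, j)) = false},
     forall j, j \notin js -> kappa' (false, (0%N, j)) = kappa (false, (0%N, j))
   & iter_sum ([seq (false, (0%N, j)) | j <- js] ++ rk)
       (fun k => (\prod_(j <- js) top_val j k) * Rest k) kappa
     = iter_sum rk Rest kappa'].
  by move=> ujs rkP; have [k' [? _ ?]] := H ujs rkP; exists k'.
elim: js kappa => [|j js IH] kappa.
  by exists kappa; split=> //; apply: eq_iter_sum => k; rewrite big_nil mul1r.
move=> /= /andP[nj ujs] rkP.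
pose kappa1 := upd kappa (false, (0%N, j)) false.
have [kappa' [k0 kN kE]] := IH kappa1 ujs rkP.
exists kappa'; split.
- move=> j'; rewrite inE => /predU1P[->|]; last exact: k0.
  by rewrite kN // /kappa1 /upd eqxx.
- move=> j'; rewrite inE negb_or => /andP[j'j j'js].
  by rewrite kN // /kappa1 /upd !xpair_eqE /= (negPf j'j).
have pull k0' : iter_sum ([seq (false, (0%N, j0)) | j0 <- js] ++ rk)
   (fun k => (\prod_(j0 <- j :: js) top_val j0 k) * Rest k) k0'
   = top_val j k0' * iter_sum ([seq (false, (0%N, j0)) | j0 <- js] ++ rk)
        (fun k => (\prod_(j0 <- js) top_val j0 k) * Rest k) k0'.
  rewrite -iter_sum_pull; first by apply: eq_iter_sum => k; rewrite big_cons mulrA.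
  move=> k1 k2 k12; rewrite /top_val k12 // mem_cat negb_or; apply/andP; split.
    by rewrite mem_map // => x y [].
  by apply: contraTN isT => /(allP rkP).
have top1 b : top_val j (upd kappa (false, (0%N, j)) b) = if b then 0 else 1.
  by rewrite /top_val /upd eqxx.
by rewrite [LHS]/= big_bool !pull !top1 /= mul0r mul1r add0r kE.
Qed.

Lemma iter_sum_grid :
  iter_sum grid_keys grid_val (fun _ => false)
  = state_sum W K [seq u i | i <- iota 1 m] (nseq m false).
Proof.
have rkP : all (fun k : edge_key => 0 < k.2.1)%N (flatten [seq row_keys i | i <- iota 1 m]).
  apply/allP => k /flatten_mapP[i' ]; rewrite mem_iota => /andP[ii' _].
  rewrite inE => /predU1P[-> //|/flatten_mapP[j' _]].
  by rewrite !inE => /orP[]/eqP ->.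
have [k' k0 E] := iter_sum_top (rows_val (iota 1 m)) (fun _ => false) (iota_uniq 1 m) rkP.
rewrite /grid_keys /top_keys E iter_sum_rows //; congr state_sum.
have /all_pred1P -> : all (pred1 false) [seq k' (false, (0%N, j)) | j <- iota 1 m].
  by apply/allP => _ /mapP[j jm ->]; rewrite /= k0.
by rewrite size_map size_iota.
Qed.

End GridSum.

Lemma flatten_uniq (T I : eqType) (s : seq I) (f : I -> seq T) (tag : T -> I) :
  uniq s -> (forall i, i \in s -> uniq (f i)) ->
  (forall i k, i \in s -> k \in f i -> tag k = i) -> uniq (flatten (map f s)).
Proof.
elim: s => //= i s IH /andP[ni us] fu ft; rewrite cat_uniq fu ?mem_head //=.
rewrite IH ?andbT // => [|j js|j k js]; last 2 first.
- by apply: fu; rewrite inE js orbT.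
- by apply: ft; rewrite inE js orbT.
apply/hasPn => k /flatten_mapP[j js kj]; apply: contra ni => ki.
have <- : j = i by rewrite -(ft j k) ?(ft i k) ?inE ?eqxx ?js ?orbT.
exact: js.
Qed.

(** * Edges, arrows and degrees in the grid *)

Section Vertices.
Variable m : nat.
Implicit Types (x y : nat * nat) (o : orientation m).

Definition is_edge x y := horizontal_edge m x y || vertical_edge m x y.

Lemma grid_vertex_box x : grid_vertex m x -> (x.1 < m.+1)%N && (x.2 < m.+2)%N.
Proof.
rewrite /grid_vertex /top_vertex /left_vertex /bulk_vertex /right_vertex.
by case: x => i j /=; lia.
Qed.

Lemma is_edge_step x y : is_edge x y ->
  [/\ (y.1 + y.2 = (x.1 + x.2).+1)%N, grid_vertex m x, grid_vertex m y
   & y = if y.1 == x.1 then (x.1, x.2.+1) else (x.1.+1, x.2)].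
Proof.
case: x y => [i j] [i' j'] /orP[]/and5P[gx gy _ /= /eqP ei /eqP ej]; subst i' j'; split=> //=.
- by rewrite addnS.
- by rewrite eqxx.
- by rewrite gtn_eqF.
Qed.

Lemma coords_inj : injective (@coords m).
Proof. by move=> [a b] [c d] [/val_inj -> /val_inj ->]. Qed.

Lemma edge_of x y : is_edge x y ->
  exists e : edge m, coords (val e).1 = x /\ coords (val e).2 = y.
Proof.
move=> xy; have [_ /grid_vertex_box/andP[x1 x2] /grid_vertex_box/andP[y1 y2] _] := is_edge_step xy.
pose a : box m := (Ordinal x1, Ordinal x2); pose b : box m := (Ordinal y1, Ordinal y2).
have ca : coords a = x by case: (x) x1 x2 @a.
have cb : coords b = y by case: (y) y1 y2 @b.
have ab : horizontal_edge m (coords a) (coords b) || vertical_edge m (coords a) (coords b).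
  by rewrite ca cb.
by exists (Sub (a, b) ab).
Qed.

Lemma is_edge_val (e : edge m) : is_edge (coords (val e).1) (coords (val e).2).
Proof. exact: (valP e). Qed.

Definition key (e : edge m) : edge_key :=
  ((coords (val e).2).1 == (coords (val e).1).1, coords (val e).1).

Lemma key_inj : injective key.
Proof.
move=> e e' [k1 k2 k3]; apply: val_inj.
have [_ _ _ E] := is_edge_step (is_edge_val e).
have [_ _ _ E'] := is_edge_step (is_edge_val e').
have kk : coords (val e).1 = coords (val e').1 by congr pair.
rewrite k1 kk -E' in E.
by rewrite [LHS]surjective_pairing (coords_inj kk) (coords_inj E) -surjective_pairing.
Qed.

Local Notation kappa o := (read key o).

(** An edge raises the sum of the coordinates by one, so the reversed pair is never listed as an
    edge and the arrow is decided by a single Boolean. *)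
Lemma arrow_edge o x y : is_edge x y ->
  arrow o x y = kappa o (y.1 == x.1, x) /\ arrow o y x = ~~ kappa o (y.1 == x.1, x).
Proof.
move=> xy; have [e0 [e1 e2]] := edge_of xy.
have -> : kappa o (y.1 == x.1, x) = o e0.
  by rewrite -(readE key_inj) /key e1 e2.
have uniq_e (e : edge m) : coords (val e).1 = x -> coords (val e).2 = y -> e = e0.
  rewrite -e1 -e2 => /coords_inj c1 /coords_inj c2; apply: val_inj.
  by rewrite [LHS]surjective_pairing c1 c2 -surjective_pairing.
have [s _ _ _] := is_edge_step xy.
have opp (e : edge m) : coords (val e).1 = y -> coords (val e).2 = x -> False.
  move=> c1 c2; have [s' _ _ _] := is_edge_step (is_edge_val e).
  by rewrite c1 c2 in s'; lia.
split; apply/existsP/idP => [[e /=]|oe].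
- case: ifP => oe /andP[/eqP c1 /eqP c2]; last by case: (opp e).
  by rewrite -(uniq_e e).
- by exists e0; rewrite oe e1 e2 /= !eqxx.
- case: ifP => oe /andP[/eqP c1 /eqP c2]; first by case: (opp e).
  by rewrite -(uniq_e e) // oe.
- by exists e0; rewrite (negPf oe) e1 e2 /= !eqxx.
Qed.

Lemma arrow_is_edge o x y : arrow o x y -> is_edge x y || is_edge y x.
Proof.
move=> /existsP[e /=]; case: ifP => _ /andP[/eqP<- /eqP<-]; rewrite is_edge_val //.
by rewrite orbT.
Qed.

Lemma card_box (P : pred (nat * nat)) s : uniq s ->
  (forall x, P x -> (x \in s) && grid_vertex m x) ->
  #|[set p : box m | P (coords p)]| = count P s.
Proof.
move=> us Ps; rewrite cardE -size_filter -(size_map (@coords m)).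
apply/perm_size/uniq_perm; rewrite ?filter_uniq ?map_inj_uniq ?enum_uniq //.
  exact: coords_inj.
move=> x; rewrite mem_filter; apply/mapP/andP => [[p]|[Px xs]].
  by rewrite mem_enum inE => Pp ->; split=> //; case/andP: (Ps _ Pp).
have /andP[_ /grid_vertex_box/andP[x1 x2]] := Ps x Px.
exists (Ordinal x1, Ordinal x2); last by rewrite /coords /= -surjective_pairing.
by rewrite mem_enum inE /coords /= -surjective_pairing.
Qed.

Lemma indegreeE o x s : uniq s -> (forall y, is_edge x y || is_edge y x -> y \in s) ->
  indegree o x = count (fun y => arrow o y x) s.
Proof.
move=> us xs; apply: card_box => // y /arrow_is_edge; rewrite orbC => yx.
rewrite xs //; case/orP: yx => /is_edge_step[] //.
Qed.

Lemma outdegreeE o x s : uniq s -> (forall y, is_edge x y || is_edge y x -> y \in s) ->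
  outdegree o x = count (fun y => arrow o x y) s.
Proof.
move=> us xs; apply: (@card_box (arrow o x)) => // y /arrow_is_edge yx.
rewrite xs //; case/orP: yx => /is_edge_step[] //.
Qed.

Lemma hedge i j : (0 < i)%N -> (i <= j <= m)%N -> is_edge (i, j) (i, j.+1).
Proof.
move=> i0 ij; apply/orP; left; rewrite /horizontal_edge /grid_vertex /top_vertex
  /left_vertex /bulk_vertex /right_vertex /= !eqxx i0.
by lia.
Qed.

Lemma vedge i j : (i < j <= m)%N -> is_edge (i, j) (i.+1, j).
Proof.
move=> ij; apply/orP; right; rewrite /vertical_edge /grid_vertex /top_vertex
  /left_vertex /bulk_vertex /right_vertex /= !eqxx.
by lia.
Qed.

End Vertices.

Lemma bulk_bounds m i j : ((1 <= i) && (i < j <= m))%N ->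
  [/\ 0 < i, 0 < j, i <= j.-1 <= m, i <= j <= m & (i.-1 < j <= m) && (i < j <= m)]%N.
Proof. by move=> ij; split; lia. Qed.

Lemma neighbours_uniq i j : (0 < i)%N -> (0 < j)%N ->
  uniq [:: (i, j.-1); (i, j.+1); (i.-1, j); (i.+1, j)].
Proof. by move=> i0 j0; rewrite /= !inE !xpair_eqE; lia. Qed.

(** * The partition function as a state sum *)

Section Conversion.
Variables (F : fieldType) (m : nat) (q : F) (us : seq F).
Implicit Types (o : orientation m) (x : nat * nat).

(** The cases are those of [bulk_weight], which asks whether arrows point in; on the right and lower
    edges [true] points out, hence the negations. *)
Definition six_weight (u v : F) (l t r b : bool) : {poly F} :=
  (match l, ~~ r, t, ~~ b with
  | true, true, false, false | false, false, true, true => 1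
  | false, true, false, true | true, false, true, false =>
      sigma_hat q (q ^+ 2 * u^-1 * v^-1)
  | false, true, true, false | true, false, false, true =>
      sigma_hat q (q ^+ 2 * u * v)
  | _, _, _, _ => 0
  end)%:P.

Definition corner_weight (u : F) (t h : bool) : {poly F} :=
  if t == h then 'X else (sigma (q * u) / sigma q)%:P.

Let uf i := us`_i.-1.
Local Notation kappa o := (read (@key m) o).

Definition local_weight o x : {poly F} :=
  if top_vertex m x then top_val {poly F} x.2 (kappa o)
  else if left_vertex m x then left_val corner_weight uf x.1 (kappa o)
  else if bulk_vertex m x then bulk_val six_weight uf x.1 x.2 (kappa o)
  else right_val {poly F} m x.1 (kappa o).

Definition local_six o x : bool :=
  [&& bulk_vertex m x ==> (indegree o x == 2) && (outdegree o x == 2),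
      top_vertex m x ==> (outdegree o x == 0)
    & right_vertex m x ==> (indegree o x == 0)].

Lemma top_outdegree o j : (1 <= j <= m)%N -> outdegree o (0%N, j) = kappa o (false, (0%N, j)).
Proof.
move=> jm; rewrite (@outdegreeE _ _ _ [:: (1, j)%N]) //=; last first.
  move=> [a b]; rewrite inE xpair_eqE.
  case/orP => /orP[]/and5P[/grid_vertex_box/andP[/= ? ?] /grid_vertex_box/andP[/= ? ?]];
    by move=> /= ? /eqP ? /eqP ?; lia.
by rewrite (proj1 (arrow_edge o (vedge (i := 0) jm))) addn0.
Qed.

Lemma right_indegree o i : (1 <= i <= m)%N ->
  indegree o (i, m.+1) = kappa o (true, (i, m)).
Proof.
move=> im; rewrite (@indegreeE _ _ _ [:: (i, m)%N]) //=; last first.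
  move=> [a b]; rewrite inE xpair_eqE.
  case/orP => /orP[]/and5P[/grid_vertex_box/andP[/= ? ?] /grid_vertex_box/andP[/= ? ?]];
    by move=> /= ? /eqP ? /eqP ?; lia.
have e : is_edge m (i, m) (i, m.+1) by apply: hedge; lia.
by rewrite (proj1 (arrow_edge o e)) /= eqxx addn0.
Qed.

Section Bulk.
Variables (o : orientation m) (i j : nat).
Hypothesis ij : ((1 <= i) && (i < j <= m))%N.
Let l := kappa o (true, (i, j.-1)).
Let r := kappa o (true, (i, j)).
Let t := kappa o (false, (i.-1, j)).
Let b := kappa o (false, (i, j)).

Let eE (a a' b' : nat) : ((a, b').1 == (a, a').1) = true. Proof. by rewrite eqxx. Qed.
Let nE (a a' b' : nat) : ((a.+1, b').1 == (a, a').1) = false. Proof. by rewrite gtn_eqF. Qed.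

Lemma bulk_arrows :
  [/\ arrow o (i, j.-1) (i, j) = l /\ arrow o (i, j) (i, j.-1) = ~~ l,
      arrow o (i, j.+1) (i, j) = ~~ r /\ arrow o (i, j) (i, j.+1) = r,
      arrow o (i.-1, j) (i, j) = t /\ arrow o (i, j) (i.-1, j) = ~~ t
    & arrow o (i.+1, j) (i, j) = ~~ b /\ arrow o (i, j) (i.+1, j) = b].
Proof.
have [i0 j0 b1 b2 /andP[b3 b4]] := bulk_bounds ij.
have := arrow_edge o (hedge i0 b1); have := arrow_edge o (hedge i0 b2).
have := arrow_edge o (vedge b3); have := arrow_edge o (vedge b4).
rewrite !eE !nE (prednK i0) (prednK j0).
by move=> [-> ->] [-> ->] [-> ->] [-> ->].
Qed.

Let nbrs := [:: (i, j.-1); (i, j.+1); (i.-1, j); (i.+1, j)].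

Let nbrs_uniq : uniq nbrs.
Proof. by have [i0 j0 _ _ _] := bulk_bounds ij; exact: neighbours_uniq. Qed.

Let nbrsP y : is_edge m (i, j) y || is_edge m y (i, j) -> y \in nbrs.
Proof.
case: y => a c; rewrite !inE !xpair_eqE.
case/orP => /orP[]/and5P[_ _ _ /= /eqP ei /eqP ej].
- by rewrite ei ej !eqxx !orbT.
- by rewrite ei ej !eqxx !orbT.
- by rewrite ei ej !eqxx.
- by rewrite ei ej !eqxx !orbT.
Qed.

Lemma bulk_indegree : indegree o (i, j) = (l + ~~ r + t + ~~ b)%N.
Proof.
have [[a1 _] [a2 _] [a3 _] [a4 _]] := bulk_arrows.
by rewrite (indegreeE o nbrs_uniq nbrsP) /= a1 a2 a3 a4 addn0 !addnA.
Qed.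

Lemma bulk_outdegree : outdegree o (i, j) = (~~ l + r + ~~ t + b)%N.
Proof.
have [[_ a1] [_ a2] [_ a3] [_ a4]] := bulk_arrows.
by rewrite (outdegreeE o nbrs_uniq nbrsP) /= a1 a2 a3 a4 addn0 !addnA.
Qed.

Lemma bulk_weightE : (bulk_weight q us o i j)%:P = six_weight (uf i) (uf j) l t r b.
Proof.
have [[a1 _] [a2 _] [a3 _] [a4 _]] := bulk_arrows.
by rewrite /bulk_weight a1 a2 a3 a4.
Qed.

End Bulk.

Lemma vertex_weightE o x : grid_vertex m x -> local_six o x ->
  vertex_weight q us o x = local_weight o x.
Proof.
case: x => i j gx /and3P[_ six_t six_r]; rewrite /vertex_weight /local_weight.
case: (boolP (top_vertex m (i, j))) => [tx|ntx].
  move: six_t; rewrite tx; move: tx => /andP[/= /eqP -> jm].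
  rewrite (_ : left_vertex _ _ = false); last by rewrite /left_vertex /=; lia.
  rewrite (_ : bulk_vertex _ _ = false); last by rewrite /bulk_vertex /=; lia.
  by rewrite top_outdegree // /top_val /= eqb0 => /negPf ->.
case: (boolP (left_vertex m (i, j))) => [lx|nlx].
  move: lx; rewrite /left_vertex /= => /andP[/eqP ij im].
  rewrite /left_val /left_weight /corner_weight /=.
  have e1 : is_edge m (i.-1, i) (i.-1.+1, i) by apply: vedge; lia.
  have e2 : is_edge m (i, i) (i, i.+1) by apply: hedge; lia.
  have [a1 _] := arrow_edge o e1; have [_ a2] := arrow_edge o e2.
  move: a1 a2; rewrite /= eqxx gtn_eqF // prednK; last lia.
  by move=> -> ->; case: (kappa o _); case: (kappa o _).
case: (boolP (bulk_vertex m (i, j))) => [bx|nbx].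
  by rewrite bulk_weightE.
have rx : right_vertex m (i, j).
  by move: gx; rewrite /grid_vertex (negPf ntx) (negPf nlx) (negPf nbx).
move: six_r; rewrite rx; move: rx; rewrite /right_vertex /= => /andP[im /eqP ->].
by rewrite right_indegree // /right_val /= eqb0 => /negPf ->.
Qed.

Lemma local_weight_eq0 o x : grid_vertex m x -> ~~ local_six o x -> local_weight o x = 0.
Proof.
case: x => i j gx; rewrite /local_six /local_weight.
case: (boolP (top_vertex m (i, j))) => [|ntx].
  rewrite /top_vertex /= => /andP[/eqP -> jm].
  rewrite (_ : bulk_vertex _ _ = false); last by rewrite /bulk_vertex /=; lia.
  rewrite (_ : right_vertex _ _ = false); last by rewrite /right_vertex /=; lia.
  by rewrite top_outdegree //= andbT eqb0 negbK /top_val => ->.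
case: (boolP (left_vertex m (i, j))) => [|nlx].
  rewrite /left_vertex /= => /andP[/eqP -> jm].
  rewrite (_ : bulk_vertex _ _ = false); last by rewrite /bulk_vertex /=; lia.
  by rewrite (_ : right_vertex _ _ = false); last by rewrite /right_vertex /=; lia.
case: (boolP (bulk_vertex m (i, j))) => [bx|nbx] /=.
  rewrite (_ : right_vertex _ _ = false) ?andbT; last first.
    by move: bx; rewrite /bulk_vertex /right_vertex /=; lia.
  rewrite bulk_indegree // bulk_outdegree // /bulk_val /six_weight /=.
  case: (kappa o (true, (i, j.-1))); case: (kappa o (true, (i, j)));
    case: (kappa o (false, (i.-1, j))); case: (kappa o (false, (i, j))) => //=.
have rx : right_vertex m (i, j).
  by move: gx; rewrite /grid_vertex (negPf ntx) (negPf nlx) (negPf nbx).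
rewrite rx; move: rx; rewrite /right_vertex /= => /andP[im /eqP ->].
by rewrite right_indegree // eqb0 negbK /right_val => ->.
Qed.

(** A violated ice rule or boundary condition makes some local weight zero, which removes the
    restriction to six-vertex configurations. *)
Lemma six_vertex_prod o :
  (if six_vertex o then \prod_(p : box m | grid_vertex m (coords p))
      vertex_weight q us o (coords p) else 0)
  = \prod_(p : box m | grid_vertex m (coords p)) local_weight o (coords p).
Proof.
case: ifP => [/forallP six|/negbT].
  by apply: eq_bigr => p gp; apply: vertex_weightE => //; exact: six.
rewrite negb_forall => /existsP[p np]; have gp : grid_vertex m (coords p).
  apply: contraNT np; rewrite /grid_vertex !negb_or => /and4P[/negPf -> _ /negPf -> /negPf ->].
  by [].
by rewrite (bigD1 p) //= local_weight_eq0 ?mul0r.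
Qed.

Definition grid_vertices : seq (nat * nat) :=
  [seq (0%N, j) | j <- iota 1 m] ++
  flatten [seq (i, i) :: rcons [seq (i, j) | j <- iota i.+1 (m - i)] (i, m.+1) | i <- iota 1 m].

Lemma grid_vertices_uniq : uniq grid_vertices.
Proof.
rewrite /grid_vertices cat_uniq map_inj_uniq ?iota_uniq => [|x y []] //=.
apply/andP; split.
  apply/hasPn => -[a c] /flatten_mapP[i ]; rewrite mem_iota => /andP[i1 _].
  move=> ai; apply/mapP => -[j _ [a0 _]].
  by move: ai; rewrite a0 inE mem_rcons inE !xpair_eqE => /or3P[||/mapP[? _ []]]; lia.
apply: (@flatten_uniq _ _ _ _ fst); first exact: iota_uniq.
  move=> i; rewrite mem_iota => im; rewrite /= rcons_uniq mem_rcons inE negb_or xpair_eqE.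
  rewrite map_inj_uniq ?iota_uniq ?andbT => [|x y []] //.
  apply/andP; split; last by apply/mapP => -[j]; rewrite mem_iota => jm [jE]; lia.
  apply/andP; split; first by lia.
  by apply/mapP => -[j]; rewrite mem_iota => jm [jE]; lia.
move=> i [a c] _; rewrite inE mem_rcons inE => /or3P[/eqP[]|/eqP[]|/mapP[? _ []]] //.
Qed.

Lemma mem_grid_vertices x : (x \in grid_vertices) = grid_vertex m x.
Proof.
case: x => a c; rewrite /grid_vertex /top_vertex /left_vertex /bulk_vertex /right_vertex /=.
rewrite mem_cat; apply/orP/idP => [[/mapP[j]|/flatten_mapP[i ]]|].
- by rewrite mem_iota => jm [-> ->] /=; lia.
- rewrite mem_iota inE mem_rcons inE => im /or3P[/eqP[-> ->]|/eqP[-> ->]|/mapP[j]]; [lia|lia|].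
  by rewrite mem_iota => jm [-> ->]; lia.
move=> gx; have [a0|a0] := eqVneq a 0%N.
  by left; apply/mapP; exists c; rewrite ?a0 // mem_iota; lia.
right; apply/flatten_mapP; exists a; first by rewrite mem_iota; lia.
rewrite inE mem_rcons inE !xpair_eqE eqxx /=.
case: eqP => //= ca; case: eqP => //= cm.
by apply/mapP; exists c => //; rewrite mem_iota; lia.
Qed.

Lemma prod_grid (G : nat * nat -> {poly F}) :
  \prod_(p : box m | grid_vertex m (coords p)) G (coords p)
  = \prod_(x <- grid_vertices) G x.
Proof.
rewrite -big_filter -(big_map (@coords m) xpredT G); apply: perm_big.
apply: uniq_perm; rewrite ?grid_vertices_uniq //.
  rewrite map_inj_uniq ?filter_uniq ?index_enum_uniq //; exact: coords_inj.
move=> x; rewrite mem_grid_vertices; apply/mapP/idP => [[p]|gx].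
  by rewrite mem_filter => /andP[gp _] ->.
have /andP[x1 x2] := grid_vertex_box gx.
exists (Ordinal x1, Ordinal x2); last by rewrite /coords /= -surjective_pairing.
by rewrite mem_filter mem_index_enum /coords /= -surjective_pairing gx.
Qed.

Lemma local_weight_prod o :
  \prod_(p : box m | grid_vertex m (coords p)) local_weight o (coords p)
  = grid_val m six_weight corner_weight uf (kappa o).
Proof.
rewrite (prod_grid (local_weight o)) /grid_vertices big_cat big_map /= /grid_val.
congr (_ * _).
  apply: eq_big_seq => j; rewrite mem_iota => jm.
  by rewrite /local_weight /top_vertex /= (_ : (_ <= _ <= _)%N) //; lia.
rewrite /rows_val big_flatten big_map; apply: eq_big_seq => i; rewrite mem_iota => im.
rewrite big_cons -cats1 big_cat big_seq1 big_map; congr (_ * _).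
  rewrite /local_weight /top_vertex /left_vertex /= eqxx.
  rewrite (_ : (_ == 0)%N = false) /=; last lia.
  by rewrite (_ : (_ <= _ <= _)%N) //; lia.
have ww j : (i < j)%N -> local_weight o (i, j) = if (j <= m)%N then
    bulk_val six_weight uf i j (kappa o) else right_val {poly F} m i (kappa o).
  move=> ij; rewrite /local_weight /top_vertex /left_vertex /bulk_vertex /= (ltn_eqF ij) /=.
  by rewrite (_ : (_ == 0)%N = false) /= ?ij; [rewrite (_ : (0 < i)%N) //; lia | lia].
congr (_ * _); last by rewrite ww ?ltnn //; lia.
apply: eq_big_seq => j; rewrite mem_iota => jm.
have [ij jm'] : (i < j)%N /\ (j <= m)%N by lia.
by rewrite ww // jm'.
Qed.

Lemma grid_keys_uniq : uniq (grid_keys m).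
Proof.
rewrite /grid_keys cat_uniq map_inj_uniq ?iota_uniq => [|x y []] //=.
apply/andP; split.
  apply/hasPn => -[h [a c]] /flatten_mapP[i ]; rewrite mem_iota => /andP[i1 _].
  move=> ai; apply/mapP => -[j _ [_ a0 _]].
  move: ai; rewrite a0 inE => /predU1P[[_ ei _]|/flatten_mapP[j' _]]; first by lia.
  by rewrite !inE !xpair_eqE; lia.
apply: (@flatten_uniq _ _ _ _ (fun k : edge_key => k.2.1)); first exact: iota_uniq.
  move=> i _; rewrite /row_keys /=; apply/andP; split.
    apply/flatten_mapP => -[j]; rewrite mem_iota => jm.
    by rewrite !inE !xpair_eqE; lia.
  apply: (@flatten_uniq _ _ _ _ (fun k : edge_key => k.2.2)); first exact: iota_uniq.
    by [].
  by move=> j [h [a c]] _; rewrite !inE => /orP[]/eqP[].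
move=> i [h [a c]] _; rewrite inE => /predU1P[[]|/flatten_mapP[j' _]] //.
by rewrite !inE => /orP[]/eqP[].
Qed.

Lemma mem_grid_keys : grid_keys m =i codom (@key m).
Proof.
have edge_codom x y : is_edge m x y -> (y.1 == x.1, x) \in codom (@key m).
  by move=> /edge_of[e [<- <-]]; exact: (codom_f (@key m) e).
move=> k; apply/idP/codomP => [|[e ->]].
  move=> kk; apply/codomP; move: kk; rewrite mem_cat => /orP[/mapP[j]|/flatten_mapP[i ]].
    rewrite mem_iota => jm ->; have e : is_edge m (0%N, j) (1%N, j) by apply: vedge; lia.
    exact: edge_codom e.
  have hh i' j : (0 < i')%N -> (i' <= j <= m)%N -> (true, (i', j)) \in codom (@key m).
    by move=> i'0 ij; have := edge_codom _ _ (hedge i'0 ij); rewrite /= eqxx.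
  have vv i' j : (i' < j <= m)%N -> (false, (i', j)) \in codom (@key m).
    by move=> ij; have := edge_codom _ _ (vedge ij); rewrite /= gtn_eqF.
  rewrite mem_iota inE => im /predU1P[->|/flatten_mapP[j]]; first by apply: hh; lia.
  rewrite mem_iota => jm; rewrite !inE => /orP[]/eqP ->; [apply: hh|apply: vv]; lia.
rewrite /key; have := is_edge_val e; move: (coords _) (coords _) => [a' c'] [a c].
rewrite mem_cat; case/orP => /and5P[gx gy /= h1 /eqP h2 /eqP h3].
  rewrite h2 eqxx; have ac : (a <= c <= m)%N.
    move: gx gy; rewrite h2 h3 /grid_vertex /top_vertex /left_vertex /bulk_vertex /right_vertex /=.
    by lia.
  apply/orP; right; apply/flatten_mapP; exists a; first by rewrite mem_iota; lia.
  rewrite inE xpair_eqE eqxx /= xpair_eqE eqxx /=; case: eqP => //= /eqP ca.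
  by apply/flatten_mapP; exists c; rewrite ?mem_head // mem_iota; lia.
rewrite h3 gtn_eqF //; have ac : (a < c <= m)%N.
  move: gx gy; rewrite h2 h3 /grid_vertex /top_vertex /left_vertex /bulk_vertex /right_vertex /=.
  by lia.
apply/orP; have [a0|a0] := eqVneq a 0%N; [left; rewrite a0 | right].
  by apply/mapP; exists c => //; rewrite mem_iota; lia.
apply/flatten_mapP; exists a; first by rewrite mem_iota; lia.
rewrite inE /=; apply/flatten_mapP; exists c; first by rewrite mem_iota; lia.
by rewrite !inE eqxx orbT.
Qed.

Lemma Ztilde_state_sum : size us = m ->
  Ztilde m q us = state_sum six_weight corner_weight us (nseq m false).
Proof.
move=> sz; rewrite /Ztilde big_mkcond /=.
under eq_bigr => o _ do rewrite six_vertex_prod local_weight_prod.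
rewrite (@sum_ffun_iter_sum _ _ _ _ (@key_inj m) (grid_keys m)) ?grid_keys_uniq //.
- rewrite iter_sum_grid; congr state_sum.
  apply: (@eq_from_nth _ 0); rewrite size_map size_iota // => i im.
  by rewrite (nth_map 0%N) ?size_iota // nth_iota.
- move=> k1 k2 k12; rewrite /grid_val /rows_val; congr (_ * _).
    by apply: eq_bigr => j _; rewrite /top_val k12.
  apply: eq_bigr => i _; rewrite /left_val /right_val !k12; congr (_ * (_ * _)).
  by apply: eq_bigr => j _; rewrite /bulk_val !k12.
- exact: mem_grid_keys.
Qed.

End Conversion.

(** * Gauge transformation at a cube root of unity *)

Section Gauge.
Variables (F : fieldType) (q : F).
Hypothesis hq : q ^+ 2 + q ^- 2 = 1.
Hypothesis three_neq0 : 3 != 0 :> F.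
Let w := q ^+ 4.

Lemma gauge_q_neq0 : q != 0.
Proof.
apply: contra_eq_neq hq => ->; rewrite expr0n invr0 addr0 eq_sym; exact: oner_neq0.
Qed.
Let q0 := gauge_q_neq0.

Lemma gauge_q4 : q ^+ 2 * q ^+ 2 = q ^+ 2 - 1.
Proof.
have := congr1 (fun z => z * q ^+ 2) hq.
rewrite mulrDl mulVf ?expf_neq0 // mul1r => E.
by apply: (addIr 1); rewrite E subrK.
Qed.

Lemma gauge_cube_root : w * w = - 1 - w.
Proof.
have wE : w = q ^+ 2 - 1 by rewrite /w -gauge_q4 -exprD.
by rewrite wE; ring: gauge_q4.
Qed.

Lemma gauge_1Bw_sqr : (1 - w) ^+ 2 = - 3 * w.
Proof. by ring: gauge_cube_root. Qed.

Lemma gauge_1Bw_neq0 : 1 - w != 0.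
Proof.
have := cube_root_neq0 gauge_cube_root; apply: contraNneq => w1.
have := gauge_1Bw_sqr; rewrite w1 expr0n /= => /esym/eqP.
by rewrite mulf_eq0 oppr_eq0 (negPf three_neq0) orFb => /eqP ->.
Qed.

Lemma gauge_q2E : q ^+ 2 = 1 + w.
Proof. by rewrite -[LHS](subrK 1) -gauge_q4 -exprD addrC. Qed.

Lemma sigma_hat_q4 x : x != 0 -> sigma_hat q (q ^+ 2 * x) = (1 - w * x ^+ 2) / ((1 - w) * x).
Proof.
move=> x0; have w1 := gauge_1Bw_neq0; have ww := gauge_cube_root.
have w0 := cube_root_neq0 ww; have qE := gauge_q2E.
have q2V : (q ^+ 2)^-1 = - w.
  by apply: (mulfI (expf_neq0 2 q0)); rewrite mulfV ?expf_neq0 // qE; ring: ww.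
have q4V : (q ^+ 4)^-1 = - 1 - w.
  by apply: (mulfI w0); rewrite mulfV // -/w; ring: ww.
rewrite /sigma_hat /sigma invfM q2V q4V -/w qE.
have w2 : w - (-1 - w) = (1 - w) * w by ring: ww.
by rewrite w2; field: ww; rewrite w0 w1 x0.
Qed.

Lemma sigma_hatM u v : u != 0 -> v != 0 ->
  sigma_hat q (q ^+ 2 * u * v) = (1 - w * u ^+ 2 * v ^+ 2) / ((1 - w) * u * v).
Proof.
by move=> u0 v0; rewrite -mulrA sigma_hat_q4 ?mulf_neq0 // exprMn !mulrA.
Qed.

Lemma sigma_hatV u v : u != 0 -> v != 0 ->
  sigma_hat q (q ^+ 2 * u^-1 * v^-1) = (u ^+ 2 * v ^+ 2 - w) / ((1 - w) * u * v).
Proof.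
move=> u0 v0; rewrite sigma_hatM ?invr_eq0 //; have w1 := gauge_1Bw_neq0.
by field; rewrite w1 u0 v0.
Qed.

Lemma corner_weightE u : u != 0 ->
  sigma (q * u) / sigma q = (1 + w - w * u ^+ 2) / u.
Proof.
move=> u0; have ww := gauge_cube_root; have w0 := cube_root_neq0 ww.
have qq : q * q = 1 + w by rewrite -expr2 gauge_q2E.
have -> : sigma q = w / q by rewrite /sigma; field: qq.
by rewrite /sigma; field: qq ww; rewrite w0 q0 u0.
Qed.

Definition sqP (u : F) : {poly F} := (u ^+ 2)%:P.

(** The gauge puts [u^-1] on every edge of line [u] in state [true]. The factors telescope along the
    line, and only its top edge contributes, since its last edge is [false]. *)
Definition line_factor (u : F) (t : bool) : F := if t then u^-1 else 1.

Lemma ice_weight_gauge u v l t r b : u != 0 -> v != 0 ->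
  ice_weight w%:P (sqP u) (sqP v) l t r b * (line_factor u r * line_factor v b)%:P
  = ((1 - w) * u * v * (line_factor u l * line_factor v t))%:P * six_weight q u v l t r b.
Proof.
move=> u0 v0; rewrite /ice_weight /six_weight sigma_hatV // sigma_hatM // /sqP /line_factor.
have w1 := gauge_1Bw_neq0.
case: l; case: t; case: r; case: b => /=;
  rewrite ?mul0r ?polyC0 ?mulr0 // -?polyC1 -?(polyCM, polyCB); congr (_%:P); field;
  rewrite ?w1 ?u0 ?v0 //.
Qed.

Lemma turn_weight_gauge u t h : u != 0 ->
  turn_weight w%:P 'X true (sqP u) t h * (line_factor u h)%:P
  = (u ^+ 2 * line_factor u t)%:P * corner_weight q u t h.
Proof.
move=> u0; rewrite /turn_weight /rho /corner_weight corner_weightE // /sqP /line_factor.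
case: t; case: h => /=; rewrite ?mulr1 // -?polyC1 -?(polyCM, polyCB, polyCD);
  try (by congr (_%:P); field); ring.
Qed.

Fixpoint top_factor (us : seq F) (ts : seq bool) : F :=
  match us, ts with
  | u :: us', t :: ts' => line_factor u t * top_factor us' ts'
  | _, _ => 1
  end.

Lemma row_sum_gauge u vs h (fX fo : seq bool -> {poly F}) ts (C : F) :
  u != 0 -> {in vs, forall v, v != 0} -> size ts = size vs ->
  (forall bs, size bs = size vs -> fX bs = (C * top_factor vs bs)%:P * fo bs) ->
  row_sum (ice_weight w%:P) (sqP u) (map sqP vs) h fX ts
  = (\prod_(v <- vs) ((1 - w) * u * v) * line_factor u h * top_factor vs ts * C)%:P
    * row_sum (six_weight q) u vs h fo ts.
Proof.
move=> u0; elim: vs h fX fo ts C => [|v vs IH] h fX fo [|t ts] C //= v0 => [_|[sz]] fE.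
  by case: h; rewrite ?mulr0 // fE //= big_nil /line_factor !mulr1 !mul1r.
have v0' : {in vs, forall v, v != 0} by move=> z zs; apply: v0; rewrite inE zs orbT.
have {}v0 : v != 0 by apply: v0; rewrite mem_head.
rewrite mulr_sumr; apply: eq_bigr => r _; rewrite mulr_sumr; apply: eq_bigr => b _.
rewrite (IH _ _ (fun bs => fo (b :: bs)) _ (C * line_factor v b)) // => [|bs sb]; last first.
  by rewrite fE /= ?sb //; congr (_%:P * _); ring.
rewrite big_cons.
transitivity (ice_weight w%:P (sqP u) (sqP v) h t r b * (line_factor u r * line_factor v b)%:P
  * (\prod_(v <- vs) ((1 - w) * u * v) * top_factor vs ts * C)%:P
  * row_sum (six_weight q) u vs r (fun bs => fo (b :: bs)) ts).
  by rewrite !polyCM; ring.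
by rewrite ice_weight_gauge // !polyCM; ring.
Qed.

(** Each pair of lines contributes [(1 - w) * u * v] and each turn [u ^+ 2], so every [u] occurs
    [(size us).+1] times. *)
Lemma state_sum_gauge us ts : {in us, forall u, u != 0} -> size ts = size us ->
  ice_sum w%:P 'X true (map sqP us) ts
  = ((1 - w) ^+ 'C(size us, 2) * (\prod_(u <- us) u) ^+ (size us).+1 * top_factor us ts)%:P
    * state_sum (six_weight q) (corner_weight q) us ts.
Proof.
rewrite /ice_sum; elim: us ts => [|u us IH] [|t ts] //= u0.
  by rewrite big_nil expr1n expr0 !mulr1.
move=> [sz]; have u0' : {in us, forall v, v != 0} by move=> z zs; apply: u0; rewrite inE zs orbT.
have {}u0 : u != 0 by apply: u0; rewrite mem_head.
rewrite mulr_sumr; apply: eq_bigr => h _.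
rewrite (row_sum_gauge h u0 u0' sz (fun bs sb => IH bs u0' sb)).
rewrite big_cons binS bin1.
have -> : \prod_(v <- us) ((1 - w) * u * v)
    = (1 - w) ^+ size us * u ^+ size us * \prod_(v <- us) v.
  elim: (us) => [|v s IHs]; first by rewrite !big_nil !mulr1.
  by rewrite !big_cons IHs !exprS; ring.
transitivity (turn_weight w%:P 'X true (sqP u) t h * (line_factor u h)%:P *
   ((1 - w) ^+ size us * u ^+ size us * (\prod_(v <- us) v) * top_factor us ts *
    ((1 - w) ^+ 'C(size us, 2) * (\prod_(u1 <- us) u1) ^+ (size us).+1))%:P *
   row_sum (six_weight q) u us h (state_sum (six_weight q) (corner_weight q) us) ts).
  by rewrite !polyCM; ring.
rewrite turn_weight_gauge // exprMn exprD !exprS !polyCM; ring.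
Qed.

End Gauge.

(** * The symplectic character as an even partition function *)

Section RationalFunctions.
Variables (F : fieldType) (N : nat).
Local Notation L := {fraction {mpoly F[N]}}.

Definition ratC : {rmorphism F -> L} := (@FracField.tofrac {mpoly F[N]}) \o (@mpolyC N F).
Definition ratX (i : 'I_N) : L := ('X_i : {mpoly F[N]})%:F.

Lemma ratX_monomial_neqC c i j a b : c != 0 -> (0 < a)%N ->
  ratX i ^+ a * ratX j ^+ b != ratC c.
Proof.
move=> c0 a0; rewrite /ratX /= -!tofracXn -tofracM tofrac_eq; apply: contraNneq c0.
move=> /(congr1 (fun p : {mpoly F[N]} => p.@[fun _ => 0])).
rewrite mevalM !rmorphXn /= mevalC !mevalXU => <-.
by rewrite expr0n gtn_eqF // mul0r.
Qed.

Lemma ratX_expr_eq c i j a : (0 < a)%N -> ratX i ^+ a = ratC c * ratX j ^+ a ->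
  i = j /\ c = 1.
Proof.
move=> a0; rewrite /ratX /= -!tofracXn -tofracM => /eqP; rewrite tofrac_eq => /eqP E.
have /(_ (fun k => (k == i)%:R)) := congr1 (fun p : {mpoly F[N]} => p.@[_]) E.
rewrite mevalM !rmorphXn /= mevalC !mevalXU eqxx expr1n.
case: eqP => [->|_]; first by rewrite expr1n mulr1.
by rewrite expr0n gtn_eqF // mulr0 => /eqP; rewrite oner_eq0.
Qed.

Lemma ratX_neq0 i : ratX i != 0.
Proof.
rewrite tofrac_eq0; apply/eqP => /(congr1 (fun p : {mpoly F[N]} => p.@[fun _ => 1])).
by rewrite mevalXU meval0 => /eqP; rewrite oner_eq0.
Qed.

Lemma ratX_neqC c i a : c != 0 -> (0 < a)%N -> ratX i ^+ a != ratC c.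
Proof. by move=> c0 a0; have := ratX_monomial_neqC i i 0 c0 a0; rewrite expr0 mulr1. Qed.

Lemma ratX_inj i j a : (0 < a)%N -> ratX i ^+ a = ratX j ^+ a -> i = j.
Proof.
move=> a0 E; have [] // := @ratX_expr_eq 1 i j a a0.
by rewrite rmorph1 mul1r.
Qed.

End RationalFunctions.

Section DetAux.
Variable K : fieldType.

Lemma alt_det_map N (x : 'I_N -> K) g :
  alt_det g [seq x i | i <- enum 'I_N] = \det (\matrix_(i < N, j < N) g j (x i)).
Proof.
have E xs : size xs = N -> alt_det g xs = \det (\matrix_(i < N, j < N) g j xs`_i).
  by move=> sz; case: N / sz {x}.
have sz : size [seq x i | i <- enum 'I_N] = N by rewrite size_map size_enum_ord.
rewrite (E _ sz); congr (\det _); apply/matrixP => i j.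
by rewrite !mxE (nth_map i) ?size_enum_ord // nth_ord_enum.
Qed.

(** The character lists its exponents in decreasing order, the alternants in increasing order; the
    sign is common to numerator and denominator. *)
Lemma det_rev_columns N (x : 'I_N -> K) (g : nat -> K -> K) :
  \det (\matrix_(i < N, j < N) g (N - j.+1)%N (x i))
  = (-1) ^+ (perm (@rev_ord_inj N)) * \det (\matrix_(i < N, j < N) g j (x i)).
Proof.
set M := (X in _ * \det X).
have -> : \matrix_(i < N, j < N) g (N - j.+1)%N (x i) = col_perm (perm (@rev_ord_inj N)) M.
  by apply/matrixP => i j; rewrite !mxE permE.
by rewrite col_permE det_mulmx det_perm odd_permV mulrC.
Qed.

Lemma alt_det_den_neq0 (w : K) xs : separated w xs -> alt_det (@den_fun K) xs != 0.
Proof.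
elim: xs => [|y xs IH] sep; first by rewrite /alt_det det_mx00 oner_neq0.
have /IH IHs := separated_subseq (subseq_cons xs y) sep.
have /andP[n0 uyxs] := sep; move: n0; rewrite inE negb_or eq_sym => /andP[y0 n0].
have x0 : {in xs, forall x, x != 0} by move=> x xxs; apply: contraNneq n0 => <-.
rewrite alt_det_den_cons // !mulf_neq0 //.
  rewrite /den_fun /sym_pow !expr1 subr_eq0.
  have : uniq ([:: 1; -1] ++ [:: y] ++ [::] ++ [::]).
    apply: subseq_uniq uyxs; apply: cat_subseq => //; apply: cat_subseq.
      by rewrite sub1seq mem_head.
    by apply: cat_subseq; exact: sub0seq.
  rewrite /= !inE !negb_or => /and3P[/andP[_ y1] yN1 _].
  apply: contraNneq y1 => yV; have : (y - 1) * (y + 1) == 0.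
    by rewrite -subr_sqr expr1n expr2 {2}yV mulfV // subrr.
  by rewrite mulf_eq0 subr_eq0 addr_eq0 ![y == _]eq_sym (negPf yN1) orbF.
rewrite prodf_seq_neq0; apply/allP => x xxs /=.
have : uniq ([::] ++ [:: y; x] ++ [:: y^-1; x^-1] ++ [::]).
  apply: subseq_uniq uyxs; apply: cat_subseq => //; apply: cat_subseq.
    by rewrite /= eqxx sub1seq.
  apply: cat_subseq; last exact: sub0seq.
  by rewrite /= eqxx sub1seq map_f.
rewrite /= !inE !negb_or => /andP[/and3P[yx _ yxV] _].
have -> : x + x^-1 - y - y^-1 = (x - y) * (1 - (x * y)^-1).
  by field; rewrite y0 x0.
rewrite mulf_neq0 // subr_eq0 eq_sym // invr_eq1.
by apply: contraNneq yxV => xy; rewrite -[x^-1]mulr1 -xy mulKf ?x0.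
Qed.

End DetAux.

Lemma signed_ratio (K : fieldType) (s dn nm e c p : K) :
  s != 0 -> dn != 0 -> c * p != 0 -> e * dn = c * p * nm -> (s * nm) / (s * dn) = e / (c * p).
Proof.
move=> s0 d0 cp0 E; rewrite -mulf_div divff // mul1r; apply: (mulIf d0).
by rewrite divfK // mulrAC E mulrAC divff // mul1r.
Qed.

Lemma separated_map (L : fieldType) (I : finType) (X : I -> L) (w : L) :
  2 != 0 :> L -> w != 0 -> injective X -> (forall i, X i != 0) ->
  (forall i, [/\ X i != 1, X i != -1, X i != w & X i != - w]) ->
  (forall i j, [/\ X i * X j != 1, X i * X j != w & X i != w * X j]) ->
  separated w [seq X i | i <- enum I].
Proof.
move=> two w0 Xinj X0 Xc XX.
have u1 : uniq [seq X i | i <- enum I] by rewrite map_inj_uniq ?enum_uniq.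
apply/andP; split; first by apply/mapP => -[i _ /eqP]; rewrite eq_sym (negPf (X0 i)).
rewrite cat_uniq; apply/and3P; split.
- by rewrite /= andbT inE -subr_eq0 opprK.
- apply/hasPn => x; rewrite !mem_cat => /or3P[/mapP[i _ ->]|/mapP[_ /mapP[i _ ->] ->]|/mapP[_ /mapP[i _ ->] ->]];
    rewrite !inE negb_or; have [x1 xN1 xw xNw] := Xc i.
  + by rewrite x1.
  + by rewrite invr_eq1 x1 -(inj_eq invr_inj) invrK invrN1.
  + apply/andP; split.
      by apply: contraNneq xw => E; rewrite -[X i]mul1r -E mulfVK.
    apply: contraNneq xNw => E; have -> : w = - X i by rewrite -mulN1r -E mulfVK.
    by rewrite opprK.
rewrite !cat_uniq u1 map_inj_uniq ?u1 /=; last exact: invr_inj.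
rewrite map_inj_uniq ?u1 ?andbT; last by move=> x y /(mulfI w0)/invr_inj.
apply/andP; split.
  apply/hasPn => x; rewrite mem_cat => /orP[]/mapP[_ /mapP[i _ ->] ->]; apply/mapP => -[j _ E].
    by have [] := XX i j; rewrite -E mulfV ?X0 // eqxx.
  by have [_] := XX i j; rewrite -E mulrC mulfVK ?X0 // eqxx.
apply/hasPn => x /mapP[_ /mapP[i _ ->] ->]; apply/mapP => -[_ /mapP[j _ ->] E].
have [_ _ /eqP] := XX i j; apply.
by rewrite -(mulfVK (X0 i) w) E mulrAC mulVf ?mul1r.
Qed.

Section SymplecticValue.
Variables (F : fieldType) (n : nat) (w : F).
Hypotheses (hw : w * w = - 1 - w) (w1 : w != 1) (two : 2 != 0 :> F).
Local Notation N := (2 * n + 2)%N.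
Local Notation L := {fraction {mpoly F[N]}}.
Local Notation X := (@ratX F N).
Local Notation wL := (ratC F N w).
Let w0 : w != 0 := cube_root_neq0 hw.

Lemma separated_ratX : separated wL [seq X i | i <- enum 'I_N].
Proof.
have XC c i : c != 0 -> X i != ratC F N c.
  by move=> c0; exact: (@ratX_neqC F N c i 1 c0 isT).
have XXC c i j : c != 0 -> X i * X j != ratC F N c.
  by move=> c0; exact: (@ratX_monomial_neqC F N c i j 1 1 c0 isT).
apply: separated_map.
- by rewrite -(rmorph_nat (ratC F N)) fmorph_eq0.
- by rewrite fmorph_eq0.
- by move=> i j E; exact: (@ratX_inj F N i j 1 isT E).
- exact: ratX_neq0.
- move=> i; rewrite -(rmorph1 (ratC F N)) -!rmorphN; split; apply: XC => //.
  + exact: oner_neq0.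
  + by rewrite oppr_eq0 oner_neq0.
  + by rewrite oppr_eq0.
move=> i j; split; [|exact: XXC|].
  by rewrite -(rmorph1 (ratC F N)); apply: XXC; exact: oner_neq0.
apply/eqP => E; have [_ /eqP] := @ratX_expr_eq F N w i j 1 isT E.
by rewrite (negPf w1).
Qed.

Lemma symplectic_character_fraction :
  symplectic_character F (@double_staircase n)
  = (ice_pf (w%:MP : {mpoly F[N]}) 0 false [seq 'X_i | i <- enum 'I_N])%:F
    / ((det_const w n.+1)%:MP * (\prod_(i < N) 'X_i) ^+ n.+1 : {mpoly F[N]})%:F.
Proof.
have numE : \det (\matrix_(i < N, j < N) (X i ^+ (double_staircase j + (N - j))
      - X i ^- (double_staircase j + (N - j))))
    = (-1) ^+ (perm (@rev_ord_inj N)) * alt_det (@num_fun L) [seq X i | i <- enum 'I_N].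
  rewrite alt_det_map -det_rev_columns; congr (\det _); apply/matrixP => i j.
  rewrite !mxE /num_fun /sym_pow /double_staircase.
  have -> // : (n - j./2 + (N - j) = (3 * (N - j.+1) + 2)./2)%N by case: j => j /=; lia.
have denE : \det (\matrix_(i < N, j < N) (X i ^+ (N - j) - X i ^- (N - j)))
    = (-1) ^+ (perm (@rev_ord_inj N)) * alt_det (@den_fun L) [seq X i | i <- enum 'I_N].
  rewrite alt_det_map -det_rev_columns; congr (\det _); apply/matrixP => i j.
  rewrite !mxE /den_fun /sym_pow.
  have -> // : (N - j = (N - j.+1).+1)%N by case: j => j /=; lia.
rewrite /symplectic_character numE denE.
have hwL : wL * wL = -1 - wL by rewrite -rmorphM hw rmorphB rmorphN1.
have sepX := separated_ratX; have X0 := @ratX_neq0 F N.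
have cE : det_const wL n.+1 = ratC F N (det_const w n.+1).
  by rewrite /det_const rmorphM !rmorphXn rmorphB rmorph1.
have pE : \prod_(x <- [seq X i | i <- enum 'I_N]) x
    = ((\prod_(i < N) 'X_i : {mpoly F[N]}))%:F.
  by rewrite big_map big_enum rmorph_prod.
have EE : even_pf wL [seq X i | i <- enum 'I_N]
    = (ice_pf (w%:MP : {mpoly F[N]}) 0 false [seq 'X_i | i <- enum 'I_N])%:F.
  by rewrite /even_pf rmorph_ice_pf rmorph0 (map_comp (@FracField.tofrac _) (fun i => 'X_i)).
have szX : size [seq X i | i <- enum 'I_N] = (2 * n).+2.
  by rewrite size_map size_enum_ord addn2.
have dX0 : alt_det (@den_fun L) [seq X i | i <- enum 'I_N] != 0 := alt_det_den_neq0 sepX.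
have P0 : (\prod_(i < N) 'X_i : {mpoly F[N]})%:F != 0.
  by rewrite rmorph_prod prodf_seq_neq0; apply/allP => i _; exact: X0.
have c0 : ratC F N (det_const w n.+1) != 0.
  by rewrite fmorph_eq0 /det_const mulf_neq0 ?expf_neq0 // subr_eq0 eq_sym.
have sgn0 : (-1) ^+ (perm (@rev_ord_inj N)) != 0 :> L by rewrite signr_eq0.
have hE : ((det_const w n.+1)%:MP * (\prod_(i < N) 'X_i) ^+ n.+1 : {mpoly F[N]})%:F
    = ratC F N (det_const w n.+1) * (\prod_(i < N) 'X_i : {mpoly F[N]})%:F ^+ n.+1.
  by rewrite -tofracXn; exact: tofracM.
rewrite hE; apply: (signed_ratio sgn0 dX0 (mulf_neq0 c0 (expf_neq0 _ P0))).
by have := even_pf_det_list hwL szX sepX; rewrite EE pE cE.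
Qed.

(** The denominator found above is a monomial up to a constant, so that fraction witnesses
    regularity even where both determinants vanish. *)
Lemma sp_double_staircase (a : 'I_N -> F) : (forall i, a i != 0) ->
  sp (@double_staircase n) a
  = even_pf w [seq a i | i <- enum 'I_N] / (det_const w n.+1 * (\prod_i a i) ^+ n.+1).
Proof.
move=> a0; have cst0 : det_const w n.+1 != 0.
  by rewrite /det_const mulf_neq0 ?expf_neq0 // subr_eq0 eq_sym.
have aE : (\prod_i 'X_i : {mpoly F[N]}).@[a] = \prod_i a i.
  by rewrite rmorph_prod; apply: eq_bigr => i _; rewrite /= mevalXU.
have V : is_value_at (symplectic_character F (@double_staircase n)) a
  (even_pf w [seq a i | i <- enum 'I_N] / (det_const w n.+1 * (\prod_i a i) ^+ n.+1)).
  rewrite symplectic_character_fraction; do 2 eexists; split; first by [].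
    rewrite mevalM mevalC rmorphXn /= aE mulf_neq0 // expf_neq0 //.
    by rewrite prodf_seq_neq0; apply/allP => i _; exact: a0.
  rewrite mevalM mevalC rmorphXn /= aE rmorph_ice_pf /= mevalC meval0 -map_comp.
  by congr (_ / _); congr ice_pf; apply: eq_map => i /=; rewrite mevalXU.
apply: (is_value_at_unique _ V).
exact: (ClassicalEpsilon.epsilon_spec (inhabits 0) _ (ex_intro _ _ V)).
Qed.

End SymplecticValue.

(** The remainder modulo ['X] is a constant and does not reach the coefficient of index 1. *)
Lemma horner0_divX (F : fieldType) (p : {poly F}) : (p %/ 'X).[0] = p`_1.
Proof.
rewrite horner_coef0 [in RHS](divp_eq p 'X) coefD coefMX /=.
rewrite [X in _ + X]nth_default ?addr0 //.
have : (size (p %% 'X)%R < size ('X : {poly F}))%N by rewrite ltn_modp polyX_eq0.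
by rewrite size_polyX ltnS.
Qed.

(** * Specialisation to an inversion-closed list *)

Section ClosedList.
Variables (K : fieldType) (n : nat) (q : K) (u : 'I_n -> K).
Hypothesis hq : q ^+ 2 + q ^- 2 = 1.
Hypotheses (two_neq0 : 2 != 0 :> K) (three_neq0 : 3 != 0 :> K).
Let w := q ^+ 4.
Hypothesis u0 : forall i, u i != 0.
(** This and the next three conditions make the squares, their inverses and 1 [generic], keep -1 and
    [- w] out of them, and make the denominators of the final formula non-zero. *)
Hypothesis u_const : forall i c, c \in [:: 1; -1; w; - w; w^-1; - w^-1] -> u i ^+ 2 != c.
Hypothesis u_prod : forall i j c, c \in [:: 1; w; w^-1] -> u i ^+ 2 * u j ^+ 2 != c.
Hypothesis u_inj : forall i j, u i ^+ 2 = u j ^+ 2 -> i = j.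
Hypothesis u_ratio : forall i j, u i ^+ 2 != w * u j ^+ 2.

Definition closed_list : seq K :=
  [seq u i | i <- enum 'I_n] ++ [seq (u i)^-1 | i <- enum 'I_n] ++ [:: 1].
Definition closed_squares : seq K := [seq x ^+ 2 | x <- closed_list].
Local Notation us := closed_list.
Local Notation xs := closed_squares.
Local Notation E := (even_pf w).

Let hw : w * w = -1 - w := gauge_cube_root hq.
Let w0 : w != 0 := cube_root_neq0 hw.
Let w1 : 1 - w != 0 := gauge_1Bw_neq0 hq three_neq0.

Lemma closed_list_size : size us = (2 * n).+1.
Proof.
have sz (f : 'I_n -> K) : size (map f (enum 'I_n)) = n by rewrite size_map size_enum_ord.
by rewrite !size_cat !sz /=; lia.
Qed.

Lemma map_closed_squares (T : Type) (f : K -> T) : map f xs =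
  [seq f (u i ^+ 2) | i <- enum 'I_n] ++ [seq f (u i ^- 2) | i <- enum 'I_n] ++ [:: f 1].
Proof.
rewrite -map_comp /us !map_cat.
rewrite -(map_comp (f \o _) u) -(map_comp (f \o _) (fun i => (u i)^-1)).
rewrite /= expr1n; congr (_ ++ (_ ++ _)).
by apply: eq_map => i /=; rewrite exprVn.
Qed.

Lemma prod_map_enum (g : 'I_n -> K) :
  \prod_(x <- [seq g i | i <- enum 'I_n]) x = \prod_i g i.
Proof. by rewrite big_map big_enum. Qed.

Lemma prod_closed_squares (f : K -> K) :
  \prod_(x <- xs) f x = f 1 * \prod_(i < n) (f (u i ^+ 2) * f (u i ^- 2)).
Proof.
rewrite -(big_map f xpredT id) map_closed_squares big_cat big_cat /= big_seq1 !prod_map_enum.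
by rewrite mulrA -big_split mulrC.
Qed.

Lemma prod_closed_list : \prod_(x <- us) x = 1.
Proof.
rewrite big_cat big_cat /= big_seq1 !prod_map_enum mulr1 -big_split big1 // => i _.
by rewrite /= mulfV.
Qed.

Lemma mem_closed_squares x : x \in xs ->
  [\/ exists i, x = u i ^+ 2, exists i, x = u i ^- 2 | x = 1].
Proof.
rewrite -[xs]map_id map_closed_squares !mem_cat => /or3P[/mapP[i _ ->]|/mapP[i _ ->]|].
- by constructor 1; exists i.
- by constructor 2; exists i.
- by rewrite inE => /eqP ->; constructor 3.
Qed.

Let u_constV i c : c^-1 \in [:: 1; -1; w; - w; w^-1; - w^-1] -> u i ^- 2 != c.
Proof. by move=> cw; rewrite -(inj_eq invr_inj) invrK; exact: u_const. Qed.

Lemma closed_squares_notin c : c != 1 -> c \in [:: 1; -1; w; - w; w^-1; - w^-1] ->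
  c^-1 \in [:: 1; -1; w; - w; w^-1; - w^-1] -> c \notin xs.
Proof.
move=> c1 cw cVw; apply/negP => /mem_closed_squares[[i ci]|[i ci]|ci].
- by have := u_const i cw; rewrite ci eqxx.
- by have := u_constV i cVw; rewrite ci eqxx.
- by rewrite ci eqxx in c1.
Qed.

Lemma closed_squares_generic : generic w xs.
Proof.
have wn1 : 1 != w by rewrite -subr_eq0.
have n1 : 1 \in [:: 1; -1; w; - w; w^-1; - w^-1] by rewrite inE eqxx.
have nw : w \in [:: 1; -1; w; - w; w^-1; - w^-1] by rewrite !inE eqxx !orbT.
have nwV : w^-1 \in [:: 1; -1; w; - w; w^-1; - w^-1] by rewrite !inE eqxx !orbT.
have nwVV : w^-1^-1 \in [:: 1; -1; w; - w; w^-1; - w^-1] by rewrite invrK.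
have n1V : 1^-1 \in [:: 1; -1; w; - w; w^-1; - w^-1] by rewrite invr1.
have sq0 i : u i ^+ 2 != 0 by rewrite expf_neq0.
apply/and3P; split.
- rewrite -[xs]map_id map_closed_squares.
  rewrite !cat_uniq map_inj_uniq ?enum_uniq //= map_inj_uniq ?enum_uniq /=; last first.
    by move=> i j /invr_inj/u_inj.
  rewrite andbT orbF; apply/andP; split.
    rewrite has_cat /= orbF negb_or; apply/andP; split.
      apply/hasPn => _ /mapP[i _ ->]; apply/mapP => -[j _ E].
      by have := @u_prod j i 1 (mem_head _ _); rewrite -E mulVf ?eqxx.
    by apply/mapP => -[i _ E]; have := u_const i n1; rewrite -E eqxx.
  by apply/mapP => -[i _ E]; have := u_constV i n1V; rewrite -E eqxx.
- apply/negP => /mem_closed_squares[[i /eqP]|[i /eqP]|/eqP]; rewrite eq_sym ?invr_eq0.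
  + by rewrite (negPf (sq0 i)).
  + by rewrite (negPf (sq0 i)).
  + by rewrite oner_eq0.
have wVC i j : u i ^+ 2 * u j ^- 2 != w.
  by apply: contraNneq (u_ratio i j) => <-; rewrite divfK.
apply/allP => x xxs; apply/allP => y yxs.
case: (mem_closed_squares xxs) (mem_closed_squares yxs)
  => [[i ->]|[i ->]|->] [[j ->]|[j ->]|->].
- by apply: u_prod; rewrite !inE eqxx orbT.
- exact: wVC.
- by rewrite mulr1 u_const.
- by rewrite mulrC wVC.
- by rewrite -invfM -(inj_eq invr_inj) invrK; apply: u_prod; rewrite !inE eqxx !orbT.
- by rewrite mulr1 u_constV.
- by rewrite mul1r u_const.
- by rewrite mul1r u_constV.
- by rewrite mulr1.
Qed.

Lemma closed_squares_inv : perm_eq (map GRing.inv xs) xs.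
Proof.
rewrite -[X in perm_eq _ X]map_id !map_closed_squares invr1.
rewrite (eq_map (fun i => invrK (u i ^+ 2))) perm_catCA perm_refl //.
Qed.

(** The arguments have product 1, so the gauge factor reduces to one [1 - w] for each of the
    [n * (2 * n).+1] pairs of lines. *)
Lemma odd_pf_closed_list : odd_pf w xs = (1 - w) ^+ (n * (2 * n).+1)
  * (Ztilde (2 * n + 1) q us)`_1.
Proof.
have us0 : {in us, forall v, v != 0}.
  move=> v; rewrite !mem_cat => /or3P[/mapP[i _ ->]|/mapP[i _ ->]|] //.
    by rewrite invr_eq0.
  by rewrite inE => /eqP ->; exact: oner_neq0.
have sz : size us = (2 * n + 1)%N by rewrite closed_list_size addn1.
rewrite (Ztilde_state_sum q sz) -sz.
have := state_sum_gauge hq three_neq0 us0 (size_nseq (size us) false).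
rewrite prod_closed_list expr1n mulr1 closed_list_size.
have -> : top_factor us (nseq (2 * n).+1 false) = 1.
  by rewrite -closed_list_size; elim: (us) => //= v s ->; rewrite mulr1.
have -> : 'C((2 * n).+1, 2) = (n * (2 * n).+1)%N.
  by rewrite bin2 /= mulnC -mulnA mul2n doubleK mulnC.
rewrite mulr1 => gauge.
rewrite /odd_pf /ice_pf !size_map closed_list_size -coefCM -gauge.
by rewrite /xs -map_comp.
Qed.

Let r i := (u i + (u i)^-1) ^+ 2.
Let p i := u i ^+ 2 + (u i)^-1 ^+ 2 - 1.

Let N1_notin : -1 \notin xs.
Proof.
apply: closed_squares_notin; rewrite ?invrN1 ?inE ?eqxx ?orbT //.
by rewrite eq_sym -subr_eq0 opprK.
Qed.

Let Nw_notin : - w \notin xs.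
Proof.
apply: closed_squares_notin; rewrite ?invrN ?inE ?eqxx ?orbT //.
rewrite eqr_oppLR; apply: contra_eq_neq hw => ->.
by rewrite mulrNN mulr1 opprK addNr oner_neq0.
Qed.

Let p_neq0 i : p i != 0.
Proof.
have x1 : u i ^+ 2 + w != 0.
  by rewrite addr_eq0; apply: u_const; rewrite !inE eqxx !orbT.
have x2 : u i ^+ 2 + w^-1 != 0.
  by rewrite addr_eq0; apply: u_const; rewrite !inE eqxx !orbT.
have -> : p i = (u i ^+ 2 + w) * (u i ^+ 2 + w^-1) / u i ^+ 2.
  by rewrite /p; field: hw; rewrite w0 u0.
by rewrite !mulf_neq0 ?invr_eq0 ?expf_neq0.
Qed.

Let sq1_neq0 i : u i ^+ 2 + 1 != 0.
Proof. by rewrite addr_eq0; apply: u_const; rewrite !inE eqxx !orbT. Qed.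

Let r_neq0 i : r i != 0.
Proof.
have -> : r i = ((u i ^+ 2 + 1) / u i) ^+ 2 by rewrite /r; field.
by rewrite expf_neq0 // mulf_neq0 ?invr_eq0.
Qed.

(** The power of 3 arises from [(1 - w) ^+ 2 = - 3 * w] raised to [n ^ 2]. The last factor [-1] is
    [w * - (w * w)], where [- (w * w)] belongs to the argument 1. *)
Lemma det_const_closed :
  det_const w n.+1 * (-1) ^+ n.+1 * 3 ^+ (n ^ 2) * -1
  = (1 - w) * w ^+ n * (1 - w) ^+ (n * (2 * n).+1).
Proof.
have -> : (n * (2 * n).+1 = 2 * n ^ 2 + n)%N by rewrite mulnS mulnCA mulnn addnC.
rewrite exprD exprM (gauge_1Bw_sqr hq) [(- 3 * w) ^+ _]exprMn (exprNn 3).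
have -> : (-1) ^+ (n ^ 2) = (-1) ^+ n :> K by rewrite -signr_odd oddX /= signr_odd.
rewrite /det_const /= mulSn -mulnn exprD !exprS; ring.
Qed.

Lemma Ztilde_closed_list : (Ztilde (2 * n + 1) q us)`_1
  = 3 ^- (n ^ 2) * \prod_(i < n) (r i / p i)
    * (E (-1 :: xs) / (det_const w n.+1 * (-1) ^+ n.+1)).
Proof.
have prod1 : \prod_(x <- xs) x = 1.
  rewrite (prod_closed_squares id) mul1r big1 // => i _.
  by rewrite mulfV // expf_neq0.
have sz : size xs = (2 * n).+1 by rewrite size_map closed_list_size.
have := even_odd_pf_closed hw sz closed_squares_generic closed_squares_inv prod1 N1_notin Nw_notin.
set P := \prod_(i < n) p i; set Q := \prod_(i < n) r i.
have -> : \prod_(x <- xs) rho w true x = P.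
  rewrite prod_closed_squares /rho mulr1 addrK mul1r; apply: eq_bigr => i _.
  by rewrite /p; field: hw.
(* The argument 1 gives [- (w * w) / 2], whose 2 cancels the one from averaging; each pair [u ^+ 2],
   [u ^- 2] gives [w * p ^+ 2 / r]. *)
have -> : \prod_(x <- xs) (pairw w x (-1) / (x + 1)) = - (w * w) / 2 * (w ^+ n * (P ^+ 2 / Q)).
  rewrite prod_closed_squares; congr (_ * _).
    by rewrite /pairw; field: hw.
  transitivity (\prod_(i < n) (w * (p i ^+ 2 / r i))).
    apply: eq_bigr => i _; have s1 := sq1_neq0 i; have := r_neq0 i.
    have -> : r i = ((u i ^+ 2 + 1) / u i) ^+ 2 by rewrite /r; field.
    have -> : u i ^- 2 + 1 = (u i ^+ 2 + 1) / u i ^+ 2 by field.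
    by rewrite /pairw /p => _; field: hw; rewrite s1 u0.
  by rewrite big_split prodr_const card_ord /= prodf_div prodrXl.
have P0 : P != 0 by rewrite prodf_seq_neq0; apply/allP => i _; exact: p_neq0.
have Q0 : Q != 0 by rewrite prodf_seq_neq0; apply/allP => i _; exact: r_neq0.
rewrite odd_pf_closed_list prodf_div -/P -/Q; set Z := _`_1; set EE := E _ => eqE.
have T0 : 3 ^+ (n ^ 2) != 0 :> K by rewrite expf_neq0.
have D0 : det_const w n.+1 * (-1) ^+ n.+1 != 0.
  by rewrite mulf_neq0 ?signr_eq0 //; exact: mulf_neq0 (expf_neq0 _ w1) (expf_neq0 _ w0).
move: det_const_closed eqE; rewrite -/Z.
move: (_ * (-1) ^+ n.+1) D0 (3 ^+ (n ^ 2)) T0 => D D0 T T0.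
move: (w ^+ n) ((1 - w) ^+ _) => W A cst eqE.
have DT : D * T = - ((1 - w) * W * A) by rewrite -cst mulrN1 opprK.
have EE' : EE = D * T * (P / Q) * Z.
  by apply: (mulfI P0); rewrite eqE DT; field: hw; rewrite ?P0 ?Q0 ?two_neq0.
by rewrite EE'; field; rewrite P0 Q0 D0 T0.
Qed.

Let ys : seq K :=
  [seq u i ^+ 2 | i <- enum 'I_n] ++ [seq (u i)^-1 ^+ 2 | i <- enum 'I_n] ++ [:: 1; -1].

Lemma Ztilde_sp : (Ztilde (2 * n + 1) q us %/ 'X).[0]
  = 3 ^- (n ^ 2)
    * \prod_(i < n) ((u i + (u i)^-1) ^+ 2 / (u i ^+ 2 + (u i)^-1 ^+ 2 - 1))
    * sp (@double_staircase n) (fun k => ys`_k).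
Proof.
have ysE : ys = xs ++ [:: -1].
  rewrite -[xs]map_id map_closed_squares -!catA /ys; congr (_ ++ (_ ++ _)).
  by apply: eq_map => i; rewrite exprVn.
have sz : size ys = (2 * n + 2)%N.
  by rewrite ysE size_cat size_map closed_list_size /= addn1 addn2.
have eys : map (fun k : 'I_(2 * n + 2) => ys`_k) (enum 'I_(2 * n + 2)) = ys.
  rewrite -[RHS](mkseq_nth 0) sz /mkseq -val_enum_ord -map_comp.
  by apply: eq_map.
have ys0 k : (k < 2 * n + 2)%N -> ys`_k != 0.
  rewrite -sz => /(mem_nth 0); rewrite {2}ysE mem_cat inE => /orP[kxs|/eqP ->].
    have [_ x0 _] := genericP closed_squares_generic; exact: x0.
  by rewrite oppr_eq0 oner_neq0.
rewrite horner0_divX Ztilde_closed_list (@sp_double_staircase _ _ w) //; last 2 first.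
- by rewrite eq_sym -subr_eq0.
- by move=> k; apply: ys0.
(* By symmetry of [E] the argument [-1] may stand last; the product of all arguments is [-1], which
   accounts for [(-1) ^+ n.+1]. *)
rewrite eys; congr (_ * (_ / (_ * _ ^+ _))).
  by apply: even_pf_perm => //; rewrite ysE -cat1s perm_catC.
rewrite -(big_enum) -(big_map _ xpredT id) eys ysE big_cat big_seq1 /=.
rewrite (prod_closed_squares id) mul1r big1 ?mul1r // => i _.
by rewrite mulfV // expf_neq0.
Qed.

End ClosedList.

(** * Independent indeterminates over the complex numbers *)

Unset Implicit Arguments.

Theorem theorem4p1 (R : realType) (n : nat) (q : R[i])
    (hq : q ^+ 2 + q ^- 2 = 1) :
  (* the field of rational functions in the indeterminates u_1, ..., u_n *)
  let K : fieldType := {fraction {mpoly R[i][n]}} in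
  let u (i : 'I_n) : K := ('X_i : {mpoly R[i][n]})%:F in
  let qK : K := (q%:MP : {mpoly R[i][n]})%:F in
  let us : seq K :=
    [seq u i | i <- enum 'I_n] ++ [seq (u i)^-1 | i <- enum 'I_n] ++ [:: 1] in
  let xs : seq K :=
    [seq u i ^+ 2 | i <- enum 'I_n] ++ [seq (u i)^-1 ^+ 2 | i <- enum 'I_n]
      ++ [:: 1; -1] in
  (Ztilde (2 * n + 1) qK us %/ 'X).[0]
  = 3 ^- (n ^ 2)
    * \prod_(i < n) ((u i + (u i)^-1) ^+ 2 / (u i ^+ 2 + (u i)^-1 ^+ 2 - 1))
    * sp (@double_staircase n) (fun k => xs`_k).
Proof.
move=> K u qK us xs; pose C := ratC R[i] n.
have wroot := gauge_cube_root hq.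
have three : 3 != 0 :> R[i] by rewrite Num.Theory.pnatr_eq0.
have two : 2 != 0 :> R[i] by rewrite Num.Theory.pnatr_eq0.
have w0 : q ^+ 4 != 0 := cube_root_neq0 wroot.
have w1 : q ^+ 4 != 1.
  by have := gauge_1Bw_neq0 hq three; rewrite subr_eq0 eq_sym.
have qKw : qK ^+ 4 = C (q ^+ 4) by rewrite rmorphXn.
have N10 : -1 != 0 :> R[i] by rewrite oppr_eq0 oner_neq0.
(* All excluded values are non-zero constants, and no monomial of positive degree in the
   indeterminates is a constant. *)
have CP (c : K) : c \in [:: 1; -1; qK ^+ 4; - qK ^+ 4; (qK ^+ 4)^-1; - (qK ^+ 4)^-1] ->
    exists2 c', c' != 0 & c = C c'.
  have W0 : (q ^+ 4)^-1 != 0 by rewrite invr_eq0.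
  have Cw (d : R[i]) : d != 0 -> exists2 c', c' != 0 & C d = C c' by exists d.
  rewrite qKw -(rmorph1 C) -(fmorphV C) -!(rmorphN C) !inE.
  case/orP => [/eqP ->|]; first by apply: Cw; rewrite oner_neq0.
  case/orP => [/eqP ->|]; first by apply: Cw.
  case/orP => [/eqP ->|]; first by apply: Cw.
  case/orP => [/eqP ->|]; first by apply: Cw; rewrite oppr_eq0.
  by case/orP => /eqP ->; apply: Cw; rewrite ?oppr_eq0.
have sub (T : eqType) (a a' b b' c c' x : T) :
    x \in [:: a; b; c] -> x \in [:: a; a'; b; b'; c; c'].
  by rewrite !inE => /or3P[] ->; rewrite ?orbT.
apply: (@Ztilde_sp K n qK u).
- by rewrite -(rmorphXn C) -(fmorphV C) -(rmorphD C) hq (rmorph1 C).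
- by rewrite -(rmorph_nat C) (fmorph_eq0 C).
- by rewrite -(rmorph_nat C) (fmorph_eq0 C).
- by move=> i; exact: ratX_neq0.
- by move=> i c /CP[c' c0 ->]; exact: ratX_neqC.
- move=> i j c cin; have [|c' c0 ->] := CP c; last exact: ratX_monomial_neqC.
  exact: sub cin.
- by move=> i j; exact: ratX_inj.
- move=> i j; apply/eqP; rewrite qKw => E.
  by have [_ /eqP] := ratX_expr_eq (isT : (0 < 2)%N) E; rewrite (negPf w1).
Qed.
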